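(* If $\mathrm{Re}\,\lambda\ge\rho$ (i.e. $\lambda\in\mathfrak a_{\mathbb C}^*(a_P)$), then $A(\lambda)=\mathcal S^\lambda$ as operators on $C^\infty(\mathcal B)$.
   Context: $\mathbb K$ is $\mathbb R$, $\mathbb C$ or the quaternions $\mathbb H$, $d=\dim_{\mathbb R}\mathbb K$, $p=q\ge1$, $n+1=2p$, $\rho=d(n+1)/2=dp$. For a square matrix $x$ over $\mathbb K$, $|\det x|=|\det_{\mathbb R}x|^{1/d}$. $G=\mathrm{SL}(2p,\mathbb K)$, $\theta(x)=(x^* )^{-1}$, $K=\{x\in G:x^*=x^{-1}\}$, $H_o=\mathrm{diag}(\tfrac12I_p,-\tfrac12I_p)$, $A=\exp(\mathbb RH_o)$, $M$ the group of block diagonal $\mathrm{diag}(a,b)\in G$ with $a,b\in\mathrm{GL}(p,\mathbb K)$, $|\det a|=|\det b|=1$, $N=\left\{\begin{pmatrix}I_p&X\\ 0&I_p\end{pmatrix}\right\}$, $\overline N=\theta(N)$, $P=MAN$. $\mathcal B=\mathrm{Gr}_p(\mathbb K)$ is the manifold of $p$-dimensional $\mathbb K$-subspaces of $\mathbb K^{2p}$ (right subspaces when $\mathbb K=\mathbb H$), $b_o=\mathbb Ke_1\oplus\dots\oplus\mathbb Ke_p$, $\mathcal B=K/L=G/P$ with $L=K\cap P$, $db$ the $K$-invariant probability measure. Each $g\in G$ is $g=k(g)m(g)a(g)n(g)\in KMAN$ with $a(g)\in A$ unique; for $a=\exp(sH_o)$ and $\lambda\in\mathbb C$, $a^\lambda=\exp(s\lambda\tfrac{p}{2})$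 (this identifies $\mathfrak a^*_{\mathbb C}$ with $\mathbb C$, half the sum of positive roots corresponding to $\rho=dp$; the set $\mathfrak a_{\mathbb C}^*(a_P)$ of the paper is then $\{\mathrm{Re}\,\lambda\ge\rho\}$). $J(\lambda)f(k\cdot b_o)=\int_{\overline N}a(\bar n)^{-\lambda-\rho}f(k\bar n\cdot b_o)\,d\bar n$, with Haar measure normalized by $\int_{\overline N}a(\bar n)^{-2\rho}d\bar n=1$. Let $w=\begin{pmatrix}0&-I_p\\ I_p&0\end{pmatrix}\in K$ and $A(\lambda)f(k\cdot b_o):=(J(\lambda)f)(kw\cdot b_o)$ (well defined because $w^{-1}Lw=L$). For $b,c\in\mathcal B$, $|\mathrm{Cos}(b,c)|:=\mathrm{Vol}_{\mathbb R}(P_c(E))^{1/d}$, where $E\subset b$ is a convex subset containing $0$ of ($dp$-dimensional Euclidean) volume one and $P_c$ is the orthogonal projection onto $c$ (independent of $E$). $\mathcal C^\lambda(f)(c)=\int_{\mathcal B}|\mathrm{Cos}(b,c)|^{\lambda-\rho}f(b)\,db$, and the $\mathrm{Sin}^\lambda$-transform is $\mathcal S^\lambda(f)(\omega):=\mathcal C^\lambda(f)(\omega^\perp)$, $\omega^\perp$ the orthogonal complement of $\omega\in\mathcal B$. *)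

(* Defs.v *)
From HB Require Import structures.
From mathcomp Require Import all_boot all_order all_algebra.
From mathcomp Require Import ring.
From mathcomp Require Import complex.
From mathcomp Require Import all_classical all_reals all_analysis.
Set Implicit Arguments.
Unset Strict Implicit.
Unset Printing Implicit Defensive.
Import Order.TTheory GRing.Theory Num.Theory.
Import numFieldNormedType.Exports.
Local Open Scope classical_set_scope.
Local Open Scope complex_scope.
Local Open Scope ring_scope.

(* Hamilton's quaternions a + b i + c j + d k. *)
Record quaternion (R : Type) :=
  Quaternion { quat_re : R; quat_i : R; quat_j : R; quat_k : R }.

Definition prod_of_quat (R : Type) (x : quaternion R) : R * R * R * R :=
  let: Quaternion a b c d := x in (a, b, c, d).
Definition quat_of_prod (R : Type) (x : R * R * R * R) : quaternion R :=
  let: (a, b, c, d) := x in Quaternion a b c d.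
Lemma prod_of_quatK (R : Type) : cancel (@prod_of_quat R) (@quat_of_prod R).
Proof. by case. Qed.

HB.instance Definition _ (R : choiceType) :=
  Choice.copy (quaternion R) (can_type (@prod_of_quatK R)).

Section QuaternionRing.
Context {R : comNzRingType}.
Implicit Types x y z : quaternion R.

Definition quat_zero : quaternion R := Quaternion 0 0 0 0.
Definition quat_one : quaternion R := Quaternion 1 0 0 0.
Definition quat_opp x :=
  let: Quaternion a b c d := x in Quaternion (- a) (- b) (- c) (- d).
Definition quat_add x y :=
  let: Quaternion a b c d := x in
  let: Quaternion a' b' c' d' := y in
  Quaternion (a + a') (b + b') (c + c') (d + d').
Definition quat_mul x y :=
  let: Quaternion a b c d := x in
  let: Quaternion a' b' c' d' := y in
  Quaternion (a * a' - b * b' - c * c' - d * d')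
             (a * b' + b * a' + c * d' - d * c')
             (a * c' - b * d' + c * a' + d * b')
             (a * d' + b * c' - c * b' + d * a').

Fact quat_addA : associative quat_add.
Proof. by do 3!case=> ????; rewrite /= !addrA. Qed.
Fact quat_addC : commutative quat_add.
Proof. by do 2!case=> ????; congr Quaternion; rewrite addrC. Qed.
Fact quat_add0 : left_id quat_zero quat_add.
Proof. by case=> ????; rewrite /= !add0r. Qed.
Fact quat_addN : left_inverse quat_zero quat_opp quat_add.
Proof. by case=> ????; rewrite /= !addNr. Qed.

HB.instance Definition _ := GRing.isZmodule.Build (quaternion R)
  quat_addA quat_addC quat_add0 quat_addN.

Fact quat_mulA : associative quat_mul.
Proof. by do 3!case=> ????; congr Quaternion; ring. Qed.
Fact quat_mul1l : left_id quat_one quat_mul.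
Proof. by case=> ????; congr Quaternion; ring. Qed.
Fact quat_mul1r : right_id quat_one quat_mul.
Proof. by case=> ????; congr Quaternion; ring. Qed.
Fact quat_mulDl : left_distributive quat_mul quat_add.
Proof. by do 3!case=> ????; congr Quaternion; ring. Qed.
Fact quat_mulDr : right_distributive quat_mul quat_add.
Proof. by do 3!case=> ????; congr Quaternion; ring. Qed.
Fact quat_one_neq0 : quat_one != 0.
Proof. by apply/eqP => -[] /eqP; rewrite oner_eq0. Qed.

HB.instance Definition _ := GRing.Zmodule_isNzRing.Build (quaternion R)
  quat_mulA quat_mul1l quat_mul1r quat_mulDl quat_mulDr quat_one_neq0.

Definition quat_conj x :=
  let: Quaternion a b c d := x in Quaternion a (- b) (- c) (- d).

End QuaternionRing.

Variant division_algebra := Reals | Complexes | Quaternions.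

Definition real_dim (k : division_algebra) : nat :=
  match k with Reals => 1 | Complexes => 2 | Quaternions => 4 end.

Section Scalars.
Context {R : realType}.

Definition scalar_ring (k : division_algebra) : nzRingType :=
  match k with
  | Reals => R
  | Complexes => R[i]
  | Quaternions => quaternion R
  end.

Definition scalars (k : division_algebra) : Type := scalar_ring k.
HB.instance Definition _ k := GRing.NzRing.copy (scalars k) (scalar_ring k).

Definition conjs (k : division_algebra) : scalars k -> scalars k :=
  match k return scalars k -> scalars k with
  | Reals => id
  | Complexes => @conjc R
  | Quaternions => @quat_conj R
  end.

Definition of_real (k : division_algebra) : R -> scalars k :=
  match k return R -> scalars k with
  | Reals => id
  | Complexes => fun r => r%:C
  | Quaternions => fun r => Quaternion r 0 0 0
  end.

(* Coordinates in the real bases (1), (1, i), (1, i, j, k). *)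
Definition to_coord (k : division_algebra) :
    scalars k -> 'rV[R]_(real_dim k) :=
  match k return scalars k -> 'rV[R]_(real_dim k) with
  | Reals => fun x => \row_j x
  | Complexes => fun z => \row_j [:: complex.Re z; complex.Im z]`_j
  | Quaternions => fun q =>
      \row_j [:: quat_re q; quat_i q; quat_j q; quat_k q]`_j
  end.

Definition of_coord (k : division_algebra) :
    'rV[R]_(real_dim k) -> scalars k :=
  match k return 'rV[R]_(real_dim k) -> scalars k with
  | Reals => fun v => v 0 0
  | Complexes => fun v => v 0 0 +i* v 0 (inord 1)
  | Quaternions => fun v =>
      Quaternion (v 0 0) (v 0 (inord 1)) (v 0 (inord 2)) (v 0 (inord 3))
  end.

Lemma to_coordK k : cancel (@to_coord k) (@of_coord k).
Proof.
case: k => /= [x|[a b]|[a b c d]]; rewrite !mxE //=.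
- by rewrite inordK.
- by rewrite !inordK.
Qed.

Lemma of_coordK k : cancel (@of_coord k) (@to_coord k).
Proof.
case: k => v; apply/rowP => j; rewrite mxE //=.
- by rewrite ord1.
- by case: j => -[|[|//]] h /=; congr (v 0 _); apply: val_inj; rewrite /= ?inordK.
- by case: j => -[|[|[|[|//]]]] h /=; congr (v 0 _); apply: val_inj;
    rewrite /= ?inordK.
Qed.

(* The topology of K = R^d; 'M[K]_(m, n) then has the product topology. *)
HB.instance Definition _ k :=
  Topological.copy (scalars k) (initial_topology (@to_coord k)).
HB.instance Definition _ k := isPointed.Build (scalars k) 0.

End Scalars.
Arguments scalars R k : clear implicits.

Section ComplexFunctions.
Context {R : realType}.
Implicit Types z : R[i].

Definition expC z : R[i] :=
  (expR (complex.Re z))%:C *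
  (cos (complex.Im z) +i* sin (complex.Im z)).

(* t ^ z for a real base t >= 0, with 0 ^ 0 = 1 and 0 ^ z = 0 for z != 0. *)
Definition powC (t : R) z : R[i] :=
  if t == 0 then (z == 0)%:R else expC (z * (ln t)%:C).

Context {d : measure_display} {T : measurableType d}.
Variable mu : {measure set T -> \bar R}.
Implicit Types (D : set T) (F : T -> R[i]).

Definition integrableC D F : Prop :=
  mu.-integrable D (fun x => (complex.Re (F x))%:E) /\
  mu.-integrable D (fun x => (complex.Im (F x))%:E).

Definition integralC D F : R[i] :=
  Rintegral mu D (fun x => complex.Re (F x)) +i*
  Rintegral mu D (fun x => complex.Im (F x)).

End ComplexFunctions.

Section RealCoordinateSpace.
Context {R : realType} {m : nat}.
Implicit Types (E : set 'rV[R]_m) (f : 'rV[R]_m -> R).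

Definition box (a b : 'rV[R]_m) : set 'rV[R]_m :=
  [set x | forall i, x 0 i \in `[a 0 i, b 0 i]].

(* m-dimensional Lebesgue outer measure: infimum of the total volume of the
   countable covers by boxes. *)
Definition lebesgue_volume E : \bar R :=
  ereal_inf [set s | exists a b : nat -> 'rV[R]_m,
    [/\ forall n i, a n 0 i <= b n 0 i,
        E `<=` \bigcup_n box (a n) (b n) &
        s = (\sum_(0 <= n <oo) (\prod_(i < m) (b n 0 i - a n 0 i))%:E)%E]].

Fixpoint Cn (n : nat) f : Prop :=
  match n with
  | 0 => continuous f
  | n'.+1 => continuous f /\
      forall v, (forall x, derivable f x v) /\ Cn n' ('D_v f)
  end.

Definition Cinfty f : Prop := forall n, Cn n f.

End RealCoordinateSpace.

Section Grassmannian.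
Context {R : realType} {k : division_algebra}.
Local Notation K := (scalars R k).
Local Notation d := (real_dim k).

(* Identification of matrices over K with real row vectors. *)
Definition to_real (m n : nat) (x : 'M[K]_(m, n)) : 'rV[R]_(m * n * d) :=
  mxvec (\matrix_i to_coord (mxvec x 0 i)).
Definition of_real_row (m n : nat) (v : 'rV[R]_(m * n * d)) : 'M[K]_(m, n) :=
  vec_mx (\row_i of_coord (row i (vec_mx v))).

Lemma to_realK (m n : nat) : cancel (@to_real m n) (@of_real_row m n).
Proof.
move=> x; rewrite /to_real /of_real_row mxvecK -[RHS]mxvecK; congr vec_mx.
by apply/rowP => i; rewrite mxE rowK to_coordK.
Qed.

Lemma of_real_rowK (m n : nat) : cancel (@of_real_row m n) (@to_real m n).
Proof.
move=> v; rewrite /to_real /of_real_row vec_mxK -[RHS]vec_mxK; congr mxvec.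
by apply/row_matrixP => i; rewrite rowK mxE of_coordK.
Qed.

(* x^*, the conjugate transpose. *)
Definition adjoint (m n : nat) (x : 'M[K]_(m, n)) : 'M[K]_(n, m) :=
  map_mx (@conjs R k) x^T.

(* |det x| = |det_R x|^(1/d), where det_R x is the determinant of the
   R-linear endomorphism v |-> x v of K^n. *)
Definition det_real (n : nat) (x : 'M[K]_n) : R :=
  \det (lin1_mx (fun v : 'rV[R]_(n * 1 * d) => to_real (x *m of_real_row v))).
Definition abs_det (n : nat) (x : 'M[K]_n) : R :=
  `|det_real x| `^ (d%:R^-1).

End Grassmannian.

(* Over the quaternions SL is defined by |det x| = 1. *)
Definition SL (R : realType) (k : division_algebra) (n : nat) :
    set 'M[scalars R k]_n :=
  match k return set 'M[scalars R k]_n with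
  | Reals => [set x : 'M[R]_n | \det x = 1]
  | Complexes => [set x : 'M[R[i]]_n | \det x = 1]
  | Quaternions => [set x | abs_det x = 1]
  end.

Section Group.
Context {R : realType} {k : division_algebra} {p : nat}.
Local Notation K := (scalars R k).
Local Notation d := (real_dim k).
Local Notation M2p := 'M[K]_(p + p).
Local Notation V := 'cV[K]_(p + p).

Definition group_G : set M2p := @SL R k (p + p).

Definition group_K : set M2p :=
  [set x | [/\ group_G x, adjoint x *m x = 1%:M & x *m adjoint x = 1%:M]].

(* exp (s H_o), with H_o = diag (1/2 I_p, - 1/2 I_p). *)
Definition expH (s : R) : M2p :=
  block_mx (of_real k (expR (s / 2)))%:M 0 0 (of_real k (expR (- (s / 2))))%:M.

Definition group_M : set M2p :=
  [set x | exists a b : 'M[K]_p,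
    [/\ x = block_mx a 0 0 b, group_G x, abs_det a = 1 & abs_det b = 1]].

Definition group_N : set M2p :=
  [set x | exists X : 'M[K]_p, x = block_mx 1%:M X 0 1%:M].

(* theta N, where theta x = (x^* )^-1. *)
Definition group_Nbar : set M2p :=
  [set y | exists x,
    [/\ group_N x, y *m adjoint x = 1%:M & adjoint x *m y = 1%:M]].

(* The s such that a(g) = exp (s H_o), where g \in K M a(g) N. *)
Definition log_a (g : M2p) : R :=
  xget 0 [set s | exists x m n,
    [/\ group_K x, group_M m, group_N n & g = x *m m *m expH s *m n]].

(* a^lambda = exp (s lambda p / 2) for a = exp (s H_o), at a = a(g). *)
Definition a_pow (g : M2p) (lambda : R[i]) : R[i] :=
  expC (lambda * (log_a g * p%:R / 2)%:C).

Definition rho : R := d%:R * p%:R.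

Definition weyl : M2p := block_mx 0 (- 1%:M) 1%:M 0.

(* p-dimensional right K-subspaces of K^(2p): the columns of B are a basis. *)
Definition is_subspace (S : set V) : Prop :=
  exists B : 'M[K]_(p + p, p),
    (forall v : 'cV[K]_p, B *m v = 0 -> v = 0) /\
    S = range (fun v : 'cV[K]_p => B *m v).

Record Gr := MkGr { Gr_set : set V; Gr_prop : is_subspace Gr_set }.

HB.instance Definition _ := gen_eqMixin Gr.
HB.instance Definition _ := gen_choiceMixin Gr.

Fact b_o_subproof :
  is_subspace (range (fun v : 'cV[K]_p => col_mx v (0 : 'cV[K]_p))).
Proof.
have E (v : 'cV[K]_p) : col_mx 1%:M 0 *m v = col_mx v (0 : 'cV[K]_p).
  by rewrite mul_col_mx mul1mx mul0mx.
exists (col_mx 1%:M 0); split; last by congr image; apply/funext => v; rewrite E.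
by move=> v; rewrite E -[RHS]col_mx0 => /eq_col_mx [].
Qed.

Definition b_o : Gr := MkGr b_o_subproof.

HB.instance Definition _ := isPointed.Build Gr b_o.

(* The element of Gr with underlying set S (b_o if S is not p-dimensional). *)
Definition to_Gr (S : set V) : Gr := xget b_o [set b : Gr | Gr_set b = S].

Lemma to_GrE (S : set V) : is_subspace S -> Gr_set (to_Gr S) = S.
Proof.
move=> hS; rewrite /to_Gr; case: xgetP => [b _ -> //|nS].
by case: (nS (MkGr hS)).
Qed.

Definition act (g : M2p) (b : Gr) : Gr :=
  to_Gr ((fun v => g *m v) @` Gr_set b).

Lemma actE (g h : M2p) (b : Gr) : h *m g = 1%:M ->
  Gr_set (act g b) = (fun v => g *m v) @` Gr_set b.
Proof.
move=> hg; apply: to_GrE; have [B [B_inj ->]] := Gr_prop b.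
exists (g *m B); split.
  by move=> v gBv; apply: B_inj; rewrite -[_ *m v]mul1mx -hg -!mulmxA (mulmxA g)
    gBv mulmx0.
apply/seteqP; split => [_ [_ [v _ <-] <-]|_ [v _ <-]].
  by exists v => //; rewrite mulmxA.
by exists (B *m v); [exists v | rewrite mulmxA].
Qed.

(* The orthogonal complement for the inner product v^* w. *)
Definition orth (S : set V) : set V :=
  [set v | forall w, S w -> adjoint v *m w = 0].

Definition perp (b : Gr) : Gr := to_Gr (orth (Gr_set b)).

(* The standard atlas of the Grassmannian: the maps X |-> g nbar(X) b_o for
   g in G, nbar(X) being the element of Nbar with lower left block X. *)
Definition chart (g : M2p) (X : 'M[K]_p) : Gr :=
  act (g *m block_mx 1%:M 0 X 1%:M) b_o.

Definition Gr_open : set (set Gr) :=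
  [set U | forall g, group_G g -> open (chart g @^-1` U)].

Fact Gr_openT : Gr_open setT.
Proof. by move=> g _; rewrite preimage_setT; exact: openT. Qed.
Fact Gr_openI (A B : set Gr) : Gr_open A -> Gr_open B -> Gr_open (A `&` B).
Proof. by move=> oA oB g Gg; rewrite preimage_setI; apply: openI; auto. Qed.
Fact Gr_open_bigU (I : Type) (F : I -> set Gr) :
  (forall i, Gr_open (F i)) -> Gr_open (\bigcup_i F i).
Proof.
by move=> oF g Gg; rewrite preimage_bigcup; apply: bigcup_open => i _; exact: oF.
Qed.

HB.instance Definition _ := isOpenTopological.Build Gr
  Gr_openT Gr_openI Gr_open_bigU.

Definition smooth (f : Gr -> R[i]) : Prop :=
  forall g, group_G g ->
    Cinfty (fun v : 'rV[R]_(p * p * d) =>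
      complex.Re (f (chart g (of_real_row v)))) /\
    Cinfty (fun v : 'rV[R]_(p * p * d) =>
      complex.Im (f (chart g (of_real_row v)))).

Definition convexV (E : set V) : Prop :=
  forall x y (t : R), E x -> E y -> 0 <= t -> t <= 1 ->
    E (of_real k t *: x + of_real k (1 - t) *: y).

(* The orthogonal projection of the set E onto b. *)
Definition proj (b : Gr) (E : set V) : set V :=
  [set w | Gr_set b w /\ exists2 v, E v & orth (Gr_set b) (v - w)].

(* Euclidean volume of a subset E of b, computed in an arbitrary linear
   isometry v |-> v *m U of R^(dp) onto b; it does not depend on U. *)
Definition vol (b : Gr) (E : set V) : \bar R :=
  xget 0%E [set s | forall U : 'M[R]_(d * p, (p + p) * 1 * d),
    U *m U^T = 1%:M ->
    range (fun v : 'rV[R]_(d * p) => v *m U) =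
      (@to_real R k (p + p) 1) @` Gr_set b ->
    s = lebesgue_volume [set v | E (of_real_row (v *m U))]].

(* |Cos(b, c)| = Vol(P_c(E))^(1/d) for every convex E in b with 0 \in E and
   Vol(E) = 1. *)
Definition abs_cos (b c : Gr) : R :=
  xget 0 [set t | forall E, E `<=` Gr_set b -> convexV E -> E 0 ->
    vol b E = 1%E -> t = (fine (vol c (proj c E))) `^ (d%:R^-1)].

Definition BorelGr := g_sigma_algebraType (@open Gr).
Definition BorelM := g_sigma_algebraType (@open M2p).

Definition K_invariant (db : probability BorelGr R) : Prop :=
  forall g (A : set BorelGr), group_K g -> measurable A ->
    db (act g @^-1` A) = db A.

(* Haar measures of the group Nbar; only the values of the Borel measure dn
   on subsets of Nbar matter. *)
Definition Haar_Nbar (dn : {measure set BorelM -> \bar R}) : Prop :=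
  [/\ forall g (A : set BorelM), group_Nbar g -> measurable A ->
        A `<=` group_Nbar -> dn ((fun x => g *m x) @` A) = dn A,
      forall C : set M2p, compact C -> C `<=` group_Nbar -> (dn C < +oo)%E &
      (0 < dn group_Nbar)%E].

Definition cos_kernel (lambda : R[i]) (f : Gr -> R[i]) (c b : Gr) : R[i] :=
  powC (abs_cos b c) (lambda - rho%:C) * f b.
Definition Cos_transform (db : probability BorelGr R) (lambda : R[i])
    (f : Gr -> R[i]) : Gr -> R[i] :=
  fun c => integralC db setT (cos_kernel lambda f c).
Definition Sin_transform (db : probability BorelGr R) (lambda : R[i])
    (f : Gr -> R[i]) : Gr -> R[i] :=
  fun omega => Cos_transform db lambda f (perp omega).

(* J(lambda) f (x b_o) is the integral of J_integrand lambda f x over Nbar,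
   for every x in K. *)
Definition J_integrand (lambda : R[i]) (f : Gr -> R[i]) (x n : M2p) : R[i] :=
  a_pow n (- lambda - rho%:C) * f (act (x *m n) b_o).
Definition J_op (dn : {measure set BorelM -> \bar R}) (lambda : R[i])
    (f : Gr -> R[i]) : Gr -> R[i] :=
  fun b => xget 0 [set z | forall x, group_K x -> act x b_o = b ->
    z = integralC dn group_Nbar (J_integrand lambda f x)].
Definition A_op (dn : {measure set BorelM -> \bar R}) (lambda : R[i])
    (f : Gr -> R[i]) : Gr -> R[i] :=
  fun b => xget 0 [set z | forall x, group_K x -> act x b_o = b ->
    z = J_op dn lambda f (act (x *m weyl) b_o)].

End Group.

Arguments Gr R k p : clear implicits.
Arguments BorelGr R k p : clear implicits.
Arguments BorelM R k p : clear implicits.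
Arguments group_Nbar R k p : clear implicits.
Arguments rho R k p : clear implicits.

(* Main.v *)
Require Import Defs.
From HB Require Import structures.
From mathcomp Require Import all_boot all_order all_algebra fingroup perm.
From mathcomp Require Import ring lra.
From mathcomp Require Import complex.
From mathcomp Require Import all_classical all_reals all_analysis measurable_realfun.
Set Implicit Arguments.
Unset Strict Implicit.
Unset Printing Implicit Defensive.
Import Order.TTheory GRing.Theory Num.Theory.
Import numFieldNormedType.Exports.
Local Open Scope classical_set_scope.
Local Open Scope complex_scope.
Local Open Scope ring_scope.

(** The two operators integrate f against the same kernel; they only parametrize the Grassmannian
    in different ways.

    Let n = nbar X be an element of the opposite unipotent group and s = log a(n). The first p
    columns of n are (1; X) = B T with B an orthonormal frame and T triangular. The Iwasawa
    decomposition gives |det T| = exp (s p / 2) ([log_aP]), and since the upper block of B is the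
    inverse of T, the subspaces n b_o and b_o have cosine 1 / |det T| = exp (- s p / 2)
    ([cos_height]). Hence a(n)^(- lambda - rho) = |Cos (n b_o, b_o)|^(lambda - rho) a(n)^(- 2 rho)
    ([J_integrandE]). If the density a(n)^(- 2 rho) dn is carried to db by n b_o, then J(lambda) f
    is the cosine transform of f, by invariance of the cosine under K. Finally x w b_o is the
    orthogonal complement of x b_o ([perp_act]), which turns J(lambda) into A(lambda) and the
    cosine transform into the sine transform.

    The cosine is defined by volumes of projections of convex sets. The linear change of variables
    for the Lebesgue outer measure ([vol_rmul]) and the volume of the cube ([vol_cube]) give
    |Cos| = |det (C^* B)| for orthonormal frames B and C ([abs_cosE]).

    That a(n)^(- 2 rho) dn is carried to db rests on two facts. It defines a K-invariant integral
    ([bigcell_invariant]): integrate F (span Z) over the frames Z = (v; w) of norm at most one,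
    an integral that is invariant because unitary matrices preserve the measure on frames.
    Substituting w = x v and integrating over v first yields a constant times the integral of
    F (n b_o) a(n)^(- 2 rho) ([frame_integralE]); the change of variables is linear in each
    block. And invariant integrals of continuous functions are unique
    ([invariant_integral_unique]): averages of F over finite subsets of K are as close as desired
    to a constant ([mean_exists]), which must be the integral of F.

    When lambda differs from rho but has the same real part, the kernel |Cos|^(lambda - rho) is
    discontinuous where the cosine vanishes. It is a bounded pointwise limit of continuous
    functions ([kernel_limit]), to which dominated convergence extends the uniqueness statement
    ([invariant_integral_limit_eq]). *)

(** * Scalars *)

Section ScalarTheory.
Context {R : realType} {k : division_algebra}.
Local Notation K := (scalars R k).
Local Notation d := (real_dim k).
Implicit Types (x y z : K) (r s : R).

Lemma conjsM x y : conjs (x * y) = conjs y * conjs x.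
Proof.
case: k x y => /=.
- by move=> x y; exact: mulrC.
- by case=> a b [c e]; congr (_ +i* _); rewrite /=; ring.
- by case=> ???? [????]; congr Quaternion; rewrite /=; ring.
Qed.

Lemma conjsD x y : conjs (x + y) = conjs x + conjs y.
Proof.
case: k x y => //=.
- by case=> a b [c e]; congr (_ +i* _); rewrite /= ?opprD.
- by case=> ???? [????]; congr Quaternion; rewrite /= ?opprD.
Qed.

Lemma conjsK : involutive (@conjs R k).
Proof.
case: k => //=.
- by case=> a b; congr (_ +i* _); rewrite /= opprK.
- by case=> ????; congr Quaternion; rewrite /= opprK.
Qed.

Lemma of_realD r s : of_real k (r + s) = of_real k r + of_real k s.
Proof.
case: k => //=.
- by congr (_ +i* _); rewrite /= addr0.
- by congr Quaternion; rewrite /= addr0.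
Qed.

Lemma of_realM r s : of_real k (r * s) = of_real k r * of_real k s.
Proof.
case: k => //=.
- by congr (_ +i* _); rewrite /=; ring.
- by congr Quaternion; rewrite /=; ring.
Qed.

Lemma of_real1 : of_real k (1 : R) = 1.
Proof. by case: k. Qed.

Lemma of_real0 : of_real k (0 : R) = 0.
Proof. by case: k. Qed.

Lemma of_realC r x : of_real k r * x = x * of_real k r.
Proof.
case: k x => /=.
- by move=> x; exact: mulrC.
- by case=> a b; congr (_ +i* _); rewrite /=; ring.
- by case=> ????; congr Quaternion; rewrite /=; ring.
Qed.

Lemma conjs_of_real r : conjs (of_real k r) = of_real k r.
Proof.
case: k => //=.
- by congr (_ +i* _); rewrite /= oppr0.
- by congr Quaternion; rewrite /= oppr0.
Qed.

Lemma to_coordD x y : to_coord (x + y) = to_coord x + to_coord y.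
Proof.
case: k x y => /= [x y|[a b] [c e]|[????] [????]]; apply/rowP => j; rewrite !mxE //.
- by case: j => -[|[|]].
- by case: j => -[|[|[|[|]]]].
Qed.

Lemma to_coordZ r x : to_coord (of_real k r * x) = r *: to_coord x.
Proof.
case: k x => /= [x|[a b]|[????]]; apply/rowP => j; rewrite !mxE //.
- by case: j => -[|[|]] //= _; ring.
- by case: j => -[|[|[|[|]]]] //= _; ring.
Qed.

(** The squared absolute value of a scalar. *)
Definition nsq x : R := \sum_j to_coord x 0 j ^+ 2.
(** The real part, defined algebra by algebra. *)
Definition res x : R :=
  match k return scalars R k -> R with
  | Reals => id | Complexes => @complex.Re R | Quaternions => @quat_re R end x.

Lemma mul_conjl x : conjs x * x = of_real k (nsq x).
Proof.
rewrite /nsq; case: k x => /= [x|[a b]|[????]].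
- by rewrite big_ord1 mxE.
- by rewrite 2!big_ord_recr big_ord0 /= !mxE /=; congr (_ +i* _); rewrite /=; ring.
- rewrite 4!big_ord_recr big_ord0 /= !mxE /=.
  by congr Quaternion; rewrite /=; ring.
Qed.

Lemma nsq_conj x : nsq (conjs x) = nsq x.
Proof.
rewrite /nsq; case: k x => /= [x|[a b]|[????]]; first by [].
- by rewrite !(big_ord_recr, big_ord0) /= !mxE /=; ring.
- by rewrite !(big_ord_recr, big_ord0) /= !mxE /=; ring.
Qed.

Lemma mul_conjr x : x * conjs x = of_real k (nsq x).
Proof. by rewrite -{1}[x]conjsK mul_conjl nsq_conj. Qed.

Lemma res_dot x y : res (conjs x * y) = \sum_j to_coord x 0 j * to_coord y 0 j.
Proof.
rewrite /res; case: k x y => /= [x y|[a b] [c e]|[????] [????]].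
- by rewrite big_ord1 !mxE.
- by rewrite !(big_ord_recr, big_ord0) /= !mxE /=; ring.
- by rewrite !(big_ord_recr, big_ord0) /= !mxE /=; ring.
Qed.

Lemma resD x y : res (x + y) = res x + res y.
Proof. by rewrite /res; case: k x y => [x y|[??][??]|[????][????]]. Qed.
Lemma res0 : res 0 = 0.
Proof. by rewrite /res; case: k. Qed.
Lemma res_of_real r : res (of_real k r) = r.
Proof. by rewrite /res; case: k. Qed.

Lemma nsq_ge0 x : 0 <= nsq x.
Proof. by apply: sumr_ge0 => i _; exact: sqr_ge0. Qed.
End ScalarTheory.

(** * Real coordinates of matrices *)

Lemma sum_mxvec (R : nmodType) (m n : nat) (F : 'I_(m * n) -> R) :
  \sum_l F l = \sum_i \sum_j F (mxvec_index i j).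
Proof.
rewrite pair_big /= (reindex _ (curry_mxvec_bij _ _)) /=.
by apply: eq_bigr => -[i j] _.
Qed.

Lemma prod_mxvec (R : comNzRingType) (m n : nat) (F : 'I_(m * n) -> R) :
  \prod_l F l = \prod_i \prod_j F (mxvec_index i j).
Proof.
rewrite pair_big /= (reindex _ (curry_mxvec_bij _ _)) /=.
by apply: eq_bigr => -[i j] _.
Qed.

(** A matrix that is triangular for some ranking h of the indices: a permutation other than the
    identity cannot strictly lower the rank at every index that it moves, so it meets a zero.
    The freedom in h covers row-major coordinates of K-matrices, in either order. *)
Lemma det_rank_trig (R : comNzRingType) (n : nat) (A : 'M[R]_n) (h : 'I_n -> nat) :
  (forall i j, i != j -> (h i <= h j)%N -> A i j = 0) -> \det A = \prod_i A i i.
Proof.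
move=> A0; rewrite /determinant (bigD1 (1%g : {perm 'I_n})) //= [X in _ + X]big1 => [|s s1].
  by rewrite addr0 odd_perm1 mul1r; apply: eq_bigr => i _; rewrite perm1.
have [Hs|] := boolP [forall i, (s i != i) ==> (h (s i) < h i)%N].
    have [i si] : exists i, s i != i.
      apply/existsP; apply: contraNT s1 => /existsPn Hn; apply/eqP/permP => i.
      by rewrite perm1; apply/eqP; have := Hn i; rewrite negbK.
    have : (\sum_i h (s i) < \sum_i h i)%N.
      rewrite (bigD1 i) //= [X in (_ < X)%N](bigD1 i) //= -addSn leq_add //.
        by have /forallP/(_ i)/implyP/(_ si) := Hs.
      apply: leq_sum => j _; have [->//|sj] := eqVneq (s j) j.
      by apply: ltnW; have /forallP/(_ j)/implyP/(_ sj) := Hs.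
    by rewrite [X in (_ < X)%N](reindex_inj (@perm_inj _ s)) ltnn.
  move=> /forallPn [j]; move: j => i; rewrite negb_imply -leqNgt => /andP[si hi].
  by rewrite (bigD1 i) //= A0 1?eq_sym // mul0r mulr0.
Qed.

Section RealCoordinates.
Context {R : realType} {k : division_algebra}.
Local Notation K := (scalars R k).
Local Notation d := (real_dim k).
Local Notation to_real := (@to_real R k _ _).
Local Notation of_real_row := (@of_real_row R k _ _).
Implicit Types (m n : nat).

Lemma to_realE m n (x : 'M[K]_(m, n)) i j c :
  to_real x 0 (mxvec_index (mxvec_index i j) c) = to_coord (x i j) 0 c.
Proof. by rewrite /Defs.to_real mxvecE mxE mxvecE. Qed.

Lemma to_realD m n (x y : 'M[K]_(m, n)) : to_real (x + y) = to_real x + to_real y.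
Proof.
apply/rowP => l; case/mxvec_indexP: l => l c; case/mxvec_indexP: l => i j.
by rewrite mxE !to_realE mxE to_coordD mxE.
Qed.

Lemma to_realZ m n r (x : 'M[K]_(m, n)) : to_real (of_real k r *: x) = r *: to_real x.
Proof.
apply/rowP => l; case/mxvec_indexP: l => l c; case/mxvec_indexP: l => i j.
by rewrite mxE !to_realE mxE to_coordZ mxE.
Qed.

Lemma of_real_rowD m n (v w : 'rV[R]_(m * n * d)) :
  of_real_row (v + w) = of_real_row v + of_real_row w :> 'M[K]_(m, n).
Proof.
by apply: (can_inj (@to_realK R k m n)); rewrite to_realD !of_real_rowK.
Qed.

Lemma of_real_rowZ m n r (v : 'rV[R]_(m * n * d)) :
  of_real_row (r *: v) = of_real k r *: of_real_row v :> 'M[K]_(m, n).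
Proof.
by apply: (can_inj (@to_realK R k m n)); rewrite to_realZ !of_real_rowK.
Qed.

Lemma to_real0 m n : to_real (0 : 'M[K]_(m, n)) = 0.
Proof. by have := to_realZ 0 (0 : 'M[K]_(m, n)); rewrite of_real0 !scale0r. Qed.

Lemma of_real_row0 m n : of_real_row 0 = 0 :> 'M[K]_(m, n).
Proof. by rewrite -(to_real0 m n) to_realK. Qed.

Lemma to_realN m n (x : 'M[K]_(m, n)) : to_real (- x) = - to_real x.
Proof. by apply/eqP; rewrite -addr_eq0 -to_realD addNr to_real0. Qed.

Lemma mulmx_realZ m n q r (x : 'M[K]_(m, n)) (y : 'M[K]_(n, q)) :
  x *m (of_real k r *: y) = of_real k r *: (x *m y).
Proof.
apply/matrixP => i j; rewrite !mxE mulr_sumr; apply: eq_bigr => l _.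
by rewrite mxE mulrA -of_realC mulrA.
Qed.

Definition rlin m n m' n' (f : 'M[K]_(m, n) -> 'M[K]_(m', n')) :=
  (forall x y, f (x + y) = f x + f y) /\
  (forall r x, f (of_real k r *: x) = of_real k r *: f x).

(** The K-linear structure is forgotten: left and right multiplications by K-matrices are both
    only real linear in general, and their real matrices are what determinants and volumes see. *)
Definition Lmx m n m' n' (f : 'M[K]_(m, n) -> 'M[K]_(m', n')) :
  'M[R]_(m * n * d, m' * n' * d) := lin1_mx (fun v => to_real (f (of_real_row v))).

Lemma rlin_mull m n q (x : 'M[K]_(m, n)) : rlin (fun y : 'M[K]_(n, q) => x *m y).
Proof. by split=> [y z|r y]; [rewrite mulmxDr | rewrite mulmx_realZ]. Qed.

Lemma rlin_mulr m n q (x : 'M[K]_(m, n)) : rlin (fun y : 'M[K]_(q, m) => y *m x).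
Proof. by split=> [y z|r y]; [rewrite mulmxDl | rewrite scalemxAl]. Qed.

Lemma mul_Lmx m n m' n' (f : 'M[K]_(m, n) -> 'M[K]_(m', n')) v :
  rlin f -> v *m Lmx f = to_real (f (of_real_row v)).
Proof.
move=> [fD fZ]; rewrite /Lmx; set g := fun v => _.
have gl : linear g.
  by move=> a u w; rewrite /g of_real_rowD of_real_rowZ fD fZ to_realD to_realZ.
pose gL := GRing.isLinear.Build _ _ _ _ g gl.
exact: (mul_rV_lin1 (HB.pack g gL : {linear _ -> _})).
Qed.

Lemma to_real_mul m n m' n' (f : 'M[K]_(m, n) -> 'M[K]_(m', n')) x :
  rlin f -> to_real (f x) = to_real x *m Lmx f.
Proof. by move=> fl; rewrite mul_Lmx // to_realK. Qed.

Lemma Lmx_comp m n m' n' m'' n'' (f : 'M[K]_(m, n) -> 'M[K]_(m', n'))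
   (g : 'M[K]_(m', n') -> 'M[K]_(m'', n'')) : rlin f -> rlin g ->
  Lmx (fun x => g (f x)) = Lmx f *m Lmx g.
Proof.
move=> fl gl; apply/row_matrixP => i; rewrite !rowE mulmxA !mul_Lmx ?to_realK //.
by split=> [x y|r x]; rewrite ?(proj1 fl) ?(proj1 gl) ?(proj2 fl) ?(proj2 gl).
Qed.

Lemma Lmx_id m n (f : 'M[K]_(m, n) -> 'M[K]_(m, n)) : (forall x, f x = x) -> Lmx f = 1%:M.
Proof.
move=> fE; have fl : rlin f by split=> *; rewrite !fE.
by apply/row_matrixP => i; rewrite !rowE mul_Lmx // fE of_real_rowK mulmx1.
Qed.

Lemma Lmx_ext m n m' n' (f g : 'M[K]_(m, n) -> 'M[K]_(m', n')) :
  f =1 g -> Lmx f = Lmx g.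
Proof. by move=> /funext ->. Qed.

(** * Adjoint, inner product and norm *)

Definition dot m n (x y : 'M[K]_(m, n)) : R := \sum_l to_real x 0 l * to_real y 0 l.
Definition nrm2 m n (x : 'M[K]_(m, n)) : R := dot x x.

Lemma dotE m n (x y : 'M[K]_(m, n)) : dot x y = res (\tr (adjoint x *m y)).
Proof.
rewrite /dot sum_mxvec sum_mxvec exchange_big /= /mxtrace.
rewrite (big_morph res resD res0); apply: eq_bigr => j _; rewrite mxE.
rewrite (big_morph res resD res0); apply: eq_bigr => i _; rewrite !mxE res_dot.
by apply: eq_bigr => c _; rewrite !to_realE.
Qed.

Lemma adjointM m n q (x : 'M[K]_(m, n)) (y : 'M[K]_(n, q)) :
  adjoint (x *m y) = adjoint y *m adjoint x.
Proof.
apply/matrixP => i j; rewrite !mxE (big_morph (@conjs R k) conjsD (_ : _ = 0)).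
  by apply: eq_bigr => l _; rewrite conjsM !mxE.
by rewrite -{1}of_real0 conjs_of_real of_real0.
Qed.

Lemma adjointD m n (x y : 'M[K]_(m, n)) : adjoint (x + y) = adjoint x + adjoint y.
Proof. by apply/matrixP => i j; rewrite !mxE conjsD. Qed.

Lemma adjointK m n (x : 'M[K]_(m, n)) : adjoint (adjoint x) = x.
Proof. by apply/matrixP => i j; rewrite !mxE conjsK. Qed.

Lemma conjs0 : conjs (0 : K) = 0.
Proof. by rewrite -{1}of_real0 conjs_of_real of_real0. Qed.

Lemma conjs1 : conjs (1 : K) = 1.
Proof. by rewrite -{1}of_real1 conjs_of_real of_real1. Qed.

Lemma conjsN (x : K) : conjs (- x) = - conjs x.
Proof. by apply/eqP; rewrite -addr_eq0 -conjsD addNr conjs0. Qed.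

Lemma adjoint1 n : adjoint (1%:M : 'M[K]_n) = 1%:M.
Proof.
by apply/matrixP => i j; rewrite !mxE eq_sym; case: eqP => _; rewrite ?conjs1 ?conjs0.
Qed.

Lemma adjoint0 m n : adjoint (0 : 'M[K]_(m, n)) = 0.
Proof. by apply/matrixP => i j; rewrite !mxE conjs0. Qed.

Lemma adjointN m n (x : 'M[K]_(m, n)) : adjoint (- x) = - adjoint x.
Proof. by apply/matrixP => i j; rewrite !mxE conjsN. Qed.

Lemma adjointZ m n r (x : 'M[K]_(m, n)) : adjoint (of_real k r *: x) = of_real k r *: adjoint x.
Proof. by apply/matrixP => i j; rewrite !mxE conjsM conjs_of_real of_realC. Qed.

Lemma adjoint_block m1 m2 n1 n2 (a : 'M[K]_(m1, n1)) (b : 'M[K]_(m1, n2))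
    (c : 'M[K]_(m2, n1)) (e : 'M[K]_(m2, n2)) :
  adjoint (block_mx a b c e) = block_mx (adjoint a) (adjoint c) (adjoint b) (adjoint e).
Proof. by rewrite /adjoint tr_block_mx map_block_mx. Qed.

Lemma adjoint_col m1 m2 n (a : 'M[K]_(m1, n)) (b : 'M[K]_(m2, n)) :
  adjoint (col_mx a b) = row_mx (adjoint a) (adjoint b).
Proof. by rewrite /adjoint tr_col_mx map_row_mx. Qed.

Lemma dot_unitl m n q (u : 'M[K]_(q, m)) (x y : 'M[K]_(m, n)) :
  adjoint u *m u = 1%:M -> dot (u *m x) (u *m y) = dot x y.
Proof. by move=> uu; rewrite !dotE adjointM -mulmxA (mulmxA _ u) uu mul1mx. Qed.

Lemma nrm2E m n (x : 'M[K]_(m, n)) : nrm2 x = \sum_i \sum_j nsq (x i j).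
Proof.
rewrite /nrm2 /dot sum_mxvec sum_mxvec; apply: eq_bigr => i _; apply: eq_bigr => j _.
by apply: eq_bigr => c _; rewrite to_realE expr2.
Qed.

Lemma nrm2_adj m n (x : 'M[K]_(m, n)) : nrm2 (adjoint x) = nrm2 x.
Proof.
rewrite !nrm2E exchange_big; apply: eq_bigr => i _; apply: eq_bigr => j _.
by rewrite !mxE nsq_conj.
Qed.

Lemma nrm2_unitl m n q (u : 'M[K]_(q, m)) (x : 'M[K]_(m, n)) :
  adjoint u *m u = 1%:M -> nrm2 (u *m x) = nrm2 x.
Proof. exact: dot_unitl. Qed.

Lemma nrm2_unitr m n q (u : 'M[K]_(n, q)) (x : 'M[K]_(m, n)) :
  u *m adjoint u = 1%:M -> nrm2 (x *m u) = nrm2 x.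
Proof.
move=> uu; rewrite -nrm2_adj adjointM nrm2_unitl ?adjointK // nrm2_adj //.
Qed.

Lemma nrm2_ge0 m n (x : 'M[K]_(m, n)) : 0 <= nrm2 x.
Proof. by apply: sumr_ge0 => l _; rewrite -expr2 sqr_ge0. Qed.

Lemma nrm2_eq0 m n (x : 'M[K]_(m, n)) : nrm2 x = 0 -> x = 0.
Proof.
move=> /eqP; rewrite psumr_eq0 => [/allP x0|l _]; last by rewrite -expr2 sqr_ge0.
apply: (can_inj (@to_realK R k m n)); rewrite to_real0; apply/rowP => l.
by have := x0 l (mem_index_enum _); rewrite mulf_eq0 orbb mxE => /eqP.
Qed.

Lemma nrm2_0 m n : nrm2 (0 : 'M[K]_(m, n)) = 0.
Proof. by rewrite /nrm2 /dot big1 // => l _; rewrite to_real0 mxE mul0r. Qed.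

Lemma nrm2N m n (x : 'M[K]_(m, n)) : nrm2 (- x) = nrm2 x.
Proof. by apply: eq_bigr => l _; rewrite to_realN mxE mulrNN. Qed.

Lemma nrm2Z m n r (x : 'M[K]_(m, n)) : nrm2 (of_real k r *: x) = r ^+ 2 * nrm2 x.
Proof.
by rewrite /nrm2 /dot mulr_sumr; apply: eq_bigr => l _; rewrite to_realZ mxE; ring.
Qed.

Lemma nrm2D m n (x y : 'M[K]_(m, n)) : nrm2 (x + y) <= 2 * nrm2 x + 2 * nrm2 y.
Proof.
rewrite /nrm2 /dot !mulr_sumr -big_split /=; apply: ler_sum => l _.
rewrite to_realD mxE -subr_ge0; set a := to_real x 0 l; set b := to_real y 0 l.
by rewrite (_ : _ - _ = (a - b) ^+ 2) ?sqr_ge0 //; ring.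
Qed.

(** Multiplicativity of the norm of K, from which the norm of a product of matrices is bounded. *)
Lemma nsqM (x y : K) : nsq (x * y) = nsq x * nsq y.
Proof.
rewrite -[LHS](@res_of_real R k) -mul_conjl conjsM mulrA -(mulrA _ _ x) mul_conjl.
by rewrite -of_realC -mulrA mul_conjl -of_realM res_of_real.
Qed.

Lemma nrm2M m n q (x : 'M[K]_(m, n)) (y : 'M[K]_(n, q)) :
  nrm2 (x *m y) <= n%:R * (nrm2 x * nrm2 y).
Proof.
have sqr_sum (a : 'I_n -> R) : (\sum_l a l) ^+ 2 <= n%:R * \sum_l a l ^+ 2.
  rewrite expr2 mulr_suml.
  have [h h0 hh] : exists2 h : R, 0 <= h & h + h = 1.
    by exists 2^-1; rewrite ?invr_ge0 ?ler0n //; field.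
  apply: (@le_trans _ _ (\sum_l \sum_j (a l ^+ 2 + a j ^+ 2) * h)).
    apply: ler_sum => l _; rewrite mulr_sumr; apply: ler_sum => j _.
    have := mulr_ge0 h0 (sqr_ge0 (a l - a j)).
    have -> : h * (a l - a j) ^+ 2 = (a l ^+ 2 + a j ^+ 2) * h - (h + h) * (a l * a j) by ring.
    by rewrite hh mul1r subr_ge0.
  under eq_bigr => l _ do
    rewrite -mulr_suml big_split /= sumr_const card_ord.
  rewrite -mulr_suml big_split /= sumr_const card_ord sumrMnl.
  by rewrite mulrDl -mulrDr hh mulr1 mulr_natl.
have nsq_sum (F : 'I_n -> K) : nsq (\sum_l F l) <= n%:R * \sum_l nsq (F l).
  rewrite /nsq exchange_big /= mulr_sumr; apply: ler_sum => c _.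
  have -> : to_coord (\sum_l F l) 0 c = \sum_l to_coord (F l) 0 c.
    apply: (big_morph (fun x => to_coord x 0 c)) => [u v|]; first by rewrite to_coordD mxE.
    by have := to_coordZ 0 (0 : K); rewrite mulr0 scale0r => ->; rewrite mxE.
  exact: sqr_sum.
rewrite !nrm2E; apply: (@le_trans _ _ (\sum_i \sum_j n%:R * \sum_l nsq (x i l) * nsq (y l j))).
  apply: ler_sum => i _; apply: ler_sum => j _; rewrite mxE.
  by apply: (le_trans (nsq_sum _)); under eq_bigr do rewrite nsqM.
under eq_bigr do rewrite -mulr_sumr exchange_big.
rewrite -mulr_sumr ler_wpM2l ?ler0n // mulr_suml; apply: ler_sum => i _.
rewrite mulr_suml; apply: ler_sum => l _; rewrite -mulr_sumr ler_wpM2l ?nsq_ge0 //.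
rewrite [leRHS](bigD1 l) //= lerDl; apply: sumr_ge0 => j _; apply: sumr_ge0 => c _.
exact: nsq_ge0.
Qed.

(** Coordinates are orthonormal for [dot], so isometries have orthogonal matrices. *)
Lemma Lmx_isom m n m' n' (f : 'M[K]_(m, n) -> 'M[K]_(m', n')) : rlin f ->
  (forall x y, dot (f x) (f y) = dot x y) -> Lmx f *m (Lmx f)^T = 1%:M.
Proof.
move=> fl fi; apply/matrixP => i j; rewrite mxE.
transitivity (dot (f (of_real_row (delta_mx 0 i))) (f (of_real_row (delta_mx 0 j)))).
  by apply: eq_bigr => l _; rewrite -!mul_Lmx // -!rowE !mxE.
rewrite fi /dot; under eq_bigr do rewrite !of_real_rowK !mxE /=.
rewrite (bigD1 j) //= eqxx mulr1 big1 ?addr0 => [|l /negbTE ->]; last exact: mulr0.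
by rewrite mxE eq_sym.
Qed.

(** * Determinants *)

Lemma det_realE n (x : 'M[K]_n) : det_real x = \det (Lmx (fun v : 'cV[K]_n => x *m v)).
Proof. by []. Qed.

Lemma det_realM n (x y : 'M[K]_n) : det_real (x *m y) = det_real x * det_real y.
Proof.
rewrite !det_realE (Lmx_ext (_ : _ =1 fun v => x *m (y *m v))) => [|v].
  by rewrite (Lmx_comp (rlin_mull 1 y) (rlin_mull 1 x)) det_mulmx mulrC.
by rewrite mulmxA.
Qed.

Lemma det_real1 n : det_real (1%:M : 'M[K]_n) = 1.
Proof. by rewrite det_realE Lmx_id ?det1 // => v; rewrite mul1mx. Qed.

Lemma abs_detM n (x y : 'M[K]_n) : abs_det (x *m y) = abs_det x * abs_det y.
Proof. by rewrite /abs_det det_realM normrM powRM. Qed.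

Lemma abs_det1 n : abs_det (1%:M : 'M[K]_n) = 1.
Proof. by rewrite /abs_det det_real1 normr1 powR1. Qed.

Lemma abs_det_ge0 n (x : 'M[K]_n) : 0 <= abs_det x.
Proof. exact: powR_ge0. Qed.

Lemma abs_det_unitary n (x : 'M[K]_n) : adjoint x *m x = 1%:M -> abs_det x = 1.
Proof.
move=> xx; rewrite /abs_det det_realE; set M := Lmx _.
have MM : M *m M^T = 1%:M.
  by apply: Lmx_isom => [|y z]; [exact: rlin_mull | exact: dot_unitl].
suff -> : `|\det M| = 1 by rewrite powR1.
have := congr1 (fun A => `|\det A|) MM.
rewrite det_mulmx det_tr det1 normrM normr1 -expr2 => /eqP.
by rewrite sqrp_eq1 // => /eqP.
Qed.

(** Injectivity passes to the real matrix, whose inverse gives a right inverse over K; applying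
    this twice makes it two-sided. *)
Lemma inj_inv n (x : 'M[K]_n) : (forall v : 'cV[K]_n, x *m v = 0 -> v = 0) ->
  exists y, x *m y = 1%:M /\ y *m x = 1%:M.
Proof.
move=> xinj; set M := Lmx (fun v : 'cV[K]_n => x *m v).
have Mu : M \in unitmx.
  rewrite -row_free_unit -kermx_eq0; apply/eqP/row_matrixP => i; rewrite row0.
  have : row i (kermx M) *m M = 0 by rewrite -row_mul mulmx_ker row0.
  rewrite mul_Lmx; last exact: rlin_mull.
  rewrite -(to_real0 n 1) => /(can_inj (@to_realK R k _ _)) /xinj /(congr1 to_real).
  by rewrite of_real_rowK to_real0.
have xinjM q (z : 'M[K]_(n, q)) : x *m z = 0 -> z = 0.
  move=> xz; apply/matrixP => i j; rewrite mxE.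
  have /colP/(_ i) : z *m delta_mx j (0 : 'I_1) = 0 by apply: xinj; rewrite mulmxA xz mul0mx.
  by rewrite -colE !mxE.
pose y := \matrix_(i, j) (of_real_row (to_real (delta_mx j 0 : 'cV[K]_n) *m invmx M)
   : 'cV[K]_n) i 0.
have xy : x *m y = 1%:M.
  apply/matrixP => i j; rewrite mxE.
  transitivity ((x *m (of_real_row (to_real (delta_mx j 0 : 'cV[K]_n) *m invmx M)
     : 'cV[K]_n)) i 0).
    by rewrite mxE; apply: eq_bigr => l _; rewrite mxE.
  rewrite -[x *m _]to_realK to_real_mul; last exact: rlin_mull.
  by rewrite of_real_rowK -/M mulmxKV // to_realK !mxE eqxx andbT.
exists y; split=> //; apply/eqP; rewrite -subr_eq0; apply/eqP/xinjM.
by rewrite mulmxBr mulmxA xy mul1mx mulmx1 subrr.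
Qed.
End RealCoordinates.

(** * Triangular matrices and the QR decomposition *)

Section Triangular.
Context {R : realType} {k : division_algebra}.
Local Notation K := (scalars R k).
Local Notation d := (real_dim k).
Local Notation to_real := (@to_real R k _ _).
Local Notation of_real_row := (@of_real_row R k _ _).
Implicit Types (m n : nat).

Definition upper m n (T : 'M[K]_(m, n)) := forall (i : 'I_m) (j : 'I_n), (j < i)%N -> T i j = 0.

Lemma LmxE m n m' n' (f : 'M[K]_(m, n) -> 'M[K]_(m', n')) l' l : rlin f ->
  Lmx f l' l = to_real (f (of_real_row (delta_mx 0 l'))) 0 l.
Proof. by move=> fl; rewrite -mul_Lmx // -rowE [RHS]mxE. Qed.

Lemma mxvec_index_inj m n : injective (fun ij : 'I_m * 'I_n => mxvec_index ij.1 ij.2).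
Proof.
by move=> [i j] [i' j'] /cast_ord_inj /enum_rank_inj.
Qed.

Lemma to_coord_delta m n (i i' : 'I_m) (j j' : 'I_n) (c c' : 'I_d) :
  to_coord ((of_real_row (delta_mx 0 (mxvec_index (mxvec_index i' j') c')) :
    'M[K]_(m, n)) i j) 0 c = ((i == i') && (j == j') && (c == c'))%:R.
Proof.
rewrite -to_realE of_real_rowK mxE /=; congr (nat_of_bool _)%:R.
apply/eqP/andP => [h|[/andP[/eqP -> /eqP ->] /eqP ->] //].
have /pair_equal_spec [h1 ->] := @mxvec_index_inj _ _ (_, _) (_, _) h.
by have /pair_equal_spec [-> ->] := @mxvec_index_inj _ _ (_, _) (_, _) h1; rewrite !eqxx.
Qed.

Lemma delta_row0 m n (i i' : 'I_m) (j j' : 'I_n) (c' : 'I_d) :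
  (i, j) != (i', j') -> (of_real_row (delta_mx 0 (mxvec_index (mxvec_index i' j') c')) :
    'M[K]_(m, n)) i j = 0.
Proof.
rewrite xpair_eqE => /negbTE h; apply: (can_inj (@to_coordK R k)); apply/rowP => c.
rewrite to_coord_delta h /=.
by have := to_coordZ 0 (0 : K); rewrite mulr0 scale0r => ->; rewrite mxE.
Qed.

(** In coordinates, T times a q-column matrix is block triangular with each real diagonal entry of T
    repeated q d times. Reality of the diagonal is what makes those blocks scalar. *)
Lemma det_mull_upper n q (T : 'M[K]_n) (t : 'I_n -> R) :
  upper T -> (forall i, T i i = of_real k (t i)) ->
  \det (Lmx (fun Z : 'M[K]_(n, q) => T *m Z)) = (\prod_i t i) ^+ (q * d).
Proof.
move=> Tu Tt; have fl := @rlin_mull R k n n q T.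
pose h := mxvec (\matrix_(l < n * q, c < d)
  mxvec (\matrix_(i < n, j < q) (i : nat)) 0 l) 0.
have hE i j c : h (mxvec_index (mxvec_index i j) c) = i by rewrite /h mxvecE mxE mxvecE mxE.
have entry (i : 'I_n) (j : 'I_q) c (i' : 'I_n) (j' : 'I_q) c' : (i' <= i)%N ->
  Lmx (fun Z : 'M[K]_(n, q) => T *m Z) (mxvec_index (mxvec_index i' j') c')
    (mxvec_index (mxvec_index i j) c) = t i *+ [&& i == i', j == j' & c == c'].
  move=> ii; rewrite LmxE // to_realE mxE (bigD1 i') //= big1 ?addr0; last first.
    by move=> l li; rewrite delta_row0 ?mulr0 // xpair_eqE (negbTE li).
  have [<-|ni] := eqVneq i i'.
    by rewrite Tt to_coordZ mxE to_coord_delta eqxx /= mulr_natr.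
  rewrite Tu ?mul0r; last by rewrite ltn_neqAle ii andbT eq_sym.
  by have := to_coordZ 0 (0 : K); rewrite mulr0 scale0r => ->; rewrite mxE.
rewrite (@det_rank_trig _ _ _ h) => [|l' l].
  rewrite prod_mxvec prod_mxvec -prodrXl; apply: eq_bigr => i _.
  rewrite exprM; under eq_bigr do under eq_bigr do rewrite entry // !eqxx /=.
  by rewrite !prodr_const !card_ord -!exprM mulnC.
case/mxvec_indexP: l' => l' c'; case/mxvec_indexP: l' => i' j'.
case/mxvec_indexP: l => l c; case/mxvec_indexP: l => i j.
move=> ne; rewrite !hE => /entry ->; case: and3P => // -[/eqP ii /eqP jj /eqP cc].
by rewrite ii jj cc eqxx in ne.
Qed.

(** The same block structure as for left multiplication, ranked along the columns. *)
Lemma det_mulr_upper n q (T : 'M[K]_n) (t : 'I_n -> R) :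
  upper T -> (forall i, T i i = of_real k (t i)) ->
  \det (Lmx (fun Z : 'M[K]_(q, n) => Z *m T)) = (\prod_i t i) ^+ (q * d).
Proof.
move=> Tu Tt; have fl := @rlin_mulr R k n n q T.
pose h := mxvec (\matrix_(l < q * n, c < d)
  mxvec (\matrix_(i < q, j < n) (n - j)%N) 0 l) 0.
have hE i j c : h (mxvec_index (mxvec_index i j) c) = (n - j)%N.
  by rewrite /h mxvecE mxE mxvecE mxE.
have entry (i : 'I_q) (j : 'I_n) c (i' : 'I_q) (j' : 'I_n) c' : (j <= j')%N ->
  Lmx (fun Z : 'M[K]_(q, n) => Z *m T) (mxvec_index (mxvec_index i' j') c')
    (mxvec_index (mxvec_index i j) c) = t j *+ [&& i == i', j == j' & c == c'].
  move=> jj; rewrite LmxE // to_realE mxE (bigD1 j') //= big1 ?addr0; last first.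
    by move=> l li; rewrite delta_row0 ?mul0r // xpair_eqE (negbTE li) andbF.
  have [<-|ni] := eqVneq j j'.
    by rewrite Tt -of_realC to_coordZ mxE to_coord_delta eqxx /= andbT mulr_natr.
  rewrite Tu ?mulr0; last by rewrite ltn_neqAle jj andbT.
  rewrite andbF.
  by have := to_coordZ 0 (0 : K); rewrite mulr0 scale0r => ->; rewrite mxE.
rewrite (@det_rank_trig _ _ _ h) => [|l' l].
  rewrite prod_mxvec prod_mxvec exchange_big /= -prodrXl; apply: eq_bigr => i _.
  rewrite exprM; under eq_bigr do under eq_bigr do rewrite entry // !eqxx /=.
  by rewrite !prodr_const !card_ord -!exprM mulnC.
case/mxvec_indexP: l' => l' c'; case/mxvec_indexP: l' => i' j'.
case/mxvec_indexP: l => l c; case/mxvec_indexP: l => i j.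
move=> ne; rewrite !hE leq_sub2lE; last exact: ltnW.
move=> /entry ->; case: and3P => // -[/eqP ii /eqP jj /eqP cc].
by rewrite ii jj cc eqxx in ne.
Qed.

Lemma abs_det_upper n (T : 'M[K]_n) (t : 'I_n -> R) : upper T ->
  (forall i, T i i = of_real k (t i)) -> (forall i, 0 <= t i) -> abs_det T = \prod_i t i.
Proof.
move=> Tu Tt t0; rewrite /abs_det det_realE (det_mull_upper 1 Tu Tt) mul1n.
have p0 : 0 <= \prod_i t i by apply: prodr_ge0.
rewrite ger0_norm ?exprn_ge0 // -powR_mulrn // -powRrM mulfV ?powRr1 //.
by rewrite pnatr_eq0; case: (k).
Qed.

Lemma scalar_inv (x : K) : x != 0 -> exists y, y * x = 1 /\ x * y = 1.
Proof.
move=> x0; have n0 : nsq x != 0.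
  apply: contraNneq x0; rewrite /nsq => /eqP; rewrite psumr_eq0 => [/allP h|]; last first.
    by move=> *; exact: sqr_ge0.
  apply/eqP/(can_inj (@to_coordK R k))/rowP => c.
  have := h c (mem_index_enum _); rewrite sqrf_eq0 => /eqP ->.
  by have := to_coordZ 0 (0 : K); rewrite mulr0 scale0r => ->; rewrite mxE.
exists (of_real k (nsq x)^-1 * conjs x); split.
  by rewrite -mulrA mul_conjl -of_realM mulVf // of_real1.
by rewrite mulrA -of_realC -mulrA mul_conjr -of_realM mulVf // of_real1.
Qed.

Definition unitary n (U : 'M[K]_n) := adjoint U *m U = 1%:M /\ U *m adjoint U = 1%:M.

(** Finite dimension makes a left inverse two-sided, also over the quaternions. *)
Lemma unitaryP n (U : 'M[K]_n) : adjoint U *m U = 1%:M -> unitary U.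
Proof.
move=> UU; split=> //; have [v Uv|y [Uy yU]] := @inj_inv R k n U.
  by rewrite -[v]mul1mx -UU -mulmxA Uv mulmx0.
by rewrite -[adjoint U]mulmx1 -Uy (mulmxA (adjoint U)) UU mul1mx.
Qed.

Lemma unitaryM n (U V : 'M[K]_n) : unitary U -> unitary V -> unitary (U *m V).
Proof.
move=> [U1 _] [V1 _]; apply: unitaryP.
by rewrite adjointM -mulmxA (mulmxA _ U) U1 mul1mx.
Qed.

Lemma unitary1 n : unitary (1%:M : 'M[K]_n).
Proof. by split; rewrite adjoint1 mulmx1. Qed.

Lemma unitary_adj n (U : 'M[K]_n) : unitary U -> unitary (adjoint U).
Proof. by case=> a b; split; rewrite adjointK. Qed.

Lemma adjoint_mul_cv n (v : 'cV[K]_n) : adjoint v *m v = (of_real k (nrm2 v))%:M.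
Proof.
apply/matrixP => i j; rewrite !ord1 !mxE eqxx mulr1n nrm2E.
rewrite (big_morph (of_real k) (@of_realD R k) (@of_real0 R k)).
by apply: eq_bigr => l _; rewrite big_ord1 !mxE mul_conjl.
Qed.

(** The reflection 1 - u S^-1 u^*  with u = v - |v| e and S = u^* v. Over a noncommutative K the
    scalar S is in general not real, and S + S^* = u^* u is the identity that makes this unitary. *)
Lemma householder n (v : 'cV[K]_n.+1) : exists U, unitary U /\
  U *m v = of_real k (Num.sqrt (nrm2 v)) *: delta_mx 0 0.
Proof.
set r := Num.sqrt _; pose e : 'cV[K]_n.+1 := delta_mx 0 0.
pose u := v - of_real k r *: e; pose S := adjoint u *m v.
have vv : adjoint v *m v = (of_real k (r ^+ 2))%:M.
  by rewrite adjoint_mul_cv sqr_sqrtr ?nrm2_ge0.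
have ee : adjoint e *m e = 1%:M.
  apply/matrixP => i j; rewrite !ord1 mxE (bigD1 0) //= big1 ?addr0.
    by rewrite !mxE !eqxx conjs1 mulr1.
  by move=> l /negbTE l0; rewrite !mxE l0 mulr0.
have ua : adjoint u = adjoint v - of_real k r *: adjoint e.
  by rewrite adjointD adjointN adjointZ.
have SS : S + adjoint S = adjoint u *m u.
  rewrite /S adjointM adjointK ua /u !(mulmxBl, mulmxBr) !mulmx_realZ -!scalemxAl.
  rewrite vv ee scalerA -of_realM -expr2 scalemx1.
  set a := adjoint e *m v; set b := adjoint v *m e; set c := _%:M.
  by rewrite opprB [LHS]addrC.
have [S0|S0] := eqVneq S 0.
  exists 1%:M; split; first exact: unitary1.
  suff u0 : u = 0 by rewrite mul1mx; apply/eqP; rewrite -subr_eq0; apply/eqP.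
  apply: nrm2_eq0; have : adjoint u *m u = 0 by rewrite -SS S0 adjoint0 addr0.
  rewrite adjoint_mul_cv => /matrixP/(_ 0 0); rewrite !mxE eqxx mulr1n => h.
  by rewrite -(@res_of_real R k (nrm2 u)) h res0.
have S00 : S 0 0 != 0.
  by apply: contraNneq S0 => h; apply/eqP/matrixP => i j; rewrite !ord1 h mxE.
have [y [yS Sy]] := scalar_inv S00; pose T : 'M[K]_1 := y%:M.
have TS : T *m S = 1%:M by apply/matrixP => i j; rewrite !ord1 [LHS]mxE big_ord1 [T _ _]mxE eqxx mulr1n yS [RHS]mxE.
have ST : S *m T = 1%:M by apply/matrixP => i j; rewrite !ord1 [LHS]mxE big_ord1 [T _ _]mxE eqxx mulr1n Sy [RHS]mxE.
exists (1%:M - u *m T *m adjoint u); split; last first.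
  by rewrite mulmxBl mul1mx -!mulmxA -/S TS mulmx1 /u opprB addrC subrK.
have TSa : adjoint T *m adjoint S = 1%:M by rewrite -adjointM ST adjoint1.
apply: unitaryP; rewrite adjointD adjointN adjoint1 !adjointM adjointK.
rewrite mulmxBl mul1mx mulmxBr mulmx1 -!mulmxA (mulmxA (adjoint u) u) -SS.
rewrite mulmxDl mulmxDr (mulmxA S) ST mul1mx.
rewrite (mulmxA (adjoint T) (adjoint S)) TSa mul1mx mulmxDr.
set a := u *m (T *m _); set b := u *m _.
by rewrite opprB [b + a]addrC addrK subrK.
Qed.

Definition real_diag m n (T : 'M[K]_(m, n)) := forall (i : 'I_m) (j : 'I_n), i = j :> nat ->
  exists t, 0 <= t /\ T i j = of_real k t.

(** Householder reflections on the first column, then recursion on the lower right block. *)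
Lemma QR m n (Z : 'M[K]_(m, n)) : exists U, [/\ unitary U, upper (U *m Z) & real_diag (U *m Z)].
Proof.
elim: m n Z => [|m IH] [|n] Z.
- by exists 1%:M; split; [exact: unitary1 | case | case].
- by exists 1%:M; split; [exact: unitary1 | case | case].
- by exists 1%:M; split; [exact: unitary1 | move=> ? [] | move=> ? []].
have [U1 [U1u U1Z]] := householder (col 0 Z).
have [Z1 Z1def] : exists Z1 : 'M[K]_(1 + m, 1 + n), Z1 = U1 *m Z by exists (U1 *m Z).
have [U [Uu UZu UZd]] := IH _ (drsubmx Z1).
have Z1col i : Z1 i 0 = (of_real k (Num.sqrt (nrm2 (col 0 Z))) *: delta_mx 0 0 : 'cV_m.+1) i 0.
  by rewrite -U1Z colE mulmxA -colE [RHS]mxE Z1def.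
have Z1E : Z1 = block_mx (ulsubmx Z1) (ursubmx Z1) 0 (drsubmx Z1).
  rewrite -[LHS]submxK; congr block_mx; apply/matrixP => i j; rewrite [RHS]mxE !mxE ord1.
  by rewrite (_ : lshift n 0 = 0) ?Z1col ?mxE ?mulr0 //; apply: ord_inj.
pose U2 : 'M[K]_(1 + m) := block_mx 1%:M 0 0 U.
have U2u : unitary U2.
  apply: unitaryP; rewrite adjoint_block mulmx_block adjoint1 !adjoint0.
  by rewrite !mulmx0 !mul0mx !addr0 !add0r mulmx1 (proj1 Uu) -scalar_mx_block.
have E : U2 *m Z1 = block_mx (ulsubmx Z1) (ursubmx Z1) 0 (U *m drsubmx Z1).
  by rewrite Z1E mulmx_block !mul1mx !mul0mx !mulmx0 !addr0 !add0r
    block_mxKul block_mxKur block_mxKdr.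
pose T : 'M[K]_(1 + m, 1 + n) :=
  block_mx (ulsubmx Z1) (ursubmx Z1) 0 (U *m drsubmx Z1).
have Tu : @upper (1 + m) (1 + n) T.
  move=> i j; case: (split_ordP i) => i' ->; first by rewrite ord1.
  case: (split_ordP j) => j' ->; first by rewrite block_mxEdl mxE.
  by rewrite block_mxEdr /= ltn_add2l; exact: UZu.
have Td : @real_diag (1 + m) (1 + n) T.
  move=> i j; case: (split_ordP i) => i' ->; case: (split_ordP j) => j' ->.
  - rewrite !ord1 block_mxEul !mxE => _.
    exists (Num.sqrt (nrm2 (col 0 Z))); rewrite sqrtr_ge0; split=> //.
    have -> : lshift m (0 : 'I_1) = 0 by apply: ord_inj.
    have -> : lshift n (0 : 'I_1) = 0 by apply: ord_inj.
    by rewrite Z1col !mxE eqxx mulr1.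
  - by rewrite ord1.
  - by rewrite ord1.
  by rewrite block_mxEdr /= => /eqP; rewrite eqn_add2l => /eqP; exact: UZd.
exists (U2 *m U1); rewrite -mulmxA -Z1def E; split=> //; exact: unitaryM.
Qed.

End Triangular.

(** * The special linear group *)

Section SpecialLinear.
Context {R : realType} {k : division_algebra}.
Local Notation K := (scalars R k).

Lemma SL1 n : @SL R k n 1%:M.
Proof. by case: k => /=; [exact: det1 | exact: det1 | exact: abs_det1]. Qed.

Lemma SL_mul n (x y : 'M[K]_n) : @SL R k n x -> @SL R k n y -> @SL R k n (x *m y).
Proof.
case: k x y => /= x y hx hy.
- by rewrite [LHS]det_mulmx hx hy mul1r.
- by rewrite [LHS]det_mulmx hx hy mul1r.
- by rewrite abs_detM hx hy mul1r.
Qed.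

Lemma SL_unitary_adj n (x : 'M[K]_n) : unitary x -> @SL R k n x -> @SL R k n (adjoint x).
Proof.
move=> xu hx; have := xu; case: k x xu hx => /= x xu hx [xx _].
- have := congr1 (fun y : 'M[R]_n => \det y) xx.
  by rewrite /= [LHS]det_mulmx hx det1 mulr1.
- have := congr1 (fun y : 'M[R[i]]_n => \det y) xx.
  by rewrite /= [LHS]det_mulmx hx det1 mulr1.
- by apply: abs_det_unitary; rewrite adjointK; exact: (proj2 xu).
Qed.

Lemma det_upper (F : comNzRingType) n (A : 'M[F]_n) :
  (forall i j : 'I_n, (j < i)%N -> A i j = 0) -> \det A = \prod_i A i i.
Proof.
move=> A0; apply: (@det_rank_trig _ _ _ (fun i => n - i)%N) => i j ij.
rewrite leq_sub2lE; last exact: ltnW.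
move=> ji; apply: A0.
by rewrite ltn_neqAle ji andbT; apply: contraNneq ij => /ord_inj ->.
Qed.

Lemma SL_upper n (S : 'M[K]_n) (t : 'I_n -> R) : upper S ->
  (forall i, S i i = of_real k (t i)) -> (forall i, 0 <= t i) -> \prod_i t i = 1 -> @SL R k n S.
Proof.
move=> Su St t0 t1; have := abs_det_upper Su St t0; rewrite t1.
case: k S Su St => //= S Su St _.
- apply: (etrans (@det_upper R n S Su)); apply: etrans t1.
  by apply: (@eq_bigr R) => i _; exact: St.
- apply: (etrans (@det_upper R[i] n S Su)).
  apply: (@etrans _ _ (\prod_i t i)%:C); last by rewrite t1.
  rewrite rmorph_prod. by apply: (@eq_bigr R[i]) => i _; exact: St.
Qed.

(** The factor U inherits its determinant from g: the triangular matrix U g has a determinant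
    that is a nonnegative real of modulus one. *)
Lemma SL_QR n (U g : 'M[K]_n) : unitary U -> @SL R k n g -> upper (U *m g) ->
  real_diag (U *m g) -> @SL R k n U.
Proof.
move=> Uu gG Su Sd.
have /choice [t tP] : forall i, exists t, 0 <= t /\ (U *m g) i i = of_real k t.
  by move=> i; exact: Sd.
have St i : (U *m g) i i = of_real k (t i) by have [] := tP i.
have t0 i : 0 <= t i by have [] := tP i.
have p0 : 0 <= \prod_i t i by apply: prodr_ge0.
have := Uu; case: k U g Uu gG Su St {tP Sd} => /= U g Uu gG Su St [UU _].
- have := @det_upper R n (U *m g) Su; rewrite [LHS]det_mulmx gG mulr1 (eq_bigr t) // => dU.
  rewrite dU; have := congr1 (fun y : 'M[R]_n => \det y) UU.
  have -> : adjoint U = U^T by apply/matrixP => i j; rewrite !mxE.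
  by rewrite /= [LHS]det_mulmx det_tr det1 dU -expr2 => /eqP; rewrite sqrp_eq1 // => /eqP.
- have := @det_upper R[i] n (U *m g) Su; rewrite [LHS]det_mulmx gG mulr1.
  rewrite (eq_bigr (fun i => (t i)%:C)) // -rmorph_prod => dU.
  rewrite dU; have := congr1 (fun y : 'M[R[i]]_n => \det y) UU.
  rewrite /= [LHS]det_mulmx [X in X * _]det_map_mx det_tr det1 dU.
  move=> /(congr1 (@complex.Re R)) /= /eqP.
  by rewrite mulr0 subr0 -expr2 sqrp_eq1 // => /eqP ->.
- exact: abs_det_unitary.
Qed.

(** The determinant of a unitary matrix has modulus one, so it can be absorbed by a diagonal unitary
    matrix acting on the last p coordinates; the first p rows stay as they are. *)
Lemma SL_fix p (U : 'M[K]_(p + p)) : (0 < p)%N -> unitary U ->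
  exists D : 'M[K]_p, unitary D /\ @SL R k (p + p) (block_mx 1%:M 0 0 D *m U).
Proof.
case: p U => // p U _ Uu.
have [c [c1 cSL]] : exists c : K, nsq c = 1 /\
    @SL R k _ (block_mx 1%:M 0 0 (diag_mx (\row_j if j == 0 then c else 1)) *m U).
  case: k U Uu => [||] /= U [UU _].
  - have := congr1 (fun y : 'M[R]_(p.+1 + p.+1) => \det y) UU.
    have -> : adjoint U = U^T by apply/matrixP => i j; rewrite !mxE.
    rewrite /= [LHS]det_mulmx det_tr det1 => dd; exists (\det (U : 'M[R]__)); split.
      by rewrite /nsq big_ord1 mxE expr2.
    rewrite [LHS]det_mulmx [X in X * _]det_lblock det1 mul1r det_diag (bigD1 0) //= mxE eqxx.
    by rewrite big1 ?mulr1 // => j /negbTE j0; rewrite mxE j0.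
  - have := congr1 (fun y : 'M[R[i]]_(p.+1 + p.+1) => \det y) UU.
    rewrite /= [LHS]det_mulmx [X in X * _]det_map_mx det_tr det1 => dd.
    exists (conjc (\det (U : 'M[R[i]]__))); split.
      have := @mul_conjr R Complexes (conjc (\det (U : 'M[R[i]]__))).
      rewrite [X in _ * X]conjcK => h; have := esym h; rewrite [RHS]dd => /= /(congr1 (@complex.Re R)).
      by [].
    rewrite [LHS]det_mulmx [X in X * _]det_lblock det1 mul1r det_diag (bigD1 0) //= mxE eqxx.
    by rewrite big1 ?mulr1 // => j /negbTE j0; rewrite mxE j0.
  - exists 1; split; first by rewrite /nsq !(big_ord_recr, big_ord0) /= !mxE /=; ring.
    apply: abs_det_unitary; rewrite (_ : diag_mx _ = 1%:M) -?scalar_mx_block ?mul1mx //.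
    by apply/matrixP => i j; rewrite !mxE if_same.
exists (diag_mx (\row_j if j == 0 then c else 1)); split=> //.
apply: unitaryP; apply/matrixP => i j; rewrite mxE (bigD1 i) //= big1 ?addr0.
  rewrite !mxE; have [_|_] := eqVneq i j; last first.
    by rewrite !mulr0n mulr0.
  rewrite eqxx !mulr1n; case: eqP => _; first by rewrite mul_conjl c1 of_real1.
  by rewrite conjs1 mulr1.
by move=> l /negbTE li; rewrite !mxE li mulr0n conjs0 mul0r.
Qed.
End SpecialLinear.

(** * Subspaces spanned by frames *)

Section GrassmannianAlgebra.
Context {R : realType} {k : division_algebra} {p : nat}.
Local Notation K := (scalars R k).
Local Notation d := (real_dim k).
Local Notation M2p := 'M[K]_(p + p).
Local Notation Gr := (Gr R k p).

Definition inj_cols m n (Z : 'M[K]_(m, n)) := forall v : 'cV[K]_n, Z *m v = 0 -> v = 0.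

Lemma inj_cols_mull m n q (Y : 'M[K]_(q, m)) (Z : 'M[K]_(m, n)) :
  inj_cols (Y *m Z) -> inj_cols Z.
Proof. by move=> h v Zv; apply: h; rewrite -mulmxA Zv mulmx0. Qed.

Lemma inj_cols_left_inv m n (Y : 'M[K]_(n, m)) (Z : 'M[K]_(m, n)) :
  Y *m Z = 1%:M -> inj_cols Z.
Proof. by move=> YZ; apply: (@inj_cols_mull _ _ _ Y) => v; rewrite YZ mul1mx. Qed.

Lemma inj_colsM m n q (Y : 'M[K]_(q, m)) (Z : 'M[K]_(m, n)) :
  inj_cols Y -> inj_cols Z -> inj_cols (Y *m Z).
Proof. by move=> hY hZ v; rewrite -mulmxA => /hY /hZ. Qed.

(** The span of the columns of Z, for an injective Z; elements of the Grassmannian are handled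
    through such frames rather than as sets of vectors. *)
Definition grs (Z : 'M[K]_(p + p, p)) : Gr := to_Gr (range (fun v : 'cV[K]_p => Z *m v)).

Lemma Gr_eq (b c : Gr) : Gr_set b = Gr_set c -> b = c.
Proof. by case: b c => [S hS] [T hT] /= E; subst; rewrite (Prop_irrelevance hS hT). Qed.

Lemma grsE Z : inj_cols Z -> Gr_set (grs Z) = range (fun v : 'cV[K]_p => Z *m v).
Proof. by move=> hZ; apply: to_GrE; exists Z. Qed.

Lemma Gr_grs (b : Gr) : exists Z, inj_cols Z /\ b = grs Z.
Proof.
have [Z [hZ E]] := Gr_prop b; exists Z; split=> //; apply: Gr_eq.
by rewrite grsE.
Qed.

Lemma act_bo (g : M2p) : act g b_o = grs (lsubmx g).
Proof.
congr to_Gr; apply/seteqP; split => [_ [_ [v _ <-] <-]|_ [v _ <-]].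
  exists v => //; rewrite -{2}[g]hsubmxK mul_row_col mulmx0 addr0 //.
exists (col_mx v 0); first by exists v.
by rewrite -{1}[g]hsubmxK mul_row_col mulmx0 addr0.
Qed.

Lemma act_grs (g h : M2p) Z : h *m g = 1%:M -> inj_cols Z -> act g (grs Z) = grs (g *m Z).
Proof.
move=> hg hZ; apply: Gr_eq; rewrite (actE _ hg) !grsE //; last first.
  by apply: inj_colsM => //; exact: inj_cols_left_inv hg.
apply/seteqP; split => [_ [_ [v _ <-] <-]|_ [v _ <-]].
  by exists v => //; rewrite mulmxA.
by exists (Z *m v); [exists v | rewrite mulmxA].
Qed.

(** A change of basis on the right does not change the span. *)
Lemma grs_mulr Z (T T' : 'M[K]_p) : T *m T' = 1%:M -> grs (Z *m T) = grs Z.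
Proof.
move=> TT; congr to_Gr; apply/seteqP; split => [_ [v _ <-]|_ [v _ <-]].
  by exists (T *m v) => //; rewrite mulmxA.
by exists (T' *m v) => //; rewrite mulmxA -(mulmxA Z) TT mulmx1.
Qed.

Lemma group_KP (x : M2p) : group_K x <-> group_G x /\ unitary x.
Proof. by split=> [[]|[? []]]. Qed.

Lemma group_K_unitary (x : M2p) : group_K x -> unitary x.
Proof. by case. Qed.
Lemma group_KG (x : M2p) : group_K x -> group_G x.
Proof. by case. Qed.

Lemma group_K1 : group_K (1%:M : M2p).
Proof. by apply/group_KP; split; [exact: SL1 | exact: unitary1]. Qed.

Lemma group_KM (x y : M2p) : group_K x -> group_K y -> group_K (x *m y).
Proof.
move=> /group_KP [xG xu] /group_KP [yG yu]; apply/group_KP.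
by split; [exact: SL_mul | exact: unitaryM].
Qed.

Lemma group_K_adj (x : M2p) : group_K x -> group_K (adjoint x).
Proof.
move=> /group_KP [xG xu]; apply/group_KP.
by split; [exact: SL_unitary_adj | exact: unitary_adj].
Qed.

Lemma unitary_lsub (x : M2p) : unitary x -> adjoint (lsubmx x) *m lsubmx x = 1%:M.
Proof.
move=> [xx _]; have := congr1 (fun y => ulsubmx (y : M2p)) xx.
rewrite /= -{1 2}[x]hsubmxK /adjoint tr_row_mx map_col_mx mul_col_row block_mxKul => ->.
by rewrite scalar_mx_block block_mxKul.
Qed.

Definition nbar (X : 'M[K]_p) : M2p := block_mx 1%:M 0 X 1%:M.

Lemma upper_block_mx (T Y D : 'M[K]_p) : upper T -> upper D ->
  upper (block_mx T Y 0 D).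
Proof.
move=> Tu Du i j; case: (split_ordP i) => i' ->; case: (split_ordP j) => j' ->.
- by rewrite block_mxEul; exact: Tu.
- by move=> /= h; have := ltn_trans h (ltn_ord i'); rewrite ltnNge leq_addr.
- by rewrite block_mxEdl mxE.
- by rewrite block_mxEdr /= ltn_add2l; exact: Du.
Qed.

Lemma upper1 n : upper (1%:M : 'M[K]_n).
Proof. by move=> i j ij; rewrite mxE; case: eqP => // E; rewrite E ltnn in ij. Qed.

Lemma diag_block1 (X : 'M[K]_p) i :
  block_mx 1%:M X 0 1%:M i i = of_real k (1 : R).
Proof.
by case: (split_ordP i) => i' ->; rewrite ?block_mxEul ?block_mxEdr mxE eqxx of_real1.
Qed.

Lemma SL_upper_block (X : 'M[K]_p) : @SL R k (p + p) (block_mx 1%:M X 0 1%:M).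
Proof.
apply: (@SL_upper R k _ _ (fun=> 1)) => //; last by rewrite big1.
  by apply: upper_block_mx; exact: upper1.
exact: diag_block1.
Qed.

Lemma abs_det_upper_block (X : 'M[K]_p) : abs_det (block_mx 1%:M X 0 1%:M) = 1.
Proof.
rewrite (@abs_det_upper R k _ _ (fun=> 1)) ?big1 //; last exact: diag_block1.
by apply: upper_block_mx; exact: upper1.
Qed.

Lemma weyl_unitary : unitary (weyl : M2p).
Proof.
apply: unitaryP; rewrite /weyl adjoint_block mulmx_block !adjoint0 adjointN adjoint1.
by rewrite !mul0mx !mulmx0 !mulmx1 mulNmx mulmxN opprK mul1mx !addr0 !add0r
  -scalar_mx_block.
Qed.

(** The opposite unipotent group is conjugate to N by the Weyl element, which transfers the
    determinant computations from upper triangular matrices. *)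
Lemma nbar_weyl X :
  nbar X = adjoint weyl *m block_mx 1%:M (- X) 0 1%:M *m weyl.
Proof.
rewrite /weyl adjoint_block !adjoint0 adjointN adjoint1 !mulmx_block.
by rewrite !(mul0mx, mulmx0, mul1mx, mulmx1, add0r, addr0, mulNmx, mulmxN, opprK, oppr0).
Qed.

Lemma abs_det_nbar X : abs_det (nbar X) = 1.
Proof.
rewrite nbar_weyl !abs_detM abs_det_upper_block mulr1 -abs_detM.
by rewrite (proj1 weyl_unitary) abs_det1.
Qed.

Lemma SL_nbar X : group_G (nbar X).
Proof.
rewrite nbar_weyl /group_G.
have := SL_upper_block (- X); have := weyl_unitary; move: (block_mx _ _ _ _).
case: k X weyl => /= _ w b [ww _] hb.
- rewrite [LHS]det_mulmx [X in X * _]det_mulmx hb mulr1.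
  by have := congr1 (fun y : 'M[R]_(p + p) => \det y) ww; rewrite det1 => <-; rewrite [RHS]det_mulmx.
- rewrite [LHS]det_mulmx [X in X * _]det_mulmx hb mulr1.
  by have := congr1 (fun y : 'M[R[i]]_(p + p) => \det y) ww; rewrite det1 => <-; rewrite [RHS]det_mulmx.
- by rewrite !abs_detM hb mulr1 -abs_detM ww abs_det1.
Qed.

(** Triangularize Z by a unitary matrix and read the decomposition backwards. The diagonal is
    positive because Z is injective, and the determinant of the unitary factor is corrected on
    its last p columns, which do not meet the span. *)
Lemma K_frame (hp : (0 < p)%N) (Z : 'M[K]_(p + p, p)) : inj_cols Z ->
  exists x T t, [/\ group_K x, Z = lsubmx x *m T, upper T,
    forall i, T i i = of_real k (t i) & forall i, 0 < t i].
Proof.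
move=> hZ; have [U [Uu UZu UZd]] := QR Z.
have [D [Du DU]] := SL_fix hp Uu.
pose D2 : M2p := block_mx 1%:M 0 0 D.
have D2u : unitary D2.
  apply: unitaryP; rewrite adjoint_block mulmx_block adjoint1 !adjoint0.
  by rewrite !mulmx0 !mul0mx !addr0 !add0r mulmx1 (proj1 Du) -scalar_mx_block.
have xK : group_K (D2 *m U) by apply/group_KP; split=> //; exact: unitaryM.
pose T := usubmx (U *m Z).
have UZE : U *m Z = col_mx T 0.
  rewrite -[LHS]vsubmxK; congr col_mx; apply/matrixP => i j; rewrite [LHS]mxE [RHS]mxE.
  by apply: UZu => /=; rewrite ltn_addr.
have Tu : upper T by move=> i j ij; rewrite mxE; apply: UZu.
have /choice [t tP] : forall i, exists t, 0 <= t /\ T i i = of_real k t.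
  by move=> i; rewrite mxE; exact: UZd.
have Tt i : T i i = of_real k (t i) by have [] := tP i.
have t0 i : 0 <= t i by have [] := tP i.
have [S [TS ST]] : exists S, T *m S = 1%:M /\ S *m T = 1%:M.
  apply: inj_inv => v Tv; apply: hZ; rewrite -[Z]mul1mx -(proj1 Uu) -!mulmxA (mulmxA U).
  by rewrite UZE mul_col_mx Tv mul0mx col_mx0 mulmx0.
exists (adjoint (D2 *m U)), T, t; split=> //.
- exact: group_K_adj.
- rewrite -[LHS]mul1mx -(proj1 Uu) -mulmxA UZE adjointM.
  rewrite -{1}[adjoint U]hsubmxK mul_row_col mulmx0 addr0.
  congr (_ *m _); rewrite -{2}[adjoint U]hsubmxK /D2 adjoint_block adjoint1 !adjoint0.
  by rewrite mul_row_block mulmx1 mulmx0 addr0 row_mxKl.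
- move=> i; rewrite lt_neqAle t0 andbT eq_sym; apply/eqP => ti.
  have := abs_detM T S; rewrite TS abs_det1 (abs_det_upper Tu Tt t0) (bigD1 i) //= ti.
  by rewrite !mul0r => /eqP; rewrite oner_eq0.
Qed.

Lemma Gr_K (hp : (0 < p)%N) (b : Gr) : exists x, group_K x /\ b = act x b_o.
Proof.
have [Z [hZ ->]] := Gr_grs b; have [x [T [t [xK ZE Tu Tt t0]]]] := K_frame hp hZ.
exists x; split=> //; rewrite act_bo ZE.
have [S [TS ST]] : exists S, T *m S = 1%:M /\ S *m T = 1%:M.
  by apply: inj_inv; apply: (@inj_cols_mull _ _ _ (lsubmx x)); rewrite -ZE.
exact: grs_mulr TS.
Qed.

Lemma adjoint_row m n1 n2 (x1 : 'M[K]_(m, n1)) (x2 : 'M[K]_(m, n2)) :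
  adjoint (row_mx x1 x2) = col_mx (adjoint x1) (adjoint x2).
Proof. by rewrite /adjoint tr_row_mx map_col_mx. Qed.

(** The last p columns of x span the orthogonal complement of the first p, and right multiplication
    by the Weyl element exchanges the two blocks. *)
Lemma perp_act (x : M2p) : group_K x -> perp (act x b_o) = act (x *m weyl) b_o.
Proof.
move=> /group_KP [_ [xx xx']].
have [x1 [x2 xE]] : exists x1 x2, x = row_mx x1 x2.
  by exists (lsubmx x), (rsubmx x); rewrite hsubmxK.
move: xx xx'; rewrite xE adjoint_row mul_row_col mul_col_row scalar_mx_block.
move=> /eq_block_mx [x11 x12 x21 x22] e.
have wE : lsubmx (row_mx x1 x2 *m weyl) = x2.
  by rewrite /weyl mul_row_block row_mxKl mulmx0 add0r mulmx1.
have i1 : inj_cols x1 by exact: inj_cols_left_inv x11.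
have i2 : inj_cols x2 by exact: inj_cols_left_inv x22.
rewrite !act_bo wE row_mxKl /perp; congr to_Gr; rewrite grsE //.
apply/seteqP; split => [v hv|_ [v _ <-] _ [w _ <-]].
  have v1 : adjoint x1 *m v = 0.
    rewrite -[LHS]adjointK adjointM adjointK.
    suff -> : adjoint v *m x1 = 0 by rewrite adjoint0.
    apply/matrixP => i j; rewrite [RHS]mxE.
    have /matrixP/(_ i 0) := hv (x1 *m delta_mx j (0 : 'I_1)) (ex_intro2 _ _ _ I erefl).
    by rewrite mulmxA -colE !mxE.
  exists (adjoint x2 *m v) => //.
  rewrite -scalar_mx_block in e.
  by rewrite -[RHS]mul1mx -e mulmxDl -!mulmxA v1 mulmx0 add0r.
by rewrite adjointM -mulmxA (mulmxA _ x1) x21 mul0mx mulmx0.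
Qed.

Lemma group_NbarP (y : M2p) : group_Nbar R k p y <-> exists X, y = nbar X.
Proof.
have E (X : 'M[K]_p) : nbar (- adjoint X) *m adjoint (block_mx 1%:M X 0 1%:M) = 1%:M /\
   adjoint (block_mx 1%:M X 0 1%:M) *m nbar (- adjoint X) = 1%:M.
  rewrite /nbar adjoint_block adjoint1 adjoint0 !mulmx_block.
  rewrite !(mul0mx, mulmx0, mul1mx, mulmx1, add0r, addr0) subrr addNr.
  by rewrite -scalar_mx_block.
split=> [[_ [[X ->] h1 h2]]|[X ->]].
  exists (- adjoint X); have [e1 e2] := E X.
  by rewrite -[LHS]mulmx1 -e2 mulmxA h1 mul1mx.
exists (block_mx 1%:M (- adjoint X) 0 1%:M); have [e1 e2] := E (- adjoint X).
by split; [exists (- adjoint X) | move: e1 | move: e2]; rewrite // adjointN adjointK opprK.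
Qed.

Lemma abs_det_scale n r (x : 'M[K]_n) : 0 <= r ->
  abs_det (of_real k r *: x) = r ^+ n * abs_det x.
Proof.
move=> r0; rewrite -mul_scalar_mx abs_detM; congr (_ * _).
rewrite (@abs_det_upper R k n _ (fun=> r)) ?prodr_const ?card_ord //.
- by move=> i j ij; rewrite mxE; case: eqP => // E; rewrite E ltnn in ij.
- by move=> i; rewrite mxE eqxx.
Qed.

(** Two orthonormal frames of the same span differ by a unitary matrix, so the modulus of the
    determinant of the coordinate matrix depends on the product only. *)
Lemma abs_det_gram n m (B C : 'M[K]_(m, n)) (T S : 'M[K]_n) :
  adjoint B *m B = 1%:M -> adjoint C *m C = 1%:M -> B *m T = C *m S ->
  (exists T', T *m T' = 1%:M) -> abs_det T = abs_det S.
Proof.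
move=> BB CC E [T' TT].
have TS : T = adjoint B *m C *m S by rewrite -mulmxA -E mulmxA BB mul1mx.
have ST : S = adjoint C *m B *m T by rewrite -mulmxA E mulmxA CC mul1mx.
have U1 : adjoint B *m C *m (adjoint C *m B) = 1%:M.
  rewrite -[LHS]mulmx1 -{1}TT mulmxA -(mulmxA (_ *m C)) -ST -TS.
  exact: TT.
rewrite TS abs_detM abs_det_unitary ?mul1r //.
have [_ V] : unitary (adjoint C *m B) by apply: unitaryP; rewrite adjointM adjointK.
by rewrite -[RHS]V !adjointM !adjointK.
Qed.
End GrassmannianAlgebra.

(** * The Iwasawa projection on the opposite unipotent group *)

Section Height.
Context {R : realType} {k : division_algebra} {p : nat}.
Local Notation K := (scalars R k).
Local Notation d := (real_dim k).
Local Notation M2p := 'M[K]_(p + p).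

Lemma mulmx_real_scalar m n r (x : 'M[K]_(m, n)) :
  x *m (of_real k r)%:M = of_real k r *: x.
Proof. by rewrite -scalemx1 mulmx_realZ mulmx1. Qed.

Lemma nbar_col X : nbar X *m col_mx 1%:M 0 = col_mx 1%:M X :> 'M[K]_(p + p, p).
Proof. by rewrite mul_block_col !mulmx1 !mulmx0 !addr0. Qed.

Lemma lsubmx_nbar (X : 'M[K]_p) : lsubmx (nbar X) = col_mx 1%:M X.
Proof. by rewrite /nbar block_mxEh row_mxKl. Qed.

Lemma inj_cols_nbar (X : 'M[K]_p) : inj_cols (col_mx 1%:M X).
Proof.
apply: (@inj_cols_left_inv _ _ _ _ (row_mx 1%:M 0)).
by rewrite mul_row_col mulmx1 mul0mx addr0.
Qed.

(** The QR decomposition of nbar X, with the block diagonal part of its triangular factor split into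
    a scalar factor in A and a factor in M. *)
Lemma Iwasawa_exists (hp : (0 < p)%N) (X : 'M[K]_p) : exists s x m n,
  [/\ group_K x, group_M m, group_N n & nbar X = x *m m *m expH s *m n].
Proof.
have [U [Uu Su Sd]] := QR (nbar X).
have USL := SL_QR Uu (SL_nbar X) Su Sd.
have S1 : abs_det (U *m nbar X) = 1.
  by rewrite abs_detM abs_det_nbar mulr1 abs_det_unitary // (proj1 Uu).
have UE : nbar X = adjoint U *m (U *m nbar X) by rewrite mulmxA (proj1 Uu) mul1mx.
move: (U *m nbar X) UE Su Sd S1 => S UE Su Sd S1.
have /choice [t tP] : forall i, exists t, 0 <= t /\ S i i = of_real k t.
  by move=> i; exact: Sd.
have St i : S i i = of_real k (t i) by have [] := tP i.
have t0 i : 0 <= t i by have [] := tP i.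
pose T := ulsubmx S; pose Y := ursubmx S; pose D := drsubmx S.
have SE : S = block_mx T Y 0 D.
  rewrite -[LHS]submxK; congr block_mx; apply/matrixP => i j; rewrite !mxE.
  by apply: Su => /=; rewrite ltn_addr.
have Tu : upper T by move=> i j ij; rewrite !mxE; apply: Su.
have Du : upper D by move=> i j ij; rewrite !mxE; apply: Su; rewrite /= ltn_add2l.
pose tau := \prod_i t (lshift p i); pose tau' := \prod_i t (rshift p i).
have Ta : abs_det T = tau.
  by apply: abs_det_upper => // i; rewrite !mxE St.
have Da : abs_det D = tau'.
  by apply: abs_det_upper => // i; rewrite !mxE St.
have tt : tau * tau' = 1.
  by rewrite -S1 (abs_det_upper Su St t0) big_split_ord.
have tau0 : 0 < tau.
  rewrite lt_neqAle prodr_ge0 ?andbT // eq_sym; apply/eqP => h.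
  by move: tt; rewrite h mul0r => /eqP; rewrite eq_sym oner_eq0.
(* exp (s / 2) is the p-th root of |det T|, so that a and b have determinants of modulus one. *)
pose s := 2 * ln tau / p%:R.
have es : expR (s / 2) ^+ p = tau.
  rewrite -expRM_natl -[RHS]lnK ?posrE //; congr expR; rewrite /s.
  by field; rewrite pnatr_eq0 -lt0n.
have ens : expR (- (s / 2)) ^+ p = tau'.
  rewrite expRN exprVn es; apply: (mulfI (lt0r_neq0 tau0)).
  by rewrite mulfV ?tt // lt0r_neq0.
pose a := of_real k (expR (- (s / 2))) *: T.
pose b := of_real k (expR (s / 2)) *: D.
have [T' [TT T'T]] : exists T', T *m T' = 1%:M /\ T' *m T = 1%:M.
  apply: inj_inv => v Tv.
  have Sv : S *m col_mx v 0 = 0 by rewrite SE mul_block_col Tv mul0mx !mulmx0 !addr0 col_mx0.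
  have : nbar X *m col_mx v 0 = 0 by rewrite UE -mulmxA Sv mulmx0.
  by rewrite mul_block_col mul1mx !mulmx0 addr0 -[RHS]col_mx0 => /eq_col_mx [].
have M1 : block_mx a 0 0 b *m expH s = block_mx T 0 0 D.
  rewrite /expH mulmx_block !mulmx0 !mul0mx !mulmx_real_scalar !addr0 add0r.
  by rewrite /a /b !scalerA -!of_realM -!expRD addrN addNr expR0 of_real1 !scale1r.
have aSL : group_G (block_mx a 0 0 b).
  apply: (@SL_upper R k _ _
    (fun i => (if (i < p)%N then expR (- (s / 2)) else expR (s / 2)) * t i)).
  - apply: upper_block_mx => i j ij; rewrite mxE ?Tu ?Du ?mulr0 //.
  - move=> i; case: (split_ordP i) => i' -> /=.
      by rewrite block_mxEul mxE of_realM -St SE block_mxEul.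
    by rewrite block_mxEdr mxE of_realM -St SE block_mxEdr.
  - by move=> i; rewrite mulr_ge0 //; case: ifP => _; exact: expR_ge0.
  - rewrite big_split_ord /=.
    rewrite (eq_bigr (fun i => expR (- (s / 2)) * t (lshift p i))); last first.
      by move=> i _; rewrite ltn_ord.
    rewrite [X in _ * X](eq_bigr (fun i => expR (s / 2) * t (rshift p i))); last first.
      by move=> i _; rewrite ltnNge leq_addr.
    rewrite !big_split /= !prodr_const !card_ord ens es.
    by rewrite -/tau -/tau' mulrACA tt (mulrC tau') tt mulr1.
exists s, (adjoint U), (block_mx a 0 0 b), (block_mx 1%:M (T' *m Y) 0 1%:M); split.
- by apply: group_K_adj; apply/group_KP.
- exists a, b; split=> //.
    by rewrite abs_det_scale ?expR_ge0 // ens Ta mulrC tt.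
  by rewrite abs_det_scale ?expR_ge0 // es Da tt.
- by exists (T' *m Y).
- rewrite {1}UE -!mulmxA; congr (_ *m _); rewrite mulmxA M1 SE mulmx_block.
  by rewrite !(mulmx0, mul0mx, mulmx1, addr0, add0r) mulmxA TT mul1mx.
Qed.

(** The height s = log a is determined by the first p columns: they are an orthonormal frame times
    exp (s/2) a with |det a| = 1, and [abs_det_gram] compares this with any other such product. *)
Lemma log_aP (hp : (0 < p)%N) (X : 'M[K]_p) (x : M2p) (T T' : 'M[K]_p) : unitary x ->
  col_mx 1%:M X = lsubmx x *m T -> T *m T' = 1%:M ->
  expR (log_a (nbar X) * p%:R / 2) = abs_det T.
Proof.
move=> xu XT TT.
have [s0 hs0] := Iwasawa_exists hp X.
rewrite /log_a; case: xgetP => [s _|/(_ s0) /(_ hs0) //].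
move=> [y [m [n [yK [a [b [-> _ a1 b1]]] [Y ->] E]]]].
have E1 : lsubmx y *m (of_real k (expR (s / 2)) *: a) = lsubmx x *m T.
  rewrite -XT -nbar_col E -!mulmxA /expH.
  rewrite !(mul_block_col, mulmx1, mulmx0, mul0mx, addr0, add0r).
  by rewrite mulmx_real_scalar -{2}[y]hsubmxK mul_row_col mulmx0 addr0.
rewrite (@abs_det_gram _ _ _ _ (lsubmx x) (lsubmx y) T (of_real k (expR (s / 2)) *: a)).
- by rewrite abs_det_scale ?expR_ge0 // a1 mulr1 -expRM_natl; congr expR; ring.
- exact: unitary_lsub.
- by apply: unitary_lsub; exact: group_K_unitary.
- by rewrite E1.
- by exists T'.
Qed.
End Height.

(** * Lebesgue outer measure *)

Section OuterMeasure.
Context {R : realType} {m : nat}.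
Hypothesis m0 : (0 < m)%N.
Local Notation V := 'rV[R]_m.
Implicit Types (a b v : V) (E F : set V).
Local Notation vol := (@lebesgue_volume R m).

Definition bvol a b : R := \prod_(i < m) (b 0 i - a 0 i).
Definition le_rv a b := forall i, a 0 i <= b 0 i.

Lemma bvol_ge0 a b : le_rv a b -> 0 <= bvol a b.
Proof. by move=> ab; apply: prodr_ge0 => i _; rewrite subr_ge0. Qed.

Lemma bvol0 a : bvol a a = 0.
Proof. by rewrite /bvol (bigD1 (Ordinal m0)) //= subrr mul0r. Qed.

Local Open Scope ereal_scope.

Lemma vol_ge0 E : 0 <= vol E.
Proof.
apply: le_ereal_inf_tmp => _ [a [b [ab _ ->]]].
by apply: nneseries_ge0 => n _ _; rewrite lee_fin; exact: bvol_ge0 (ab n).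
Qed.

Lemma vol_le_cover E (a b : nat -> V) : (forall n, le_rv (a n) (b n)) ->
  E `<=` \bigcup_n box (a n) (b n) -> vol E <= \sum_(0 <= n <oo) (bvol (a n) (b n))%:E.
Proof. by move=> ab Eab; apply: ereal_inf_lbound; exists a, b. Qed.

(** Cover each F n up to e / 2^(n+1) and merge the countably many covers through a bijection of the
    pairs of indices with the integers. *)
Lemma vol_subadditive E (F : nat -> set V) : E `<=` \bigcup_n F n ->
  vol E <= \sum_(0 <= n <oo) vol (F n).
Proof.
move=> EF; have [[i ioo]|] := pselect (exists i, vol (F i) = +oo).
  rewrite (eseries_pinfty _ _ ioo) ?leey// => n _.
  by rewrite -ltNye (lt_le_trans _ (vol_ge0 _)).
rewrite -forallNE => Foo.
suff add2e (e : {posnum R}) : vol E <= \sum_(0 <= n <oo) vol (F n) + e%:num%:E.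
  by apply/lee_addgt0Pr => _/posnumP[].
rewrite (le_trans _ (epsilon_trick _ _ _))//; last by move=> n; exact: vol_ge0.
pose P n (B : nat -> V * V) := [/\ forall l, le_rv (B l).1 (B l).2,
   F n `<=` \bigcup_l box (B l).1 (B l).2 &
   \sum_(0 <= l <oo) (bvol (B l).1 (B l).2)%:E <= vol (F n) + (e%:num / (2 ^ n.+1)%:R)%:E].
have [G PG] : {G : nat -> nat -> V * V & forall n, P n (G n)}.
  apply: (@choice _ _ P) => n; rewrite /P /lebesgue_volume.
  set S := (X in ereal_inf X); move infS : (ereal_inf S) => iS.
  case: iS infS => [r Sr|Soo|Soo].
  - have en1 : (0 < e%:num / (2 ^ n.+1)%:R)%R by [].
    have /(lb_ereal_inf_adherent en1) : ereal_inf S \is a fin_num by rewrite Sr.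
    move=> [x [a [b [ab Fab xE]]] xS].
    by exists (fun l => (a l, b l)); split => //=; rewrite -[leLHS]xE -Sr; exact/ltW.
  - by have := Foo n; rewrite /lebesgue_volume -/S Soo.
  - by have := vol_ge0 (F n); rewrite /lebesgue_volume -/S Soo.
pose W (x : nat * nat) : \bar R := (bvol (G x.1 x.2).1 (G x.1 x.2).2)%:E.
have W0 x : 0 <= W x by rewrite lee_fin; apply: bvol_ge0; have [] := PG x.1.
have /card_esym/ppcard_eqP[f] := card_nat2.
apply: (@le_trans _ _ (\sum_(0 <= n <oo) W (f n))).
  apply: vol_le_cover => [n|]; first by have [] := PG (f n).1.
  move=> x /EF [n _ Fx]; have [_ /(_ _ Fx) [l _ xl] _] := PG n.
  by exists (f^-1%FUN (n, l)) => //=; rewrite invK ?inE.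
have -> : \sum_(0 <= n <oo) W (f n) = \sum_(0 <= n <oo) \sum_(0 <= l <oo) W (n, l).
  rewrite nneseries_esumT // -(reindex_esum setT setT f) //.
  rewrite nneseries_esumT => [|n]; last by apply: nneseries_ge0 => l _ _; exact: W0.
  under [RHS]eq_esum do rewrite nneseries_esumT //.
  rewrite esum_esum //; congr esum.
    by apply/seteqP.
apply: lee_nneseries => [i _ _|n _]; first by apply: nneseries_ge0 => l _ _; exact: W0.
by have [] := PG n.
Qed.

Lemma vol_fin_cover E (M : nat) (a b : nat -> V) :
  (forall n, (n < M)%N -> le_rv (a n) (b n)) ->
  (forall x, E x -> exists2 n, (n < M)%N & box (a n) (b n) x) ->
  vol E <= (\sum_(n < M) bvol (a n) (b n))%:E.
Proof.
move=> ab Eab; pose a' n := if (n < M)%N then a n else 0%R.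
pose b' n := if (n < M)%N then b n else 0%R.
have ab' n : le_rv (a' n) (b' n).
  by rewrite /a' /b'; case: ifP => [/ab|] // _ i; rewrite lexx.
apply: (@le_trans _ _ (\sum_(0 <= n <oo) (bvol (a' n) (b' n))%:E)).
  apply: vol_le_cover => // x /Eab [n nM xn]; exists n => //.
  by rewrite /a' /b' nM.
rewrite (nneseries_split 0 M) => [|n _]; last by rewrite lee_fin; exact: bvol_ge0.
rewrite add0n eseries0 ?adde0 => [|n Mn _]; last first.
  by rewrite /a' /b' ltnNge Mn /= bvol0.
rewrite big_mkord sumEFin lee_fin le_eqVlt; apply/orP; left; apply/eqP.
by apply: eq_bigr => i _; rewrite /a' /b' ltn_ord.
Qed.

(** Testing an upper bound against covers; the case C = 0 needs one cover, since the infimum may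
    be infinite. *)
Lemma le_mul_vol E (C : R) (x : \bar R) : (0 <= C)%R ->
  (forall a b : nat -> V, (forall n, le_rv (a n) (b n)) ->
     E `<=` \bigcup_n box (a n) (b n) ->
     x <= C%:E * \sum_(0 <= n <oo) (bvol (a n) (b n))%:E) ->
  x <= C%:E * vol E.
Proof.
move=> C0 H; have [C00|Cn0] := eqVneq C 0%R; last first.
  have Cp : (0 < C)%R by rewrite lt_neqAle eq_sym Cn0.
  rewrite -lee_pdivrMl //; apply: le_ereal_inf_tmp => _ [a [b [ab Eab ->]]].
  by rewrite lee_pdivrMl //; exact: H.
pose c n : V := const_mx n%:R.
have := H (fun n => (- c n)%R) c; rewrite C00 !mul0e; apply.
  by move=> n i; rewrite !mxE ge0_cp.
move=> y _; exists (Num.truncn (\sum_i `|y 0 i|)).+1 => //= i.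
have : (`|y 0 i| <= (Num.truncn (\sum_i `|y 0 i|)).+1%:R)%R.
  apply: (@le_trans _ _ (\sum_i `|y 0 i|)%R); last by rewrite ltW // truncnS_gt.
  by rewrite (bigD1 i) //= lerDl sumr_ge0.
by rewrite ler_norml !mxE in_itv.
Qed.

(** A bound on the images of boxes is enough, since an image of a cover is a cover. *)
Lemma vol_image_le (f : V -> V) (C : R) E : (0 <= C)%R ->
  (forall a b, le_rv a b -> vol (f @` box a b) <= (C * bvol a b)%:E) ->
  vol (f @` E) <= C%:E * vol E.
Proof.
move=> C0 fC; apply: le_mul_vol => // a b ab Eab.
apply: (@le_trans _ _ (\sum_(0 <= n <oo) vol (f @` box (a n) (b n)))).
  apply: vol_subadditive => _ [x /Eab [n _ xn] <-]; exists n => //; exists x => //.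
rewrite -nneseriesZl => [|n _]; last by rewrite lee_fin; exact: bvol_ge0 (ab n).
apply: lee_nneseries => [n _ _|n _]; first exact: vol_ge0.
by rewrite -EFinM; exact: fC (ab n).
Qed.
End OuterMeasure.

(** * Volume of linear images *)

Section PolynomialLimit.
Context {R : realType}.

(** The slicing estimates hold up to an error that is polynomial in 1 / (n+1). *)
Lemma le_poly0 (P : {poly R}) (x : \bar R) : (0 <= x)%E ->
  (forall n : nat, (x <= (P.[n.+1%:R^-1])%:E)%E) -> (x <= (P.[0])%:E)%E.
Proof.
move=> x0 h; have := h 0%N; case: x x0 h => [x|//|//] _ h _.
rewrite lee_fin.
have cP : (fun n => P.[n.+1%:R^-1]) @ \oo --> P.[0].
  apply: (@cvg_comp _ _ _ (fun n : nat => n.+1%:R^-1 : R) (fun t => P.[t]) _ (nbhs (0 : R))).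
    exact: cvg_harmonic.
  exact: continuous_horner.
rewrite -(cvg_lim _ cP) //; apply: limr_ge; first by apply/cvg_ex; exists P.[0].
by apply: nearW => n; rewrite -lee_fin; exact: h.
Qed.
End PolynomialLimit.

Section LinearVolume.
Context {R : realType} {m : nat}.
Hypothesis m0 : (0 < m)%N.
Local Notation V := 'rV[R]_m.
Implicit Types (a b v w : V) (E F : set V) (A B : 'M[R]_m).
Local Notation vol := (@lebesgue_volume R m).

Definition rmul A (v : V) : V := v *m A.

(** The identity with its row i replaced by w. These generate all invertible matrices up to
    permutations, and change a box in the direction of one coordinate only. *)
Definition row_repl (i : 'I_m) w : 'M[R]_m :=
  1%:M + delta_mx i 0 *m (w - delta_mx 0 i).

Lemma rmul_row_repl i w v j :
  rmul (row_repl i w) v 0 j = (if j == i then 0 else v 0 j) + v 0 i * w 0 j.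
Proof.
rewrite /rmul /row_repl mulmxDr mulmx1 mulmxA -colE.
rewrite mxE [X in _ + X]mxE big_ord1 !mxE eqxx /=.
by case: eqP => [->|_]; rewrite ?subr0 //=; ring.
Qed.

Lemma slice_exists (M : nat) (x dl : R) : 0 <= x -> x <= M%:R * dl -> (0 < M)%N -> exists2 s : nat,
  (s < M)%N & s%:R * dl <= x <= s%:R * dl + dl.
Proof.
move=> x0; elim: M => // M IH xM _.
have [xs|xs] := leP x (M%:R * dl); last first.
  exists M => //; rewrite (ltW xs) /=; apply: (le_trans xM).
  by rewrite -natr1 mulrDl mul1r.
have [M0|Mp] := posnP M.
  exists 0%N => //; rewrite mul0r x0 /= add0r.
  by move: xM; rewrite M0 mul1r.
by have [s sM h] := IH xs Mp; exists s => //; rewrite ltnS ltnW.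
Qed.

(** Cut the box into M+1 slices along coordinate i. The image of a slice is contained in a box whose
    sides j other than i exceed those of the original by at most dl |w_j|, so the sum of the
    volumes tends to |w_i| times the volume as M grows. *)
Lemma vol_row_repl_box i w a b : le_rv a b ->
  (vol (rmul (row_repl i w) @` box a b) <= (`|w 0 i| * bvol a b)%:E)%E.
Proof.
move=> ab.
(* The total volume of the boxes around the M+1 image slices, as a polynomial in 1 / (M+1). *)
pose P : {poly R} := ((b 0 i - a 0 i) * `|w 0 i|)%:P *
  \prod_(j | j != i) ((b 0 j - a 0 j)%:P + ((b 0 i - a 0 i) * `|w 0 j|) *: 'X).
have slice M : (vol (rmul (row_repl i w) @` box a b) <= (P.[M.+1%:R^-1])%:E)%E.
  pose dl := (b 0 i - a 0 i) / M.+1%:R.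
  have dl0 : 0 <= dl by rewrite divr_ge0 ?subr_ge0.
  pose lo s : V := \row_j ((if j == i then 0 else a 0 j) +
    (a 0 i + s%:R * dl) * w 0 j + Num.min 0 (dl * w 0 j)).
  pose hi s : V := \row_j ((if j == i then 0 else b 0 j) +
    (a 0 i + s%:R * dl) * w 0 j + Num.max 0 (dl * w 0 j)).
  have hilo s j : hi s 0 j - lo s 0 j =
      (if j == i then 0 else b 0 j - a 0 j) + dl * `|w 0 j|.
    rewrite !mxE -[`|w 0 j|]/(`|w 0 j|) -(ger0_norm dl0) -normrM (ger0_norm dl0).
    case: (lerP 0 (dl * w 0 j)) => h; [rewrite ger0_norm // | rewrite ltr0_norm //];
    by case: (j == i); ring.
  have le s : le_rv (lo s) (hi s).
    move=> j; rewrite -subr_ge0 hilo; apply: addr_ge0; last exact: mulr_ge0.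
    by case: ifP => // _; rewrite subr_ge0.
  apply: (le_trans (@vol_fin_cover _ _ m0 _ M.+1 lo hi _ _)) => //.
    move=> _ [v vab <-].
    have /andP [vi1 vi2] : a 0 i <= v 0 i <= b 0 i by have := vab i; rewrite in_itv.
    have [s sM /andP [s1 s2]] : exists2 s : nat, (s < M.+1)%N &
        s%:R * dl <= v 0 i - a 0 i <= s%:R * dl + dl.
      apply: slice_exists => //; first by rewrite subr_ge0.
      by rewrite /dl mulrC divfK ?lerD2r // pnatr_eq0.
    exists s => // j; rewrite in_itv /= rmul_row_repl !mxE.
    have /andP [vj1 vj2] : a 0 j <= v 0 j <= b 0 j by have := vab j; rewrite in_itv.
    have [e [e0 edl vE]] : exists e, [/\ 0 <= e, e <= dl & v 0 i = a 0 i + s%:R * dl + e].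
      by exists (v 0 i - (a 0 i + s%:R * dl)); split; [lra | lra | ring].
    rewrite vE mulrDl.
    have h1 : (if j == i then 0 else a 0 j) <= (if j == i then 0 else v 0 j) by case: ifP.
    have h2 : (if j == i then 0 else v 0 j) <= (if j == i then 0 else b 0 j) by case: ifP.
    have h3 : Num.min 0 (dl * w 0 j) <= e * w 0 j.
      have [w0|w0] := leP 0 (w 0 j).
        by rewrite ge_min (mulr_ge0 e0 w0).
      by rewrite ge_min ler_nM2r // edl orbT.
    have h4 : e * w 0 j <= Num.max 0 (dl * w 0 j).
      have [w0|w0] := leP 0 (w 0 j).
        by rewrite le_max ler_wpM2r ?orbT.
      by rewrite le_max mulr_ge0_le0 // ltW.
    by apply/andP; split; lra.
  rewrite lee_fin (eq_bigr (fun=> P.[M.+1%:R^-1] / M.+1%:R)) => [|s _].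
    set y := P.[_]; set z := M.+1%:R^-1.
    by rewrite sumr_const card_ord -mulr_natr -mulrA mulVf ?mulr1 // pnatr_eq0.
  rewrite /bvol (bigD1 i) //= hilo eqxx add0r /P hornerM hornerC.
  rewrite horner_prod; set X := \prod_(j | _) _; set Y := \prod_(j | _) _.
  have -> : X = Y.
    apply: eq_bigr => j /negbTE ji; rewrite hilo ji hornerD hornerC hornerZ hornerX.
    by rewrite /dl mulrAC.
  by rewrite /dl; set z := _^-1; ring.
have : (vol (rmul (row_repl i w) @` box a b) <= (P.[0])%:E)%E.
  by apply: le_poly0 slice; exact: vol_ge0.
have -> : bvol a b = (b 0 i - a 0 i) * \prod_(j | j != i) (b 0 j - a 0 j).
  by rewrite /bvol (bigD1 i).
rewrite /P hornerM hornerC horner_prod.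
set X := \prod_(j | _) _; set Y := \prod_(j | _) _.
have -> : X = Y.
  by apply: eq_bigr => j _; rewrite hornerD hornerC hornerZ hornerX mulr0 addr0.
by rewrite (_ : `|w 0 i| * _ = (b 0 i - a 0 i) * `|w 0 i| * Y) //; ring.
Qed.

Lemma det_row_repl i w : \det (row_repl i w) = w 0 i.
Proof.
rewrite (@det_rank_trig _ _ _ (fun l => (l == i) : nat)) => [|l j lj].
  rewrite (bigD1 i) //= big1 ?mulr1 => [|j /negbTE ji].
    by rewrite /row_repl !mxE big_ord1 !mxE !eqxx /=; ring.
  by rewrite /row_repl !mxE big_ord1 !mxE !eqxx ji /=; ring.
move=> hl; have li : l != i.
  by apply: contraNneq lj => li; move: hl; rewrite li eqxx; case: eqP => // ->.
rewrite /row_repl !mxE big_ord1 !mxE (negbTE lj) (negbTE li) /=; ring.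
Qed.

Definition vol_le A := forall E, (vol (rmul A @` E) <= `|\det A|%:E * vol E)%E.

Lemma vol_leM A B : vol_le A -> vol_le B -> vol_le (A *m B).
Proof.
move=> hA hB E; have -> : rmul (A *m B) @` E = rmul B @` (rmul A @` E).
  rewrite image_comp; congr (image _); apply/funext => v.
  by rewrite /rmul /= mulmxA.
apply: (le_trans (hB _)); rewrite det_mulmx normrM mulrC EFinM -muleA.
by apply: lee_wpmul2l; rewrite ?lee_fin.
Qed.

Lemma vol_le_row_repl i w : vol_le (row_repl i w).
Proof.
move=> E; rewrite det_row_repl; apply: (@vol_image_le _ _ (rmul _) `|w 0 i| E) => // a b.
exact: vol_row_repl_box.
Qed.

Lemma vol_le_perm (s : {perm 'I_m}) : vol_le (perm_mx s).
Proof.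
have pE v j : rmul (perm_mx s) v 0 j = v 0 ((s^-1)%g j).
  by rewrite /rmul -{1}(invgK s) -col_permE mxE.
move=> E; rewrite det_perm normrX normrN1 expr1n; apply: (@vol_image_le _ _ (rmul _) 1 E) => // a b ab.
pose a' : V := \row_j a 0 ((s^-1)%g j); pose b' : V := \row_j b 0 ((s^-1)%g j).
apply: (le_trans (@vol_fin_cover _ _ m0 _ 1 (fun=> a') (fun=> b') _ _)).
- by move=> _ _ j; rewrite !mxE.
- by move=> _ [v vab <-]; exists 0%N => // j; rewrite pE !mxE; exact: vab.
rewrite big_ord1 mul1r lee_fin /bvol [leRHS](reindex_inj (@perm_inj _ (s^-1)%g)).
by rewrite le_eqVlt; apply/orP; left; apply/eqP/eq_bigr => j _; rewrite !mxE.
Qed.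

(** Replacing the rows of an invertible matrix one at a time, in the order given by h. *)
Lemma vol_le_chain A (h : 'I_m -> nat) : injective h -> 
  (forall n, (\matrix_i if (h i < n)%N then row i A else delta_mx 0 i) \in unitmx) ->
  vol_le A.
Proof.
move=> hinj Bu; pose B n := \matrix_i if (h i < n)%N then row i A else delta_mx 0 i.
have Bv n : vol_le (B n).
  elim: n => [|n IH].
    have -> : B 0%N = perm_mx 1.
      by apply/row_matrixP => i; rewrite rowK perm_mx1 row1.
    exact: vol_le_perm.
  have [[i hi]|no] := pselect (exists i, h i = n); last first.
    have -> // : B n.+1 = B n.
    apply/row_matrixP => i; rewrite !rowK ltnS leq_eqVlt.
    by case: eqP => // hi; case: no; exists i.
  have -> : B n.+1 = row_repl i (row i A *m invmx (B n)) *m B n.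
    rewrite /row_repl mulmxDl mul1mx -mulmxA mulmxBl -mulmxA mulVmx ?Bu // mulmx1 -rowE.
    apply/matrixP => j l; rewrite [LHS]mxE [RHS]mxE [X in _ + X]mxE big_ord1.
    rewrite [X in _ + _ * X]mxE [X in _ + X * _]mxE andbT.
    have [->|ji] := eqVneq j i.
      by rewrite hi ltnSn mul1r [X in _ + (_ + X)]mxE [X in _ - X]mxE addrC subrK.
    rewrite mul0r addr0 [RHS]mxE ltnS leq_eqVlt.
    by case: eqP => // hj; case/eqP: ji; apply: hinj; rewrite hj hi.
  by apply: vol_leM => //; exact: vol_le_row_repl.
suff -> : A = B (\max_i h i).+1 by [].
by apply/row_matrixP => i; rewrite rowK ltnS leq_bigmax.
Qed.
End LinearVolume.

Section LinearVolumeFormula.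
Context {R : realType}.

Lemma vol_le_trig n (A : 'M[R]_n.+1) : (forall i, A i i != 0) ->
  is_trig_mx A \/ is_trig_mx A^T -> vol_le A.
Proof.
move=> A0 At; apply: (@vol_le_chain _ _ (ltn0Sn n) A (fun i => i)); first exact: ord_inj.
move=> l; rewrite unitmxE; set B := \matrix_i _.
have BE i j : B i j = if (i < l)%N then A i j else (i == j)%:R.
  by rewrite mxE; case: ifP; rewrite !mxE ?eqxx //= eq_sym.
suff -> : \det B = \prod_i B i i.
  rewrite unitfE; apply/prodf_neq0 => i _; rewrite BE eqxx.
  by case: ifP; rewrite ?oner_neq0.
case: At => /is_trig_mxP At.
- apply: det_trig; apply/is_trig_mxP => i j ij; rewrite BE At // ?if_same.
  by case: ifP => // _; case: eqP => // E; rewrite E ltnn in ij.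
- rewrite -det_tr det_trig; first by apply: eq_bigr => i _; rewrite mxE.
  apply/is_trig_mxP => i j ij; rewrite mxE BE; have := At i j ij; rewrite mxE => ->.
  by case: ifP => // _; case: eqP => // E; rewrite E ltnn in ij.
Qed.

(** The triangular factors of an LUP decomposition have invertible intermediate matrices, so that
    [vol_le_chain] applies to them. *)
Lemma vol_le_unit m (m0 : (0 < m)%N) (A : 'M[R]_m) : A \in unitmx -> vol_le A.
Proof.
case: m m0 A => // n m0 A Au.
have := cormen_lup_correct A; have := cormen_lup_perm A; have := cormen_lup_lower A.
have := cormen_lup_upper A; have := cormen_lup_detL A.
case: (cormen_lup A) => [[P L] U] /= detL Uu Ll /is_perm_mxP [s ->] E.
have E' : A = perm_mx s^-1 *m L *m U.
  rewrite -mulmxA -[L *m U]E [_ * A]/(_ *m A) mulmxA -perm_mxM mulVg perm_mx1 mul1mx //.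
have Ut : is_trig_mx U^T by apply/is_trig_mxP => i j ij; rewrite mxE Uu.
have Lt : is_trig_mx L.
  apply/is_trig_mxP => i j ij; rewrite Ll ?(ltnW ij) //.
  by case: eqP => // h; rewrite h ltnn in ij.
have dU : \det U != 0.
  move: Au; rewrite unitmxE E' !det_mulmx unitfE !mulf_eq0 !negb_or.
  by case/andP.
rewrite E'; apply: vol_leM; first apply: vol_leM.
- exact: vol_le_perm.
- by apply: vol_le_trig; [move=> i; rewrite Ll // eqxx oner_neq0 | left].
- apply: vol_le_trig; last by right.
  move=> i; move: dU; rewrite -det_tr det_trig // => /prodf_neq0 /(_ i isT).
  by rewrite mxE.
Qed.

Section Formula.
Context {m : nat}.
Hypothesis m0 : (0 < m)%N.
Local Notation vol := (@lebesgue_volume R m).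
Implicit Types (A : 'M[R]_m) (E : set 'rV[R]_m).

Lemma vol_le_mono E F : E `<=` F -> (vol E <= vol F)%E.
Proof.
move=> EF; apply: le_ereal_inf => _ [a [b [ab Fab ->]]]; exists a, b; split => //.
exact: subset_trans EF Fab.
Qed.

(** The image lies in a hyperplane, which a shear turns into a coordinate hyperplane, and this is the
    image of the whole space under a row replacement with w = 0. *)
Lemma vol_singular A E : \det A = 0%R -> vol (rmul A @` E) = 0%E.
Proof.
move=> dA.
have [c c0 Ac] : exists2 c : 'cV[R]_m, c != 0%R & A *m c = 0%R.
  have : \det A^T == 0%R by rewrite det_tr dA.
  move=> /det0P [v v0 vA]; exists v^T; first by rewrite -(inj_eq trmx_inj) trmxK trmx0.
  by apply: trmx_inj; rewrite trmx_mul trmxK vA trmx0.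
have [i ci] : exists i, c i 0 != 0%R.
  apply/existsP; apply: contraNT c0 => /existsPn h; apply/eqP/colP => i.
  by have := h i; rewrite negbK mxE => /eqP.
pose Hi := [set v : 'rV[R]_m | v 0 i = 0].
have hyper : vol Hi = 0%E.
  apply/eqP; rewrite eq_le vol_ge0 andbT.
  have H0 : vol_le (row_repl i 0 : 'M[R]_m) by exact: vol_le_row_repl.
  have := H0 setT; rewrite det_row_repl mxE normr0 mul0e; apply: le_trans; apply: vol_le_mono => v /= vi; exists v => //.
  by apply/rowP => j; rewrite rmul_row_repl mxE mulr0 addr0; case: eqP => // ->.
(* A vector v with v c = 0 is recovered by the shear S from its coordinates other than i. *)
pose c' : 'cV[R]_m := ((c i 0)^-1 *: c - delta_mx i 0)%R.
pose S : 'M[R]_m := (1%:M - c' *m delta_mx 0 i)%R.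
have SS : (S *m (1%:M + c' *m delta_mx 0 i) = 1%:M)%R.
  rewrite /S mulmxBl mul1mx mulmxDr mulmx1 mulmxA -(mulmxA c').
  have -> : (delta_mx 0 i *m c' = 0 :> 'M[R]_1)%R.
    apply/matrixP => x y; rewrite !ord1 -rowE !mxE eqxx /=.
    by rewrite mulVf // subrr.
  by rewrite mulmx0 mul0mx addr0 addrK.
have Su : S \in unitmx by case/mulmx1_unit: SS.
apply/eqP; rewrite eq_le vol_ge0 andbT.
have S0 : (vol (rmul S @` Hi) <= 0)%E.
  by apply: (le_trans (vol_le_unit m0 Su _)); rewrite hyper mule0.
apply: (le_trans _ S0); apply: vol_le_mono => _ [u _ <-]; set v := rmul A u.
have vc : v *m c = 0%R by rewrite /v /rmul -mulmxA Ac mulmx0.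
clearbody v.
exists (v - v 0%R i *: delta_mx 0%R i)%R.
  by rewrite /Hi /= !mxE !eqxx mulr1 subrr.
rewrite /rmul /S mulmxBr mulmx1 mulmxA.
suff -> : ((v - v 0 i *: delta_mx 0 i) *m c' = (- v 0 i)%:M)%R.
  by rewrite mul_scalar_mx scaleNr opprK subrK.
rewrite mulmxBl /c' !mulmxBr -!scalemxAr vc scaler0 -!scalemxAl.
apply/matrixP => x y; rewrite !ord1 -rowE -colE mul_delta_mx !mxE !eqxx /= mulr1n.
by field.
Qed.

(** The inequality for A and for its inverse. *)
Lemma vol_rmul A E : (vol (rmul A @` E) = `|\det A|%:E * vol E)%E.
Proof.
have [Au|] := boolP (A \in unitmx); last first.
  rewrite unitmxE unitfE negbK => /eqP dA; rewrite dA normr0 mul0e.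
  exact: vol_singular.
apply/eqP; rewrite eq_le vol_le_unit //=.
have E1 : E = rmul (invmx A) @` (rmul A @` E).
  rewrite image_comp -[LHS]image_id; congr (image _); apply/funext => v.
  by rewrite /rmul /= mulmxK.
have dA : (0 < `|\det A|)%R by rewrite normr_gt0 -unitfE -unitmxE.
have iu : invmx A \in unitmx by rewrite unitmx_inv.
have h := vol_le_unit m0 iu (rmul A @` E).
rewrite -E1 det_inv normfV in h.
apply: (le_trans (lee_wpmul2l _ h)); first by rewrite lee_fin ltW.
by rewrite muleA -EFinM mulfV ?gt_eqF // mul1e.
Qed.

End Formula.

(** A cover of the cube by boxes dominates its indicator; integrating one coordinate after another
    replaces each indicator of an interval by its length. This is the countable form of
    the statement that boxes covering the cube have total volume at least one. *)
Lemma box_cover_integral (m : nat) (a b : nat -> nat -> R) (c : nat -> R) (C : R) :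
  0 <= C -> (forall n i, a n i <= b n i) -> (forall n, 0 <= c n) ->
  (forall x : nat -> R, (forall i, 0 <= x i <= 1) ->
    (C%:E <= \sum_(0 <= n <oo) (c n * \prod_(i < m) \1_`[a n i, b n i]%classic (x i))%:E)%E) ->
  (C%:E <= \sum_(0 <= n <oo) (c n * \prod_(i < m) (b n i - a n i))%:E)%E.
Proof.
move=> C0 ab; elim: m c => [|m IH] c c0 H.
  have := H (fun=> 0) (fun i => _); rewrite lexx ler01 => /(_ (fun=> isT)).
  by congr (_ <= _)%E; apply: eq_eseriesr => n _; rewrite !big_ord0.
have -> : (\sum_(0 <= n <oo) (c n * \prod_(i < m.+1) (b n i - a n i))%:E =
   \sum_(0 <= n <oo) ((c n * (b n m - a n m)) * \prod_(i < m) (b n i - a n i))%:E)%E.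
  by apply: eq_eseriesr => n _; rewrite big_ord_recr /= mulrAC mulrA.
apply: IH => [n|x x01]; first by rewrite mulr_ge0 ?subr_ge0.
pose K n := c n * \prod_(i < m) \1_`[a n i, b n i]%classic (x i).
have K0 n : 0 <= K n by rewrite mulr_ge0 // prodr_ge0.
pose g n (y : R) : \bar R := (K n * \1_`[a n m, b n m]%classic y)%:E.
pose I : set R := `[0, 1]%classic.
have mI : measurable I by exact: measurable_itv.
have mab n : measurable (`[a n m, b n m]%classic : set (R)).
  exact: measurable_itv.
have mg n : measurable_fun I (g n).
  apply/measurable_EFinP; apply: measurable_funM.
    exact: measurable_cst.
  exact: (measurable_indic (mab n)).
have g0 n y : (0 <= g n y)%E by rewrite lee_fin mulr_ge0.
have : (\int[lebesgue_measure]_(y in I) C%:E <=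
   \int[lebesgue_measure]_(y in I)
     \sum_(0 <= n <oo) g n y)%E.
  apply: ge0_le_integral => //.
  - by apply: (@ge0_emeasurable_sum _ _ _ I g xpredT).
  - move=> y; rewrite /I /= in_itv /= => y01.
    pose x' i := if (i < m)%N then x i else y.
    have := H x' _; rewrite /x'.
    have x'01 i : 0 <= (if (i < m)%N then x i else y) <= 1 by case: ifP.
    move=> /(_ x'01) /le_trans; apply; rewrite le_eqVlt; apply/orP; left; apply/eqP.
    apply: eq_eseriesr => n _; congr EFin; rewrite big_ord_recr /= ltnn mulrA /K.
    by congr (_ * _ * _); apply: eq_bigr => i _; rewrite ltn_ord.
rewrite integral_cst // [X in (_ * X)%E]lebesgue_measure_itv /= lte_fin ltr01 oppr0 adde0 mule1.
move=> /le_trans; apply; rewrite integral_nneseries //.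
apply: lee_nneseries => [n _ _|n _]; first exact: integral_ge0.
rewrite /g; under eq_integral do rewrite EFinM.
rewrite ge0_integralZl //; last 2 first.
- by apply/measurable_EFinP; exact: measurable_indic.
- by rewrite lee_fin.
rewrite integral_indic // -mulrA (mulrC (b n m - _)) mulrA (EFinM _ (b n m - a n m)).
apply: lee_wpmul2l; first by rewrite lee_fin.
apply: (@le_trans _ _ (lebesgue_measure (`[a n m, b n m]%classic : set (R)))).
  by apply: le_measure; rewrite ?inE //; exact: measurableI.
rewrite lebesgue_measure_itv /= lte_fin; case: ifP => // _.
by rewrite lee_fin subr_ge0.
Qed.

Lemma vol_cube m (m0 : (0 < m)%N) : lebesgue_volume (box 0 (const_mx 1) : set 'rV[R]_m) = 1%E.
Proof.
apply/eqP; rewrite eq_le; apply/andP; split.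
  apply: (le_trans (@vol_fin_cover _ _ m0 _ 1 (fun=> 0) (fun=> const_mx 1) _ _)).
  - by move=> n _ i; rewrite !mxE ler01.
  - by move=> x hx; exists 0%N.
  by rewrite big_ord1 lee_fin /bvol big1 // => i _; rewrite !mxE subr0.
apply: le_ereal_inf_tmp => _ [a [b [ab cov ->]]].
pose a' n i := if insub i is Some j then a n 0 (j : 'I_m) else 0.
pose b' n i := if insub i is Some j then b n 0 (j : 'I_m) else 0.
have a'E n (i : 'I_m) : a' n i = a n 0 i by rewrite /a' valK.
have b'E n (i : 'I_m) : b' n i = b n 0 i by rewrite /b' valK.
have := @box_cover_integral m a' b' (fun=> 1) 1 ler01 _ (fun=> ler01) _.
rewrite (_ : \big[_/_]_(0 <= n <oo) _ =
  \big[+%E/0%E]_(0 <= n <oo) (\prod_(i < m) (b n 0 i - a n 0 i))%:E); last first.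
  by apply: eq_eseriesr => n _; rewrite mul1r; congr EFin; apply: eq_bigr => i _; rewrite a'E b'E.
apply; first by move=> n i; rewrite /a' /b'; case: insub.
move=> x x01; have bx : box 0 (const_mx 1) (\row_(i < m) x i : 'rV[R]_m).
  by move=> i; rewrite in_itv /= !mxE.
have [n _ xn] := cov _ bx.
rewrite (nneseries_split 0 n.+1) => [|l _]; last by rewrite lee_fin mul1r prodr_ge0.
rewrite add0n big_nat_recr //= -addeA lee_paddl //.
  by apply: sume_ge0 => l _; rewrite lee_fin mul1r prodr_ge0.
rewrite lee_paddr //; first by apply: nneseries_ge0 => l _ _; rewrite lee_fin mul1r prodr_ge0.
rewrite mul1r lee_fin big1 // => i _; rewrite indicE mem_set //=.
by have := xn i; rewrite a'E b'E mxE.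
Qed.
End LinearVolumeFormula.

(** * The cosine of two subspaces *)

Section CosineFormula.
Context {R : realType} {k : division_algebra} {p : nat}.
Local Notation K := (scalars R k).
Local Notation d := (real_dim k).
Local Notation Gr := (Gr R k p).
Implicit Types (B C : 'M[K]_(p + p, p)).

Section Coordinates.
Variables (N : nat) (e : (p * 1 * d)%N = N).

Definition cv (v : 'rV[R]_N) : 'cV[K]_p := of_real_row (castmx (erefl, esym e) v).
Definition rv (x : 'cV[K]_p) : 'rV[R]_N := castmx (erefl, e) (to_real x).
(** The coordinates of Definition vol have dimension d p and those of p-columns p 1 d: the casts in
    this section transport between them. *)
Definition Umx (B : 'M[K]_(p + p, p)) : 'M[R]_(N, (p + p) * 1 * d) :=
  castmx (e, erefl _) (Lmx (fun v : 'cV[K]_p => B *m v)).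
Definition Amx (A : 'M[K]_p) : 'M[R]_N :=
  castmx (e, e) (Lmx (fun v : 'cV[K]_p => A *m v)).

Lemma cvK : cancel cv rv.
Proof. by rewrite /cv /rv => v; case: _ / e v => v; rewrite !castmx_id of_real_rowK. Qed.
Lemma rvK : cancel rv cv.
Proof. by rewrite /cv /rv => v; case: _ / e; rewrite !castmx_id to_realK. Qed.

Lemma cvD u v : cv (u + v) = cv u + cv v.
Proof. by rewrite /cv; case: _ / e u v => u v; rewrite !castmx_id of_real_rowD. Qed.
Lemma cvZ r v : cv (r *: v) = of_real k r *: cv v.
Proof. by rewrite /cv; case: _ / e v => v; rewrite !castmx_id of_real_rowZ. Qed.
Lemma cv0 : cv 0 = 0.
Proof. by have := cvZ 0 0; rewrite of_real0 !scale0r. Qed.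

Lemma mul_Umx B v : v *m Umx B = to_real (B *m cv v).
Proof.
rewrite /cv /Umx; case: _ / e v => v; rewrite !castmx_id mul_Lmx //.
exact: rlin_mull.
Qed.

Lemma mul_Amx A v : v *m Amx A = rv (A *m cv v).
Proof.
rewrite /cv /Amx /rv; case: _ / e v => v; rewrite !castmx_id mul_Lmx //.
exact: rlin_mull.
Qed.

Lemma det_Amx A : \det (Amx A) = det_real A.
Proof. by rewrite /Amx; case: _ / e; rewrite castmx_id. Qed.

Lemma Umx_isom B : adjoint B *m B = 1%:M -> Umx B *m (Umx B)^T = 1%:M.
Proof.
move=> BB; rewrite /Umx; case: _ / e; rewrite castmx_id Lmx_isom //.
  exact: rlin_mull.
by move=> x y; exact: dot_unitl.
Qed.

Lemma Umx_range B : inj_cols B ->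
  range (fun v : 'rV[R]_N => v *m Umx B) = (@to_real R k (p + p) 1) @` Gr_set (grs B).
Proof.
move=> Bi; rewrite grsE //; apply/seteqP; split => [_ [v _ <-]|_ [_ [v _ <-] <-]].
  by rewrite mul_Umx; exists (B *m cv v) => //; exists (cv v).
by exists (rv v) => //; rewrite mul_Umx rvK.
Qed.
End Coordinates.

Fact dimE : (p * 1 * d)%N = (d * p)%N.
Proof. by rewrite muln1 mulnC. Qed.
Local Notation cvp := (cv dimE).
Local Notation rvp := (rv dimE).
Local Notation Ump := (Umx dimE).
Local Notation Amp := (Amx dimE).

Lemma dim_gt0 : (0 < p)%N -> (0 < d * p)%N.
Proof. by move=> p0; rewrite muln_gt0 p0 andbT; case: (k). Qed.

(** Two isometric parametrizations of the same subspace differ by an orthogonal matrix, so the volume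
    in a subspace does not depend on the parametrization. *)
Lemma orthogonal_change N n (U W : 'M[R]_(N, n)) :
  U *m U^T = 1%:M -> W *m W^T = 1%:M ->
  range (fun v : 'rV[R]_N => v *m U) `<=` range (fun v : 'rV[R]_N => v *m W) ->
  exists Q : 'M[R]_N, U = Q *m W /\ Q *m Q^T = 1%:M.
Proof.
move=> UU WW UW; have E : U = U *m W^T *m W.
  apply/row_matrixP => i; rewrite !row_mul.
  have [w _ wE] : range (fun v : 'rV[R]_N => v *m W) (row i U).
    by apply: UW; exists (delta_mx 0 i) => //; rewrite rowE.
  by rewrite -wE -!mulmxA (mulmxA W) WW mul1mx.
exists (U *m W^T); split=> //.
by rewrite trmx_mul trmxK mulmxA -E.
Qed.

Lemma volE (p0 : (0 < p)%N) B E : adjoint B *m B = 1%:M ->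
  vol (grs B) E = lebesgue_volume [set v | E (B *m cvp v)].
Proof.
move=> BB; have Bi : inj_cols B by exact: inj_cols_left_inv BB.
rewrite /vol; set P := [set s | _].
have UE : lebesgue_volume [set v | E (B *m cvp v)] =
    lebesgue_volume [set v | E (of_real_row (v *m Ump B))].
  by congr lebesgue_volume; apply/funext => v; rewrite /= mul_Umx to_realK.
have PE : P (lebesgue_volume [set v | E (B *m cvp v)]).
  move=> U UU Ur; rewrite UE.
  have sub : range (fun v : 'rV[R]_(d * p) => v *m U) `<=`
      range (fun v : 'rV[R]_(d * p) => v *m Ump B) by rewrite Ur (Umx_range dimE).
  have [Q [UO OO]] := orthogonal_change UU (Umx_isom dimE BB) sub.
  have OtO : Q^T *m Q = 1%:M by exact: mulmx1C.
  set S := [set v | E (of_real_row (v *m Ump B))].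
  have -> : [set v | E (of_real_row (v *m U))] = rmul Q^T @` S.
    apply/seteqP; split => [v /= Ev|_ [w Sw <-]].
      by exists (v *m Q); rewrite /S /= /rmul -!mulmxA ?OO ?mulmx1 // -UO.
    by rewrite /= UO /rmul -mulmxA (mulmxA _ Q) OtO mul1mx.
  rewrite vol_rmul ?dim_gt0 // det_tr.
  have := congr1 (fun A => `|\det A|) OO.
  rewrite det_mulmx det_tr det1 normrM normr1 -expr2 => /eqP.
  by rewrite sqrp_eq1 // => /eqP ->; rewrite mul1e.
case: xgetP => [s _ Ps|/(_ _ PE) //].
by rewrite UE; apply: Ps; [exact: Umx_isom | exact: Umx_range].
Qed.

Lemma orth_rangeP m n (C : 'M[K]_(m, n)) (u : 'cV[K]_m) :
  (forall w, range (fun v : 'cV[K]_n => C *m v) w -> adjoint u *m w = 0) <->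
  adjoint C *m u = 0.
Proof.
split=> [hu|Cu _ [v _ <-]]; last first.
  by rewrite mulmxA -[X in X *m _]adjointK adjointM adjointK Cu adjoint0 mul0mx.
rewrite -[LHS]adjointK adjointM adjointK.
suff -> : adjoint u *m C = 0 by rewrite adjoint0.
apply/matrixP => i j; rewrite [RHS]mxE.
have /matrixP/(_ i 0) := hu (C *m delta_mx j (0 : 'I_1)) (ex_intro2 _ _ _ I erefl).
by rewrite mulmxA -colE !mxE.
Qed.

(** In orthonormal coordinates the projection onto the second subspace is the matrix C^* B, and the
    volume of a linear image is multiplied by the modulus of the determinant. The image of the
    unit cube shows that the defining property is not vacuous. *)
Lemma abs_cosE (p0 : (0 < p)%N) B C :
  adjoint B *m B = 1%:M -> adjoint C *m C = 1%:M ->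
  abs_cos (grs B) (grs C) = abs_det (adjoint C *m B).
Proof.
move=> BB CC; have Bi : inj_cols B by exact: inj_cols_left_inv BB.
have Ci : inj_cols C by exact: inj_cols_left_inv CC.
rewrite /abs_cos; set P := [set t | _].
have PE : P (abs_det (adjoint C *m B)).
  move=> E Eb _ _; rewrite !volE // => E1.
  have -> : [set v | Defs.proj (grs C) E (C *m cvp v)] =
      rmul (Amp (adjoint C *m B)) @` [set v | E (B *m cvp v)].
    apply/seteqP; split => [v /= [_ [x Ex]]|_ [v /= Ev <-]].
      have := Eb x Ex; rewrite !grsE // => -[y _ xE] h.
      exists (rvp y); rewrite /= ?rvK ?xE //.
      rewrite /rmul mul_Amx rvK -mulmxA xE -[RHS](cvK dimE); congr rv.
      move/orth_rangeP: h; rewrite mulmxBr mulmxA CC mul1mx => /eqP.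
      by rewrite subr_eq0 => /eqP.
    split; first by rewrite grsE //; exists (cvp (rmul (Amp (adjoint C *m B)) v)).
    exists (B *m cvp v) => //; rewrite grsE //; apply/orth_rangeP.
    by rewrite /rmul mul_Amx rvK mulmxBr (mulmxA _ C) CC mul1mx mulmxA subrr.
  rewrite vol_rmul ?dim_gt0 // E1 mule1 /= det_Amx //.
case: xgetP => [t _ Pt|/(_ _ PE) //].
pose E : set 'cV[K]_(p + p) := (fun v => B *m cvp v) @` box 0 (const_mx 1).
have EE : [set v | E (B *m cvp v)] = box 0 (const_mx 1).
  apply/seteqP; split=> v /=; last by move=> h; exists v.
  move=> [w hw /eqP]; rewrite -subr_eq0 -mulmxBr => /eqP /Bi /eqP.
  by rewrite subr_eq0 => /eqP /(can_inj (cvK dimE)) <-.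
have Eb : E `<=` Gr_set (grs B) by move=> _ [v _ <-]; rewrite grsE //; exists (cvp v).
have Ec : convexV E.
  move=> _ _ t' [v hv <-] [w hw <-] t0 t1; exists (t' *: v + (1 - t') *: w).
    move=> i; have := hv i; have := hw i; rewrite !in_itv /= !mxE => /andP [w0 w1] /andP [v0 v1].
    by apply/andP; split; nra.
  by rewrite cvD !cvZ mulmxDr !mulmx_realZ.
have E0 : E 0.
  exists 0; last by rewrite cv0 mulmx0.
  by move=> i; rewrite in_itv /= !mxE lexx ler01.
have E1 : vol (grs B) E = 1%E by rewrite volE // EE vol_cube // dim_gt0.
by rewrite (Pt E Eb Ec E0 E1) -(PE E Eb Ec E0 E1).
Qed.
End CosineFormula.

(** * Borel sets of coordinate spaces *)

(** The image measure, carrying the measurability of the map so that it is a measure by construction. *)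
Definition pushm d1 d2 (T1 : measurableType d1) (T2 : measurableType d2) (R : realType)
    (mu : {measure set T1 -> \bar R}) (f : T1 -> T2) (mf : measurable_fun setT f) :
    {measure set T2 -> \bar R} :=
  measure_function_pushforward__canonical__measure_function_Measure mu mf.

Lemma ge0_integral_pushm d1 d2 (T1 : measurableType d1) (T2 : measurableType d2) (R : realType)
    (mu : {measure set T1 -> \bar R}) (f : T1 -> T2) (mf : measurable_fun setT f)
    (g : T2 -> \bar R) : measurable_fun setT g -> (forall y, (0 <= g y)%E) ->
  (\int[pushm mu mf]_y g y = \int[mu]_x g (f x))%E.
Proof.
move=> mg g0; rewrite (ge0_integral_pushforward mf mu measurableT mg) //.
Qed.

Section BorelGeneral.
Context {R : realType}.

Lemma measurable_open (T : ptopologicalType) (A : set (g_sigma_algebraType (@open T))) :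
  open (A : set T) -> measurable A.
Proof. by move=> oA; exact: sub_gen_smallest. Qed.

Lemma measurable_closed (T : ptopologicalType) (A : set (g_sigma_algebraType (@open T))) :
  closed (A : set T) -> measurable A.
Proof.
by move=> cA; rewrite -(setCK A); apply: measurableC; apply: measurable_open; exact: closed_openC.
Qed.

Lemma continuous_measurable (T : ptopologicalType) (f : T -> R) : continuous f ->
  measurable_fun setT (f : g_sigma_algebraType (@open T) -> R).
Proof.
move=> cf; apply: (measurability _ (RGenOpens.measurableE R)).
move=> _ [_ [a [b ->]] <-]; rewrite setTI; apply: measurable_open.
by move/continuousP: cf; apply; exact: interval_open.
Qed.

Lemma continuous_measurable_borel (T U : ptopologicalType) (f : T -> U) : continuous f ->
  measurable_fun setT
    (f : g_sigma_algebraType (@open T) -> g_sigma_algebraType (@open U)).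
Proof.
move=> cf; apply: (@measurability _ _ (g_sigma_algebraType (@open T))
  (g_sigma_algebraType (@open U)) setT f (@open U) erefl).
move=> _ [A oA <-]; rewrite setTI; apply: measurable_open.
by move/continuousP: cf; apply.
Qed.
End BorelGeneral.

Section BorelSpace.
Context {R : realType} {N : nat}.
Local Notation V := 'rV[R]_N.
Local Notation BV := (g_sigma_algebraType (@open V)).
Implicit Types (a b v : V).

(** Half-open boxes, which can be cut into disjoint half-open boxes. *)
Definition hbox a b : set V := [set x | forall i, a 0 i <= x 0 i < b 0 i].

Lemma continuous_coord i : continuous (fun v : V => v 0 i).
Proof. exact: coord_continuous. Qed.

Lemma measurable_coord i : measurable_fun setT (fun v : BV => v 0 i : R).
Proof. by apply: continuous_measurable; exact: continuous_coord. Qed.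

Lemma measurable_hbox a b : measurable (hbox a b : set BV).
Proof.
have -> : hbox a b = \bigcap_(i in [set: 'I_N]) ((fun v : V => v 0 i) @^-1` `[a 0 i, b 0 i[).
  by apply/seteqP; split => x /= h i; have := h i; rewrite /= in_itv //= => /(_ I).
apply: fin_bigcap_measurable => // i _.
by rewrite -[X in measurable X]setTI; exact: measurable_coord.
Qed.

(** Boxes with rational corners form a countable base, which puts open sets in the sigma-algebra
    generated by boxes. *)
Lemma open_hbox (O : set V) x : open O -> O x ->
  exists a b : 'rV[rat]_N, hbox (map_mx ratr a) (map_mx ratr b) x /\
    hbox (map_mx ratr a) (map_mx ratr b) `<=` O.
Proof.
rewrite openE => /(_ x) oO /oO /nbhs_ballP [e /= e0 eO].
have /choice [a aP] : forall i, exists q : rat, x 0 i - e < ratr q < x 0 i.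
  move=> i; have /rat_in_itvoo [q] : x 0 i - e < x 0 i by rewrite ltrBlDr ltrDl.
  by rewrite in_itv; exists q.
have /choice [b bP] : forall i, exists q : rat, x 0 i < ratr q < x 0 i + e.
  move=> i; have /rat_in_itvoo [q] : x 0 i < x 0 i + e by rewrite ltrDl.
  by rewrite in_itv; exists q.
exists (\row_i a i), (\row_i b i); split.
  move=> i; rewrite !mxE; have /andP [_ /ltW ->] := aP i.
  by have /andP [-> _] := bP i.
move=> y hy; apply: eO; split=> // i j; rewrite !ord1.
have := hy j; rewrite !mxE => /andP [y1 y2].
have /andP [a1 a2] := aP j; have /andP [b1 b2] := bP j.
by rewrite /ball /= ltr_norml; apply/andP; split; lra.
Qed.

Lemma measurable_hboxE : (@measurable _ BV) = <<s [set A | exists a b, A = hbox a b] >>.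
Proof.
apply/seteqP; split.
  apply: smallest_sub; first exact: smallest_sigma_algebra.
  move=> O oO.
  pose F n : set V := if unpickle n is Some (a, b) then
      if `[< hbox (map_mx ratr a) (map_mx ratr b) `<=` O >] then
        hbox (map_mx ratr (a : 'rV[rat]_N)) (map_mx ratr b) else set0
    else set0.
  have -> : O = \bigcup_n F n.
    apply/seteqP; split => [x Ox|x [n _]].
      have [a [b [xab abO]]] := open_hbox oO Ox.
      exists (pickle (a, b)) => //; rewrite /F pickleK.
      by case: ifPn => // /negP; case; apply/asboolP.
    by rewrite /F; case: unpickle => // -[a b]; case: ifPn => // /asboolP; apply.
  apply: sigma_algebra_bigcup => n; rewrite /F.
  case: unpickle => [[a b]|]; last exact: sigma_algebra0.
  case: ifP => _; last exact: sigma_algebra0.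
  by apply: sub_gen_smallest; exists (map_mx ratr a), (map_mx ratr b).
apply: smallest_sub; first exact: sigma_algebra_measurable.
by move=> _ [a [b ->]]; exact: measurable_hbox.
Qed.

(** Measurability into the Borel space of rows can be checked on coordinates. *)
Lemma measurable_fun_rV d (T : measurableType d) (f : T -> V) :
  (forall i, measurable_fun setT (fun x => f x 0 i)) ->
  measurable_fun setT (f : T -> BV).
Proof.
move=> mf; apply: (measurability _ measurable_hboxE) => _ [_ [a [b ->]] <-].
rewrite setTI.
have -> : f @^-1` (hbox a b) = \bigcap_(i in [set: 'I_N]) ((fun x => f x 0 i) @^-1` `[a 0 i, b 0 i[).
  by apply/seteqP; split => x /= h i; have := h i; rewrite /= in_itv //= => /(_ I).
apply: fin_bigcap_measurable => // i _.
by rewrite -[X in measurable X]setTI; exact: mf.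
Qed.
End BorelSpace.

(** * Translation-invariant measures *)

Section AdditiveFunction.
Context {R : realType}.

(** Monotonicity comes from nonnegativity, and squeezing n t between consecutive integers
    determines the value at t up to c / n. *)
Lemma additive_linear (phi : R -> \bar R) (c : R) :
  (forall t, 0 <= t -> (0 <= phi t)%E) ->
  (forall s t, 0 <= s -> 0 <= t -> phi (s + t) = (phi s + phi t)%E) ->
  phi 1 = c%:E -> forall t, 0 <= t -> phi t = (t * c)%:E.
Proof.
move=> phi0 phiD phi1.
have c0 : 0 <= c by rewrite -lee_fin -phi1 phi0.
have phin n : phi n.+1%:R = (n.+1%:R * c)%:E.
  elim: n => [|n IH]; first by rewrite mul1r.
  by rewrite -natr1 phiD // IH phi1 -EFinD mulrDl mul1r.
have tn (t : R) : 0 <= t -> t <= (Num.truncn t).+1%:R.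
  by move=> t0; rewrite ltW // truncnS_gt.
have fin t : 0 <= t -> phi t \is a fin_num.
  move=> t0; rewrite ge0_fin_numE ?phi0 //.
  apply: (@le_lt_trans _ _ (phi (Num.truncn t).+1%:R)); last by rewrite phin ltry.
  rewrite (_ : _.+1%:R = t + ((Num.truncn t).+1%:R - t)); last by rewrite addrC subrK.
  rewrite phiD ?subr_ge0 ?tn //.
  by rewrite leeDl // phi0 // subr_ge0 tn.
pose psi t := fine (phi t).
have psiE t : 0 <= t -> phi t = (psi t)%:E by move=> t0; rewrite /psi fineK // fin.
have psiD s t : 0 <= s -> 0 <= t -> psi (s + t) = psi s + psi t.
  by move=> s0 t0; rewrite /psi phiD // fineD ?fin.
have psi0 t : 0 <= t -> 0 <= psi t by move=> t0; rewrite fine_ge0 // phi0.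
have psile s t : 0 <= s -> s <= t -> psi s <= psi t.
  by move=> s0 st; rewrite -[t](subrK s) addrC psiD ?subr_ge0 // lerDl psi0 ?subr_ge0.
have psiz : psi 0 = 0.
  by have := psiD 0 0 (lexx _) (lexx _); rewrite addr0 => h; lra.
have psin n : psi n%:R = n%:R * c.
  by case: n => [|n]; [rewrite mul0r psiz | rewrite /psi phin].
have psiM n t : 0 <= t -> psi (n%:R * t) = n%:R * psi t.
  move=> t0; elim: n => [|n IH]; first by rewrite !mul0r psiz.
  by rewrite -natr1 !mulrDl !mul1r psiD ?mulr_ge0 // IH.
move=> t t0; rewrite psiE //; congr EFin; apply/eqP.
(* n t lies between two consecutive integers, where the value of psi is known. *)
have bound n : `|n%:R * (psi t - t * c)| <= c.
  have nt0 : 0 <= n%:R * t by rewrite mulr_ge0.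
  set M := Num.truncn (n%:R * t).
  have /andP [M1 M2] : M%:R <= n%:R * t < M.+1%:R by rewrite truncn_itv.
  have := psile _ _ (ler0n _ M) M1; have := psile _ _ nt0 (ltW M2).
  rewrite !psin psiM // => h1 h2.
  have h3 : M%:R * c <= n%:R * t * c by rewrite ler_wpM2r.
  have h4 : n%:R * t * c <= M.+1%:R * c by rewrite ler_wpM2r // ltW.
  have h5 : M.+1%:R * c = M%:R * c + c by rewrite -natr1 mulrDl mul1r.
  rewrite mulrBr mulrA ler_norml; apply/andP; split; lra.
apply: contraT => ne; have x0 : 0 < `|psi t - t * c| by rewrite normr_gt0 subr_eq0.
have := bound (Num.truncn (c / `|psi t - t * c|)).+1.
rewrite normrM normr_nat -ler_pdivlMr // => h.
by have := le_lt_trans h (truncnS_gt (c / `|psi t - t * c|)); rewrite ltxx.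
Qed.
End AdditiveFunction.

Section TranslationInvariant.
Context {R : realType} {N : nat}.
Hypothesis N0 : (0 < N)%N.
Local Notation V := 'rV[R]_N.
Local Notation BV := (g_sigma_algebraType (@open V)).
Implicit Types (a b v s : V) (mu : {measure set BV -> \bar R}).

Definition tinv mu := forall v (A : set BV), measurable A -> mu ((fun x : V => x + v) @^-1` A) = mu A.

(** The side i of the box s is changed to t, to study the measure as a function of one side. *)
Definition upd s (i : 'I_N) (t : R) : V := \row_j if j == i then t else s 0 j.

Lemma bvol_upd s i t : bvol 0 (upd s i t) = t * \prod_(j | j != i) s 0 j.
Proof.
rewrite /bvol (bigD1 i) //= !mxE eqxx subr0; congr (_ * _).
by apply: eq_bigr => j /negbTE ji; rewrite !mxE ji subr0.
Qed.

Lemma hbox_split mu s i t u : tinv mu -> 0 <= t -> 0 <= u ->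
  mu (hbox 0 (upd s i (t + u))) = (mu (hbox 0 (upd s i t)) + mu (hbox 0 (upd s i u)))%E.
Proof.
move=> mut t0 u0; pose e : V := - (t *: delta_mx 0 i).
rewrite -(mut e (hbox 0 (upd s i u)) (measurable_hbox _ _)) -measureU.
- have eE (x : V) j : (x + e) 0 j = if j == i then x 0 i - t else x 0 j.
    by rewrite !mxE eqxx /=; case: eqP => [->|_]; rewrite ?mulr1 // mulr0 subr0.
  have uE r j : upd s i r 0 j = if j == i then r else s 0 j by rewrite mxE.
  have zE j : (0 : V) 0 j = 0 by rewrite mxE.
  congr (mu _); apply/seteqP; split => x /=.
    move=> hx; have [xt|xt] := ltP (x 0 i) t; [left|right] => j; have := hx j;
      rewrite ?eE !uE zE; case: eqP => // -> /andP [h1 h2]; apply/andP; split=> //.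
      by rewrite subr_ge0.
    by rewrite ltrBlDl.
  by move=> [] hx j; have := hx j; rewrite ?eE !uE zE; case: eqP => // -> /andP [h1 h2];
    apply/andP; split; lra.
- exact: measurable_hbox.
- rewrite -[X in measurable X]setTI.
  have mm : measurable_fun setT (fun x : BV => (x : V) + e : BV).
    apply: measurable_fun_rV => j.
    rewrite (_ : (fun x : BV => _) = (fun x : BV => (x : V) 0 j + e 0 j)); last first.
      by apply/funext => x; rewrite mxE.
    by apply: measurable_funD => //; exact: measurable_coord.
  by apply: mm => //; exact: measurable_hbox.
- apply/seteqP; split => // x [] /= /(_ i) + /(_ i).
  rewrite !mxE !eqxx /= mulr1 => /andP [_ h1] /andP [h2 _].
  by move: h2; rewrite subr_ge0 => /(lt_le_trans h1); rewrite ltxx.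
Qed.

(** Additivity in each side makes the measure linear in that side; the sides of the unit cube are
    changed one after another. *)
Lemma mu_hbox mu (c : R) a b : tinv mu -> mu (hbox 0 (const_mx 1)) = c%:E ->
  le_rv a b -> mu (hbox a b) = (c * bvol a b)%:E.
Proof.
move=> mut mu1; have key s : le_rv 0 s -> mu (hbox 0 s) = (c * bvol 0 s)%:E.
  move=> s0; pose sn n : V := \row_j if (j < n)%N then s 0 j else 1.
  have sn0 n j : 0 <= sn n 0 j.
    by rewrite mxE; case: ifP => // _; have := s0 j; rewrite mxE.
  suff /(_ N) : forall n, mu (hbox 0 (sn n)) = (c * bvol 0 (sn n))%:E.
    by rewrite (_ : sn N = s) //; apply/rowP => j; rewrite mxE ltn_ord.
  elim=> [|n IH].
    have -> : sn 0%N = const_mx 1 by apply/rowP => j; rewrite !mxE.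
    by rewrite mu1 /bvol big1 ?mulr1 // => j _; rewrite !mxE subr0.
  have [nN|nN] := ltnP n N; last first.
    suff -> : sn n.+1 = sn n by [].
    by apply/rowP => j; rewrite !mxE !(leq_trans (ltn_ord j)) // ltnW.
  pose i := Ordinal nN.
  have E1 : sn n = upd (sn n) i 1.
    by apply/rowP => j; rewrite !mxE; case: eqP => // ->; rewrite ltnn.
  have E2 : sn n.+1 = upd (sn n) i (s 0 i).
    apply/rowP => j; rewrite !mxE; case: eqP => [->|ji]; first by rewrite ltnSn.
    rewrite ltnS leq_eqVlt; case: eqP => //= jn.
    by case: ji; apply: ord_inj.
  rewrite E2 (@additive_linear _ (fun t => mu (hbox 0 (upd (sn n) i t)))
     (c * bvol 0 (sn n))).
  - by rewrite bvol_upd {1}E1 bvol_upd mul1r mulrCA.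
  - by move=> t _; exact: measure_ge0.
  - by move=> t u t0 u0; exact: hbox_split.
  - by rewrite -E1.
  - by have := s0 i; rewrite mxE.
move=> ab; rewrite -(mut a (hbox a b)); last exact: measurable_hbox.
have -> : (fun x : V => x + a) @^-1` hbox a b = hbox 0 (b - a).
  apply/seteqP; split => x /= h j; have := h j; rewrite !mxE.
    by rewrite lerDr -ltrBrDr.
  by rewrite lerDr -ltrBrDr.
rewrite key => [|j]; last by rewrite !mxE subr_ge0.
by congr (_ * _)%:E; apply: eq_bigr => j _; rewrite !mxE subr0.
Qed.

Lemma hboxI a b a' b' : hbox a b `&` hbox a' b' =
  hbox (\row_i Num.max (a 0 i) (a' 0 i)) (\row_i Num.min (b 0 i) (b' 0 i)).
Proof.
apply/seteqP; split => x /=.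
  move=> [h h'] i; rewrite !mxE ge_max lt_min.
  by have /andP [-> ->] := h i; have /andP [-> ->] := h' i.
move=> h; split => i; have := h i; rewrite !mxE ge_max lt_min.
  by move=> /andP [/andP [-> _] /andP [-> _]].
by move=> /andP [/andP [_ ->] /andP [_ ->]].
Qed.

(** Boxes are stable under intersection, generate the Borel sets and exhaust the space. *)
Lemma tinv_unique mu nu (c : R) : tinv mu -> tinv nu ->
  mu (hbox 0 (const_mx 1)) = c%:E -> nu (hbox 0 (const_mx 1)) = c%:E ->
  forall A : set BV, measurable A -> mu A = nu A.
Proof.
move=> mut nut mu1 nu1.
have nonempty a b : ~ le_rv a b -> hbox a b = set0.
  move=> ab; apply/seteqP; split => // x hx; apply: ab => i.
  by have /andP [h1 /ltW h2] := hx i; exact: le_trans h1 h2.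
apply: (@measure_unique _ R BV [set A : set BV | exists a b, A = hbox a b]
   (fun n => hbox (const_mx (- n%:R)) (const_mx n%:R))).
- exact: measurable_hboxE.
- move=> _ _ [a [b ->]] [a' [b' ->]]; rewrite hboxI.
  by exists (\row_i Num.max (a 0 i) (a' 0 i)), (\row_i Num.min (b 0 i) (b' 0 i)).
- by move=> n; exists (const_mx (- n%:R)), (const_mx n%:R).
- apply/seteqP; split => // x _; exists (Num.truncn (\sum_i `|x 0 i|)).+1 => //= i.
  have : (`|x 0 i| < (Num.truncn (\sum_i `|x 0 i|)).+1%:R).
    apply: (@le_lt_trans _ _ (\sum_i `|x 0 i|)); last by rewrite truncnS_gt.
    by rewrite (bigD1 i) //= lerDl sumr_ge0.
  by rewrite ltr_norml !mxE => /andP [/ltW -> ->].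
- move=> _ [a [b ->]]; have [ab|/nonempty ->] := pselect (le_rv a b).
    by rewrite (mu_hbox mut mu1 ab) (mu_hbox nut nu1 ab).
  by rewrite !measure0.
- move=> n; rewrite (mu_hbox mut mu1) ?ltry // => i; rewrite !mxE.
  by rewrite (le_trans (y := 0)) // oppr_le0.
Qed.

(** A cover by closed boxes is measured by half-open boxes that are larger by an arbitrarily small
    amount. This is all that is needed to bring the linear volume formula to the measure mu. *)
Lemma mu_le_vol mu (c : R) (A : set BV) : tinv mu -> mu (hbox 0 (const_mx 1)) = c%:E ->
  measurable A -> (mu A <= c%:E * lebesgue_volume (A : set V))%E.
Proof.
move=> mut mu1 mA.
have c0 : 0 <= c by rewrite -lee_fin -mu1.
have mbox a b : measurable (box a b : set BV).
  have -> : box a b = \bigcap_(i in [set: 'I_N]) ((fun v : V => v 0 i) @^-1` `[a 0 i, b 0 i]).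
    by apply/seteqP; split => x /= h i; [move=> _; exact: h | exact: (h i I)].
  apply: fin_bigcap_measurable => // i _.
  by rewrite -[X in measurable X]setTI; exact: measurable_coord.
have boxle a b : le_rv a b -> (mu (box a b) <= (c * bvol a b)%:E)%E.
  move=> ab; pose P : {poly R} := c%:P * \prod_i ((b 0 i - a 0 i)%:P + 'X).
  have -> : c * bvol a b = P.[0].
    rewrite /P hornerM hornerC horner_prod; congr (_ * _); apply: eq_bigr => i _.
    by rewrite hornerD hornerC hornerX addr0.
  apply: le_poly0 => // n.
  have -> : (P.[n.+1%:R^-1])%:E = mu (hbox a (b + const_mx n.+1%:R^-1)).
    rewrite (mu_hbox mut mu1) => [|i]; last first.
      by rewrite !mxE (le_trans (ab i)) // lerDl.
    rewrite /P hornerM hornerC horner_prod; congr (_ * _)%:E; apply: eq_bigr => i _.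
    by rewrite hornerD hornerC hornerX !mxE addrAC.
  apply: le_measure; rewrite ?inE //; first exact: measurable_hbox.
  move=> x hx i; have := hx i; rewrite in_itv /= !mxE => /andP [-> h] /=.
  by rewrite (le_lt_trans h) // ltrDl invr_gt0.
apply: le_mul_vol => // a b ab Aab.
apply: (@le_trans _ _ (\sum_(0 <= n <oo) mu (box (a n) (b n)))%E).
  by apply: measure_sigma_subadditive.
rewrite -nneseriesZl => [|n _]; last by rewrite lee_fin; exact: bvol_ge0 (ab n).
apply: lee_nneseries => [n _ _|n _]; first exact: measure_ge0.
by rewrite -EFinM; exact: boxle (ab n).
Qed.
End TranslationInvariant.

(** * Linear change of variables *)

Section LinearChange.
Context {R : realType} {N : nat}.
Hypothesis N0 : (0 < N)%N.
Local Notation V := 'rV[R]_N.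
Local Notation BV := (g_sigma_algebraType (@open V)).
Implicit Types (A : 'M[R]_N) (mu : {measure set BV -> \bar R}).

Local Notation cube := (hbox 0%R (const_mx 1%R) : set V).

Lemma measurable_rmul A : measurable_fun setT (rmul A : BV -> BV).
Proof.
apply: measurable_fun_rV => j.
rewrite (_ : (fun x : BV => _) = (fun x : BV => \sum_i (x : V) 0 i * A i j)); last first.
  by apply/funext => x; rewrite mxE.
apply: measurable_sum => i; apply: measurable_funM => //; exact: measurable_coord.
Qed.

Lemma tinv_pushforward mu A : A \in unitmx -> tinv mu ->
  tinv (pushm mu (measurable_rmul A)).
Proof.
move=> Au mut v E mE; rewrite -[LHS]/(mu (rmul A @^-1` ((fun x : V => x + v) @^-1` E))) -[RHS]/(mu (rmul A @^-1` E)).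
rewrite -[RHS](mut (v *m invmx A)).
  congr (mu _); apply/seteqP; split => x /=; rewrite /rmul mulmxDl mulmxKV //.
by rewrite -[X in measurable X]setTI; apply: measurable_rmul.
Qed.

(** The image of mu is again translation invariant, hence a multiple of mu; the multiple is bounded
    on the unit cube by the outer volume of its linear image. *)
Lemma linear_change_le mu (c : R) A : tinv mu -> mu (cube) = c%:E -> 0 < c ->
  A \in unitmx -> exists kap : R, [/\ 0 <= kap, kap <= `|\det A|^-1 &
    forall E : set BV, measurable E -> mu (rmul A @^-1` E) = (kap%:E * mu E)%E].
Proof.
move=> mut mu1 c0 Au; pose nu := pushm mu (measurable_rmul A).
have mcube : measurable (cube : set BV) by exact: measurable_hbox.
have mpre (E : set BV) : measurable E -> measurable (rmul A @^-1` E : set BV).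
  by move=> mE; rewrite -[X in measurable X]setTI; apply: measurable_rmul.
have nu_le : (nu (cube) <= (c * `|\det A|^-1)%:E)%E.
  rewrite -[leLHS]/(mu (rmul A @^-1` cube)) EFinM.
  have h := mu_le_vol mut mu1 (mpre _ mcube).
  apply: (le_trans h).
  apply: lee_wpmul2l; first by rewrite lee_fin ltW.
  have -> : rmul A @^-1` cube = rmul (invmx A) @` cube.
    apply/seteqP; split => [x /= hx|_ [x hx <-]].
      by exists (rmul A x) => //; rewrite /rmul mulmxK.
    by rewrite /= /rmul mulmxKV.
  rewrite vol_rmul // det_inv normfV -[leRHS]mule1; apply: lee_wpmul2l.
    by rewrite lee_fin invr_ge0.
  rewrite -(@vol_cube R _ N0); apply: vol_le_mono => x hx i; rewrite in_itv /=.
  by have /andP [-> /ltW ->] := hx i.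
have [y yE] : exists y, nu (cube) = y%:E.
  have : nu (cube) \is a fin_num.
    by rewrite ge0_fin_numE //; apply: le_lt_trans nu_le _; exact: ltry.
  by move=> /fineK <-; eexists.
have y0 : 0 <= y by rewrite -lee_fin -yE.
have kap0 : 0 <= y / c by rewrite divr_ge0 // ltW.
exists (y / c); split=> //.
  by rewrite ler_pdivrMr // mulrC -lee_fin -yE.
move=> E mE; pose k := NngNum kap0.
rewrite -[LHS]/(nu E) (@tinv_unique _ _ nu (mscale k mu) y) //.
- exact: tinv_pushforward.
- by move=> v F mF; congr (_ * _)%E; exact: mut.
- by rewrite -[LHS]/((y / c)%:E * mu cube)%E mu1 -EFinM divfK // gt_eqF.
Qed.

(** The upper bounds for A and for its inverse multiply to one, so both are equalities. *)
Lemma linear_change mu (c : R) A (E : set BV) : tinv mu -> mu (cube) = c%:E ->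
  A \in unitmx -> measurable E ->
  mu (rmul A @^-1` E) = (`|\det A|^-1%:E * mu E)%E.
Proof.
move=> mut mu1 Au mE.
have mpre (F : set BV) : measurable F -> measurable (rmul A @^-1` F : set BV).
  by move=> mF; rewrite -[X in measurable X]setTI; apply: measurable_rmul.
have c0 : 0 <= c by rewrite -lee_fin -mu1.
have [c00|cp] := leP c 0.
  have cz : c = 0 by apply/eqP; rewrite eq_le c00 c0.
  have z (F : set BV) : measurable F -> mu F = 0%E.
    move=> mF; apply/eqP; rewrite eq_le measure_ge0 andbT.
    by have := mu_le_vol mut mu1 mF; rewrite cz mul0e.
  by rewrite !z ?mule0 //; exact: mpre.
have [kap [k0 kle kE]] := linear_change_le mut mu1 cp Au.
have iAu : invmx A \in unitmx by rewrite unitmx_inv.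
have [kap' [k0' kle' kE']] := linear_change_le mut mu1 cp iAu.
have mcube : measurable (cube : set BV) by exact: measurable_hbox.
(* The cube is mapped by A and then back by its inverse. *)
have kk : kap' * kap = 1.
  have := kE' (rmul A @^-1` cube) (mpre _ mcube).
  rewrite kE // mu1 (_ : rmul (invmx A) @^-1` _ = cube); last first.
    by apply/seteqP; split => x /=; rewrite /rmul mulmxKV.
  rewrite mu1 -!EFinM => -[] h; apply: (mulIf (lt0r_neq0 cp)).
  by rewrite mul1r -mulrA.
rewrite kE //; congr (_%:E * _)%E; apply/eqP; rewrite eq_le kle /=.
have kap'0 : 0 < kap'.
  by rewrite lt_neqAle k0' andbT eq_sym; apply: contra_eqN kk => /eqP ->; rewrite mul0r eq_sym oner_eq0.
have -> : kap = kap'^-1 by apply: (mulfI (lt0r_neq0 kap'0)); rewrite kk mulfV // lt0r_neq0.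
have dA : 0 < `|\det A| by rewrite normr_gt0 -unitfE -unitmxE.
rewrite lef_pV2 ?posrE //.
by move: kle'; rewrite det_inv normfV invrK.
Qed.

Lemma integral_linear_change mu (c : R) A (phi : BV -> \bar R) :
  tinv mu -> mu (cube) = c%:E -> A \in unitmx ->
  measurable_fun setT phi -> (forall x, (0 <= phi x)%E) ->
  (\int[mu]_x phi (rmul A x) = `|\det A|^-1%:E * \int[mu]_x phi x)%E.
Proof.
move=> mut mu1 Au mphi phi0.
have k0 : 0 <= `|\det A|^-1 by rewrite invr_ge0.
rewrite -(ge0_integral_pushm mu (measurable_rmul A) mphi phi0).
rewrite -(ge0_integral_mscale mu measurableT (NngNum k0) mphi) //.
apply: eq_measure_integral => E mE _.
by rewrite /mscale /= /pushforward (linear_change mut mu1).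
Qed.
End LinearChange.

(** * Continuity of matrix operations *)

Section MatrixContinuity.
Context {T : topologicalType}.

Lemma continuous_mx (U : topologicalType) m n (f : T -> 'M[U]_(m, n)) :
  (forall i j, continuous (fun x => f x i j)) -> continuous f.
Proof.
move=> cf x A [P Px PA]; rewrite nbhs_filterE /fmap /=.
have : \forall y \near x, forall ij : 'I_m * 'I_n, P ij.1 ij.2 (f y ij.1 ij.2).
  by apply: filter_forall => -[i j] /=; exact: (cf i j x _ (Px i j)).
by apply: filterS => y h; apply: PA => i j; exact: (h (i, j)).
Qed.

Context {R : realType}.
Implicit Types f g : T -> R.

Lemma continuous_add f g : continuous f -> continuous g -> continuous (fun x => f x + g x).
Proof. by move=> cf cg x; apply: cvgD; [exact: cf | exact: cg]. Qed.

Lemma continuous_mul f g : continuous f -> continuous g -> continuous (fun x => f x * g x).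
Proof. by move=> cf cg x; apply: cvgM; [exact: cf | exact: cg]. Qed.

Lemma continuous_cst (U : topologicalType) (c : U) : continuous (fun _ : T => c).
Proof. by move=> x; exact: cvg_cst. Qed.

Lemma continuous_sum I (r : seq I) (F : I -> T -> R) :
  (forall i, continuous (F i)) -> continuous (fun x => \sum_(i <- r) F i x).
Proof.
move=> cF; elim: r => [|i r IH].
  by under eq_fun do rewrite big_nil; exact: continuous_cst.
by under eq_fun do rewrite big_cons; exact: continuous_add.
Qed.

Lemma continuous_prod I (r : seq I) (F : I -> T -> R) :
  (forall i, continuous (F i)) -> continuous (fun x => \prod_(i <- r) F i x).
Proof.
move=> cF; elim: r => [|i r IH].
  by under eq_fun do rewrite big_nil; exact: continuous_cst.
by under eq_fun do rewrite big_cons; exact: continuous_mul.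
Qed.

Lemma continuous_det n (A : T -> 'M[R]_n) :
  (forall i j, continuous (fun x => A x i j)) -> continuous (fun x => \det (A x)).
Proof.
move=> cA; apply: continuous_sum => s; apply: continuous_mul; first exact: continuous_cst.
by apply: continuous_prod => i.
Qed.

Lemma continuous_mulmx m n q (A : T -> 'M[R]_(m, n)) (B : T -> 'M[R]_(n, q)) i j :
  (forall i j, continuous (fun x => A x i j)) ->
  (forall i j, continuous (fun x => B x i j)) -> continuous (fun x => (A x *m B x) i j).
Proof.
move=> cA cB; under eq_fun do rewrite mxE.
by apply: continuous_sum => l; exact: continuous_mul.
Qed.
End MatrixContinuity.

Lemma continuous_entry (U : topologicalType) m n i j :
  continuous (fun M : 'M[U]_(m, n) => M i j).
Proof.
move=> M A MA; exists (fun i' j' => if (i' == i) && (j' == j) then A else setT).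
  by move=> i' j'; case: ifP => [/andP [/eqP -> /eqP ->] //|_]; exact: filterT.
by move=> N /(_ i j); rewrite !eqxx.
Qed.

Lemma continuous_comp' (T U W : topologicalType) (f : T -> U) (g : U -> W) :
  continuous f -> continuous g -> continuous (fun x => g (f x)).
Proof. by move=> cf cg x; apply: (@continuous_comp _ _ _ f g); [exact: cf | exact: cg]. Qed.

Section RealCoordinatesContinuity.
Context {R : realType} {k : division_algebra}.
Local Notation K := (scalars R k).
Local Notation d := (real_dim k).

(** The topology of K is the initial one for the real coordinates. *)
Lemma continuous_to_scalars (T : topologicalType) (f : T -> K) :
  continuous (fun x => to_coord (f x)) -> continuous f.
Proof.
move=> cf; apply/continuousP => _ [B oB <-]; rewrite -comp_preimage.
by move/continuousP: cf; apply.
Qed.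

Lemma continuous_to_coord : continuous (@to_coord R k).
Proof. exact: initial_continuous. Qed.

Lemma continuous_to_real m n : continuous (@to_real R k m n).
Proof.
apply: continuous_mx => i l; rewrite ord1; case/mxvec_indexP: l => l c.
case/mxvec_indexP: l => i' j'; under eq_fun do rewrite to_realE.
apply: (@continuous_comp' _ 'rV[R]_d R (fun x : 'M[K]_(m, n) => to_coord (x i' j'))
  (fun w => w 0 c)); last exact: continuous_entry.
apply: (@continuous_comp' _ K 'rV[R]_d (fun x : 'M[K]_(m, n) => x i' j')).
  exact: continuous_entry.
exact: continuous_to_coord.
Qed.

Lemma continuous_of_real_row m n : continuous (@of_real_row R k m n).
Proof.
apply: continuous_mx => i j; apply: continuous_to_scalars.
apply: continuous_mx => i' c; rewrite ord1.
under eq_fun do rewrite -to_realE of_real_rowK.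
exact: continuous_entry.
Qed.

Lemma continuous_to_M (T : topologicalType) m n (f : T -> 'M[K]_(m, n)) :
  continuous (fun x => to_real (f x)) -> continuous f.
Proof.
move=> cf; rewrite (_ : f = fun x => of_real_row (to_real (f x))).
  apply: (@continuous_comp' _ _ _ (fun x => to_real (f x)) (@of_real_row R k m n)) => //.
  exact: continuous_of_real_row.
by apply/funext => x; rewrite to_realK.
Qed.

Lemma continuous_real_entry (T : topologicalType) m n (f : T -> 'M[K]_(m, n)) i j :
  continuous f -> continuous (fun x => to_real (f x) i j).
Proof.
move=> cf.
apply: (@continuous_comp' _ _ _ (fun x => to_real (f x)) (fun w => w i j)).
  by apply: (@continuous_comp' _ _ _ f) => //; exact: continuous_to_real.
exact: continuous_entry.
Qed.

Lemma continuous_rlin (T : topologicalType) m n m' n' (f : T -> 'M[K]_(m, n))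
    (h : 'M[K]_(m, n) -> 'M[K]_(m', n')) : rlin h -> continuous f ->
  continuous (fun x => h (f x)).
Proof.
move=> hl cf; apply: continuous_to_M; apply: continuous_mx => i j.
under eq_fun do rewrite to_real_mul //.
apply: continuous_mulmx => i' j'; last exact: continuous_cst.
exact: continuous_real_entry.
Qed.

Lemma continuous_Lmxl (T : topologicalType) m n q (f : T -> 'M[K]_(m, n)) i j :
  continuous f -> continuous (fun x => Lmx (fun v : 'M[K]_(n, q) => f x *m v) i j).
Proof.
move=> cf; under eq_fun do rewrite (LmxE _ _ (rlin_mull _ _)).
apply: (@continuous_real_entry _ _ _ (fun x => f x *m of_real_row (delta_mx 0 i)) 0 j).
by apply: (@continuous_rlin _ _ _ _ _ f (fun y => y *m of_real_row (delta_mx 0 i))) => //;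
  exact: rlin_mulr.
Qed.

Lemma continuous_Lmxr (T : topologicalType) m n q (f : T -> 'M[K]_(m, n)) i j :
  continuous f -> continuous (fun x => Lmx (fun v : 'M[K]_(q, m) => v *m f x) i j).
Proof.
move=> cf; under eq_fun do rewrite (LmxE _ _ (rlin_mulr _ _)).
apply: (@continuous_real_entry _ _ _ (fun x => of_real_row (delta_mx 0 i) *m f x) 0 j).
by apply: (@continuous_rlin _ _ _ _ _ f (fun y => of_real_row (delta_mx 0 i) *m y)) => //;
  exact: rlin_mull.
Qed.

Lemma continuous_nrm2 (T : topologicalType) m n (f : T -> 'M[K]_(m, n)) :
  continuous f -> continuous (fun x => nrm2 (f x)).
Proof.
move=> cf; apply: continuous_sum => l; apply: continuous_mul; exact: continuous_real_entry.
Qed.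

Lemma continuous_add_M (T : topologicalType) m n (f g : T -> 'M[K]_(m, n)) :
  continuous f -> continuous g -> continuous (fun x => f x + g x).
Proof.
move=> cf cg; apply: continuous_to_M; apply: continuous_mx => i j.
under eq_fun do rewrite to_realD mxE.
by apply: continuous_add; exact: continuous_real_entry.
Qed.

(** The conjugate transpose is the adjoint for [dot], and coordinates are orthonormal. *)
Lemma Lmx_adj m n q (Z : 'M[K]_(m, n)) :
  Lmx (fun v : 'M[K]_(m, q) => adjoint Z *m v) = (Lmx (fun v : 'M[K]_(n, q) => Z *m v))^T.
Proof.
have dotEL m' n' (x : 'M[K]_(m', n')) l : to_real x 0 l = dot x (of_real_row (delta_mx 0 l)).
  rewrite /dot of_real_rowK (bigD1 l) //= big1 ?addr0 => [|i il].
    by rewrite mxE !eqxx mulr1.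
  by rewrite mxE (negbTE il) andbF mulr0.
have dotC m' n' (x y : 'M[K]_(m', n')) : dot x y = dot y x.
  by apply: eq_bigr => l _; rewrite mulrC.
apply/matrixP => i j; rewrite [RHS]mxE !LmxE; [|exact: rlin_mull|exact: rlin_mull].
rewrite !dotEL [RHS]dotC; set x := of_real_row _; set y := of_real_row _.
by rewrite !dotE adjointM adjointK mulmxA.
Qed.

(** The squared real volume of the parallelepiped spanned by the frame Z. It is a polynomial in the
    coordinates, whereas the triangular factor of Z is not. *)
Definition gram m n (Z : 'M[K]_(m, n)) : R := det_real (adjoint Z *m Z).

Lemma gramE m n (Z : 'M[K]_(m, n)) : gram Z =
  \det (Lmx (fun v : 'cV[K]_n => Z *m v) *m (Lmx (fun v : 'cV[K]_n => Z *m v))^T).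
Proof.
rewrite /gram det_realE -Lmx_adj -Lmx_comp; [|exact: rlin_mull|exact: rlin_mull].
by congr (\det _); apply: Lmx_ext => v; rewrite mulmxA.
Qed.

Lemma gram_frame m n (B : 'M[K]_(m, n)) (T : 'M[K]_n) : adjoint B *m B = 1%:M ->
  gram (B *m T) = det_real T ^+ 2.
Proof.
move=> BB; rewrite /gram adjointM -mulmxA (mulmxA _ B) BB mul1mx.
rewrite det_realM expr2; congr (_ * _).
by rewrite !det_realE Lmx_adj det_tr.
Qed.

Lemma continuous_gram (T : topologicalType) m n (f : T -> 'M[K]_(m, n)) :
  continuous f -> continuous (fun x => gram (f x)).
Proof.
move=> cf; under eq_fun do rewrite gramE.
apply: continuous_det => i j; apply: continuous_mulmx => i' j'.
  exact: continuous_Lmxl.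
under eq_fun do rewrite mxE; exact: continuous_Lmxl.
Qed.

Lemma continuous_det_real (T : topologicalType) n (f : T -> 'M[K]_n) :
  continuous f -> continuous (fun x => det_real (f x)).
Proof.
move=> cf; under eq_fun do rewrite det_realE.
by apply: continuous_det => i j; exact: continuous_Lmxl.
Qed.

Lemma continuous_block_nbar (T : topologicalType) n (f : T -> 'M[K]_n) :
  continuous f -> continuous (fun x => block_mx 1%:M 0 (f x) 1%:M : 'M[K]_(n + n)).
Proof.
move=> cf; apply: continuous_mx => i j.
case: (split_ordP i) => i' ->; case: (split_ordP j) => j' ->.
- by under eq_fun do rewrite block_mxEul; exact: continuous_cst.
- by under eq_fun do rewrite block_mxEur; exact: continuous_cst.
- under eq_fun do rewrite block_mxEdl.
  apply: (@continuous_comp' _ _ _ f (fun w => w i' j')) => //; exact: continuous_entry.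
- by under eq_fun do rewrite block_mxEdr; exact: continuous_cst.
Qed.

Lemma continuous_col_mx (T : topologicalType) m1 m2 n (f : T -> 'M[K]_(m1, n)) (g : T -> 'M[K]_(m2, n)) :
  continuous f -> continuous g -> continuous (fun x => col_mx (f x) (g x)).
Proof.
move=> cf cg; apply: continuous_mx => i j; case: (split_ordP i) => i' ->.
  under eq_fun do rewrite col_mxEu.
  apply: (@continuous_comp' _ _ _ f (fun w => w i' j)) => //; exact: continuous_entry.
under eq_fun do rewrite col_mxEd.
apply: (@continuous_comp' _ _ _ g (fun w => w i' j)) => //; exact: continuous_entry.
Qed.

End RealCoordinatesContinuity.

(** * Continuous functions on the Grassmannian *)

Section ContinuityOnGrassmannian.
Context {R : realType} {k : division_algebra} {p : nat}.
Local Notation K := (scalars R k).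
Local Notation d := (real_dim k).
Local Notation M2p := 'M[K]_(p + p).
Local Notation Gr := (Gr R k p).
Implicit Types (F : Gr -> R) (Z : 'M[K]_(p + p, p)).

(** Continuity on the Grassmannian, tested in the charts of the atlas, which are the only maps
    through which its topology is defined. *)
Definition chart_continuous F :=
  forall g : M2p, group_G g -> continuous (fun X : 'M[K]_p => F (chart g X)).

(** A quantitative inverse: with X = c a^-1 one has X = X (1 - a) + c, and the first term is absorbed. *)
Lemma inverse_near_one n (a : 'M[K]_n) : n%:R * nrm2 (1%:M - a) <= 4^-1 ->
  exists a', [/\ a *m a' = 1%:M, a' *m a = 1%:M &
    forall (c : 'M[K]_n), nrm2 (c *m a') <= 4 * nrm2 c].
Proof.
move=> a1; have [v av|a' [aa' a'a]] := @inj_inv R k n a.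
  apply: nrm2_eq0; apply/eqP; rewrite eq_le nrm2_ge0 andbT.
  have : nrm2 v <= 4^-1 * nrm2 v.
    have {1}-> : v = (1%:M - a) *m v by rewrite mulmxBl mul1mx av subr0.
    by apply: (le_trans (nrm2M _ _)); rewrite mulrA ler_wpM2r // nrm2_ge0.
  by move=> h; lra.
exists a'; split=> // c; set X := c *m a'.
have XE : X = X *m (1%:M - a) + c by rewrite mulmxBr mulmx1 /X -mulmxA a'a mulmx1 subrK.
have : nrm2 X <= 2 * (n%:R * (nrm2 X * nrm2 (1%:M - a))) + 2 * nrm2 c.
  rewrite {1}XE; apply: (le_trans (nrm2D _ _)); rewrite lerD2r ler_wpM2l //.
  exact: nrm2M.
have : n%:R * (nrm2 X * nrm2 (1%:M - a)) <= 4^-1 * nrm2 X.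
  by rewrite mulrCA mulrC ler_wpM2r // nrm2_ge0.
move=> h1 h2; have := nrm2_ge0 X; lra.
Qed.

Lemma lsubmx_mull m n1 n2 (x : 'M[K]_m) (y : 'M[K]_(m, n1 + n2)) :
  lsubmx (x *m y) = x *m lsubmx y.
Proof. by rewrite -{1}[y]hsubmxK mul_mx_row row_mxKl. Qed.

Lemma chartE (g : M2p) X : chart g X = grs (g *m col_mx 1%:M X).
Proof. by rewrite /chart act_bo lsubmx_mull -[block_mx _ _ _ _]/(nbar X) lsubmx_nbar. Qed.

Lemma coord_le_nrm2 m n (x : 'M[K]_(m, n)) l : to_real x 0 l ^+ 2 <= nrm2 x.
Proof.
rewrite /nrm2 /dot (bigD1 l) //= -expr2 lerDl; apply: sumr_ge0 => i _.
by rewrite -expr2 sqr_ge0.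
Qed.

Lemma continuous_near0 n (f : 'M[K]_n -> R) (e : R) : continuous f -> 0 < e ->
  exists2 dl : R, 0 < dl & forall X, nrm2 X < dl -> `|f X - f 0| < e.
Proof.
move=> cf e0.
have cf' : continuous (fun v : 'rV[R]_(n * n * d) => f (of_real_row v)).
  by apply: (@continuous_comp' _ _ _ (@of_real_row R k n n) f) => //; exact: continuous_of_real_row.
have /cvgrPdist_lt/(_ _ e0)/nbhs_ballP [r /= r0 hr] := cf' 0.
exists (r ^+ 2); first exact: exprn_gt0.
move=> X Xr; have := hr (to_real X); rewrite to_realK of_real_row0 distrC; apply.
split=> // i l; rewrite ord1 mxE /ball /= sub0r normrN.
rewrite -(@ltr_pXn2r _ 2) ?nnegrE ?(ltW r0) //.
by rewrite real_normK ?num_real // (le_lt_trans (coord_le_nrm2 X l)).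
Qed.

(** The frames near Z0 lie in one chart: after multiplication by a unitary matrix and a change of
    basis Z0 becomes (1; 0), a nearby frame becomes (a; c) with a near 1 and c small, and its
    span is the point c a^-1 of the chart. *)
Lemma grs_continuous F Z0 (e : R) : (0 < p)%N -> chart_continuous F -> inj_cols Z0 -> 0 < e ->
  exists2 dl : R, 0 < dl & forall Z, nrm2 (Z - Z0) < dl ->
    inj_cols Z /\ `|F (grs Z) - F (grs Z0)| < e.
Proof.
move=> hp cF iZ0 e0; have [x [T [t [xK Z0E _ _ _]]]] := K_frame hp iZ0.
have [S [TS ST]] : exists S, T *m S = 1%:M /\ S *m T = 1%:M.
  by apply: inj_inv; apply: (@inj_cols_mull _ _ _ _ _ (lsubmx x)); rewrite -Z0E.
have [eta eta0 He] := continuous_near0 (cF x (group_KG xK)) e0.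
have [xx xx'] := group_K_unitary xK.
(* C bounds what multiplication by S does to the norm; the two terms of mu keep the block a
   invertible and the coordinate c a^-1 within eta. *)
pose C := p%:R * (nrm2 S + 1).
have C0 : 0 < C by rewrite mulr_gt0 ?ltr0n // ltr_wpDl ?nrm2_ge0.
pose mu := Num.min (p%:R^-1 / 4) (eta / 4).
have mu0 : 0 < mu by rewrite lt_min !divr_gt0 ?invr_gt0 ?ltr0n.
exists (mu / C); first by rewrite divr_gt0.
move=> Z Zd; pose Y := adjoint x *m Z *m S.
have Z0Y : adjoint x *m Z0 *m S = col_mx 1%:M 0.
  rewrite Z0E -!mulmxA TS mulmx1 -lsubmx_mull xx.
  by rewrite scalar_mx_block block_mxEh row_mxKl.
have YE : Y - col_mx 1%:M 0 = adjoint x *m (Z - Z0) *m S.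
  by rewrite -Z0Y mulmxBr mulmxBl.
have Ysmall : nrm2 (Y - col_mx 1%:M 0) < mu.
  have nx (y : 'M[K]_(p + p, p)) : nrm2 (adjoint x *m y) = nrm2 y.
    by rewrite nrm2_unitl // adjointK.
  rewrite YE -mulmxA nx; apply: (le_lt_trans (nrm2M _ _)).
  rewrite ltr_pdivlMr // in Zd; apply: le_lt_trans Zd.
  rewrite mulrCA; apply: ler_wpM2l; first exact: nrm2_ge0.
  by rewrite ler_wpM2l // lerDl.
pose a := usubmx Y; pose c := dsubmx Y.
have acE : Y - col_mx 1%:M 0 = col_mx (a - 1%:M) c.
  by rewrite -{1}[Y]vsubmxK opp_col_mx add_col_mx subr0.
have nE : nrm2 (Y - col_mx 1%:M 0) = nrm2 (a - 1%:M) + nrm2 c.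
  rewrite acE !nrm2E big_split_ord /=.
  by congr (_ + _); apply: eq_bigr => i _; apply: eq_bigr => j _; rewrite ?col_mxEu ?col_mxEd.
have a1 : p%:R * nrm2 (1%:M - a) <= 4^-1.
  rewrite -nrm2N opprB.
  have : nrm2 (a - 1%:M) <= p%:R^-1 / 4.
    apply: le_trans (_ : mu <= _); last by rewrite ge_min lexx.
    by apply: le_trans (ltW Ysmall); rewrite nE lerDl nrm2_ge0.
  by rewrite -(ler_pM2l (_ : 0 < p%:R)) ?ltr0n // mulrA mulfV ?mul1r // pnatr_eq0 -lt0n.
have [a' [aa' a'a Ha']] := inverse_near_one a1.
have ZE : Z = x *m col_mx 1%:M (c *m a') *m (a *m T).
  have cE : col_mx 1%:M (c *m a') *m a = Y.
    by rewrite mul_col_mx mul1mx -mulmxA a'a mulmx1 vsubmxK.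
  rewrite mulmxA -(mulmxA x) cE.
  by rewrite /Y -!mulmxA ST mulmx1 !mulmxA xx' mul1mx.
have aT : a *m T *m (S *m a') = 1%:M by rewrite mulmxA -(mulmxA a) TS mulmx1.
split.
  rewrite ZE; apply: inj_colsM; last first.
    apply: (@inj_cols_left_inv _ _ _ _ (S *m a')).
    by rewrite mulmxA -(mulmxA S) a'a mulmx1.
  apply: inj_colsM; last exact: inj_cols_nbar.
  exact: inj_cols_left_inv xx.
have -> : grs Z = chart x (c *m a') by rewrite ZE (grs_mulr _ aT) chartE.
have -> : grs Z0 = chart x 0.
  rewrite chartE {1}Z0E (grs_mulr _ TS); congr grs.
  by rewrite -{2}[x]hsubmxK mul_row_col mulmx1 mulmx0 addr0.
apply: He; apply: (le_lt_trans (Ha' c)).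
have : nrm2 c < eta / 4.
  apply: (@lt_le_trans _ _ mu); last by rewrite ge_min lexx orbT.
  by apply: le_lt_trans Ysmall; rewrite nE lerDr nrm2_ge0.
by move=> h; lra.
Qed.
Lemma abs_det_inj n (g : 'M[K]_n) : abs_det g != 0 -> inj_cols g.
Proof.
move=> g0 v gv; have gu : Lmx (fun v : 'cV[K]_n => g *m v) \in unitmx.
  rewrite unitmxE unitfE -det_realE; apply: contraNneq g0 => g0.
  by rewrite /abs_det g0 normr0 powR0 // invr_eq0 pnatr_eq0; case: (k).
apply: (can_inj (@to_realK R k n 1)).
rewrite -[LHS](mulmxK gu) -to_real_mul ?gv ?to_real0 ?mul0mx //.
exact: rlin_mull.
Qed.

End ContinuityOnGrassmannian.

(** * Compactness and uniform continuity *)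

Section InvariantMean.
Context {R : realType} {k : division_algebra} {p : nat}.
Hypothesis hp : (0 < p)%N.
Local Notation K := (scalars R k).
Local Notation d := (real_dim k).
Local Notation M2p := 'M[K]_(p + p).
Local Notation Gr := (Gr R k p).
Implicit Types (F : Gr -> R) (Z : 'M[K]_(p + p, p)) (x y : M2p) (s : seq M2p).

Lemma act_unitary_grs x Z : unitary x -> inj_cols Z -> act x (grs Z) = grs (x *m Z).
Proof. by move=> [xx _] iZ; exact: act_grs xx iZ. Qed.

Lemma actM x y (b : Gr) : unitary x -> unitary y -> act (x *m y) b = act x (act y b).
Proof.
move=> xu yu; have [Z [iZ ->]] := Gr_grs b.
rewrite (act_unitary_grs (unitaryM xu yu) iZ) !act_unitary_grs ?mulmxA //.
by apply: inj_colsM => //; exact: inj_cols_left_inv (proj1 yu).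
Qed.

Lemma chart_act x (g : M2p) X : unitary x -> inj_cols g -> act x (chart g X) = chart (x *m g) X.
Proof.
move=> xu gu; rewrite !chartE act_unitary_grs ?mulmxA //.
by apply: inj_colsM => //; exact: inj_cols_nbar.
Qed.

Lemma group_G_inj (g : M2p) : group_G g -> inj_cols g.
Proof.
rewrite /group_G; case: k g => /= g gG.
- apply: (@inj_cols_left_inv R Reals _ _ (invmx (g : 'M[R]__))).
  by apply: mulVmx; rewrite unitmxE gG unitr1.
- apply: (@inj_cols_left_inv R Complexes _ _ (invmx (g : 'M[R[i]]__))).
  by apply: mulVmx; rewrite unitmxE gG unitr1.
- by apply: (@abs_det_inj R Quaternions _ g); rewrite gG oner_neq0.
Qed.

Lemma nrm2_lsub m n1 n2 (x : 'M[K]_(m, n1 + n2)) : nrm2 (lsubmx x) <= nrm2 x.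
Proof.
rewrite !nrm2E; apply: ler_sum => i _; rewrite [leRHS]big_split_ord /=.
under eq_bigr do rewrite mxE.
by rewrite lerDl; apply: sumr_ge0 => j _; exact: nsq_ge0.
Qed.

Lemma nrm2_orthonormal m n (B : 'M[K]_(m, n)) : adjoint B *m B = 1%:M -> nrm2 B = n%:R.
Proof.
move=> BB; rewrite /nrm2 dotE BB mxtrace1.
elim: n {B BB} => [|n IH]; first by rewrite res0.
by rewrite -natr1 resD IH -[X in _ + res X](@of_real1 R k) res_of_real natr1.
Qed.

(** The orthonormal frames in real coordinates; the conditions are closed, and the bound on the norm
    makes boundedness immediate. *)
Definition frames : set 'rV[R]_((p + p) * p * d) :=
  [set v | nrm2 (of_real_row v : 'M[K]_(p + p, p)) <= p%:R /\
    forall i j, (Lmx (fun w : 'cV[K]_p => (of_real_row v : 'M[K]_(p + p, p)) *m w) *m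
     (Lmx (fun w : 'cV[K]_p => (of_real_row v : 'M[K]_(p + p, p)) *m w))^T) i j = (i == j)%:R].

Lemma frames_orthonormal Z : adjoint Z *m Z = 1%:M -> frames (to_real Z).
Proof.
move=> ZZ; split; rewrite to_realK ?nrm2_orthonormal // => i j.
rewrite Lmx_isom ?mxE //; first exact: rlin_mull.
by move=> u v; exact: dot_unitl.
Qed.

Lemma frames_inj v : frames v -> inj_cols (of_real_row v : 'M[K]_(p + p, p)).
Proof.
move=> [_ hv] w vw; have vv : Lmx (fun w : 'cV[K]_p => (of_real_row v : 'M[K]_(p + p, p)) *m w) *m
     (Lmx (fun w : 'cV[K]_p => (of_real_row v : 'M[K]_(p + p, p)) *m w))^T = 1%:M.
  by apply/matrixP => i j; rewrite hv mxE.
apply: (can_inj (@to_realK R k p 1)); rewrite -[LHS]mulmx1 -vv mulmxA.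
by rewrite -to_real_mul ?vw ?to_real0 ?mul0mx //; exact: rlin_mull.
Qed.

Lemma compact_frames : compact frames.
Proof.
have box_compact : compact [set v : 'rV[R]_((p + p) * p * d) | forall i,
    `[- (p%:R + 1), p%:R + 1]%classic (v 0 i)].
  apply: (@rV_compact R _ (fun=> `[- (p%:R + 1), p%:R + 1]%classic : set R)) => i.
  exact: segment_compact.
apply: (subclosed_compact _ box_compact); last first.
  move=> v [hv _] i; rewrite /= in_itv /=.
  have := coord_le_nrm2 (of_real_row v : 'M[K]_(p + p, p)) i.
  rewrite of_real_rowK => /le_trans/(_ hv) h.
  rewrite -ler_norml -(@ler_pXn2r _ 2) ?nnegrE ?addr_ge0 //.
  rewrite real_normK ?num_real //; apply: (le_trans h).
  by rewrite sqrrD expr1n mulr1; have := ler0n R p; have := sqr_ge0 (p%:R : R); lra.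
have cof : continuous (fun v : 'rV[R]_((p + p) * p * d) => of_real_row v : 'M[K]_(p + p, p)).
  exact: continuous_of_real_row.
have -> : frames = [set v | nrm2 (of_real_row v : 'M[K]_(p + p, p)) <= p%:R] `&`
  \bigcap_i \bigcap_j [set v | (Lmx (fun w : 'cV[K]_p => (of_real_row v : 'M[K]_(p + p, p)) *m w) *m
     (Lmx (fun w : 'cV[K]_p => (of_real_row v : 'M[K]_(p + p, p)) *m w))^T) i j = (i == j)%:R].
  apply/seteqP; split => v [h1 h2]; split=> //; first by move=> i _ j _; exact: h2.
  by move=> i j; exact: (h2 i I j I).
apply: closedI.
  by have /continuous_closedP/(_ _ (@closed_le R p%:R)) := continuous_nrm2 cof.
apply: closed_bigI => i _; apply: closed_bigI => j _.
have cM : continuous (fun v : 'rV[R]_((p + p) * p * d) =>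
    (Lmx (fun w : 'cV[K]_p => (of_real_row v : 'M[K]_(p + p, p)) *m w) *m
     (Lmx (fun w : 'cV[K]_p => (of_real_row v : 'M[K]_(p + p, p)) *m w))^T) i j).
  apply: continuous_mulmx => i' j'; first exact: continuous_Lmxl.
  by under eq_fun do rewrite mxE; exact: continuous_Lmxl.
by have /continuous_closedP/(_ _ (@closed_eq R (i == j)%:R)) := cM.
Qed.

(** Local continuity in the frame is uniform over the compact set of orthonormal frames. *)
Lemma uniform_continuity F (e : R) : chart_continuous F -> 0 < e ->
  exists2 dl : R, 0 < dl & forall Z Z', adjoint Z *m Z = 1%:M ->
    nrm2 (Z' - Z) < dl -> `|F (grs Z') - F (grs Z)| < e.
Proof.
move=> cF e0.
pose P (dl : R) (v : 'rV[R]_((p + p) * p * d)) := forall Z', nrm2 (Z' - of_real_row v) < dl ->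
  `|F (grs Z') - F (grs (of_real_row v))| < e.
have : \forall dl \near 0^'+, frames `<=` P dl.
  have /compact_near_coveringP := compact_frames; apply => v fv.
  have [dl dl0 H] := grs_continuous hp cF (frames_inj fv) (divr_gt0 e0 (ltr0n _ 2 : 0 < 2 :> R)).
  exists ([set v' | nrm2 (of_real_row v' - of_real_row v : 'M[K]_(p + p, p)) < dl / 4],
          [set r | r < dl / 4]).
    split.
      have cn : continuous (fun v' : 'rV[R]_((p + p) * p * d) =>
          nrm2 (of_real_row v' - of_real_row v : 'M[K]_(p + p, p))).
        apply: continuous_nrm2; apply: continuous_add_M; last exact: continuous_cst.
        exact: continuous_of_real_row.
      have /cvgrPdist_lt/(_ (dl / 4)) := cn v; rewrite divr_gt0 // => /(_ isT).
      apply: filterS => w /=; rewrite subrr nrm2_0 sub0r normrN.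
      by rewrite ger0_norm ?nrm2_ge0.
    by apply: nbhs_right_lt; rewrite divr_gt0.
  move=> [v' r] /= [hv hr] Z' Zr.
  have hv' : nrm2 (of_real_row v' - of_real_row v : 'M[K]_(p + p, p)) < dl.
    by apply: (lt_trans hv); lra.
  have [_ h1] := H _ hv'.
  have hZ : nrm2 (Z' - of_real_row v) < dl.
    rewrite -[Z'](subrK (of_real_row v')) -addrA.
    by apply: (le_lt_trans (nrm2D _ _)); lra.
  have [_ h2] := H _ hZ.
  move: h1 h2; rewrite !ltr_norml => /andP [? ?] /andP [? ?].
  by apply/andP; split; lra.
rewrite /at_right => -[r /= r0 hr]; exists (r / 2); first by rewrite divr_gt0.
move=> Z Z' ZZ ZZ'; have := hr (r / 2) _ _ (to_real Z) (frames_orthonormal ZZ) Z'.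
rewrite to_realK; apply=> //; last by rewrite divr_gt0.
by rewrite /ball_ /= sub0r normrN gtr0_norm ?divr_gt0 //; lra.
Qed.
End InvariantMean.

(** * The mean value of a continuous function *)

Section InvariantMeanUniqueness.
Context {R : realType} {k : division_algebra} {p : nat}.
Hypothesis hp : (0 < p)%N.
Local Notation K := (scalars R k).
Local Notation d := (real_dim k).
Local Notation M2p := 'M[K]_(p + p).
Local Notation Gr := (Gr R k p).
Implicit Types (F : Gr -> R) (Z : 'M[K]_(p + p, p)) (x y : M2p) (s L : seq M2p).

Definition inK s := forall x, x \in s -> group_K x.

(** The entries of the elements of K are bounded, so a fine grid has finitely many cells, and any two
    elements of K in the same cell are close. *)
Lemma K_net (dl : R) : 0 < dl -> exists L, inK L /\
  forall x, group_K x -> exists2 l, l \in L & nrm2 (l - x) < dl.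
Proof.
move=> dl0; pose N := ((p + p) * (p + p) * d)%N.
pose M : R := (p + p)%:R + 1.
have M0 : 0 < M by rewrite ltr_wpDl.
have [eta eta0 etaN] : exists2 eta : R, 0 < eta & N%:R * eta ^+ 2 < dl.
  pose q : R := dl / (N%:R + 1).
  have q0 : 0 < q by rewrite divr_gt0 // ltr_wpDl.
  exists (Num.sqrt q); first by rewrite sqrtr_gt0.
  rewrite sqr_sqrtr ?ltW // /q mulrA ltr_pdivrMr ?ltr_wpDl // mulrC ltr_pM2l //.
  by rewrite ltrDl.
pose T := Num.truncn ((M + M) / eta).
pose cell (x : M2p) : {ffun 'I_N -> 'I_T.+1} :=
  [ffun i => inord (Num.truncn ((to_real x 0 i + M) / eta))].
pose rep (z : {ffun 'I_N -> 'I_T.+1}) : M2p := xget 1%:M [set x | group_K x /\ cell x = z].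
exists [seq rep z | z <- enum {: {ffun 'I_N -> 'I_T.+1}}]; split.
  move=> x /mapP [z _ ->]; rewrite /rep; case: xgetP => [y _ [] //|_].
  exact: group_K1.
move=> x xK; exists (rep (cell x)); first by apply: map_f; rewrite mem_enum.
have [rK rE] : group_K (rep (cell x)) /\ cell (rep (cell x)) = cell x.
  by rewrite /rep; case: xgetP => [y _ [] //|/(_ x)]; case.
have coordM y i : group_K y -> - M <= to_real y 0 i <= M.
  move=> yK; have := coord_le_nrm2 y i.
  rewrite nrm2_orthonormal ?(proj1 (group_K_unitary yK)) // => h.
  rewrite -ler_norml -(@ler_pXn2r _ 2) ?nnegrE ?(ltW M0) // real_normK ?num_real //.
  apply: (le_trans h); rewrite /M sqrrD expr1n mulr1.
  by have := ler0n R (p + p); have := sqr_ge0 ((p + p)%:R : R); lra.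
have val_cell y i : group_K y -> (cell y i : nat) = Num.truncn ((to_real y 0 i + M) / eta).
  move=> yK; have /andP [h1 h2] := coordM y i yK.
  rewrite ffunE inordK // ltnS /T; apply: le_truncn.
  by rewrite ler_pM2r ?invr_gt0 // lerD2r.
apply: le_lt_trans etaN; rewrite /nrm2 /dot.
apply: (@le_trans _ _ (\sum_(i < N) eta ^+ 2)); last first.
  by rewrite sumr_const card_ord mulr_natl.
apply: ler_sum => i _; rewrite -expr2.
have c1 := val_cell _ i rK; have c2 := val_cell _ i xK; rewrite rE c2 in c1.
have pos y : group_K y -> 0 <= (to_real y 0 i + M) / eta.
  move=> yK; rewrite divr_ge0 ?(ltW eta0) //.
  by have /andP [h _] := coordM y i yK; lra.
have /andP [a1 a2] := truncn_itv (pos _ xK).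
have /andP [b1 b2] := truncn_itv (pos _ rK).
rewrite -c1 in b1 b2; set t := Num.truncn _ in a1 a2 b1 b2.
rewrite ler_pdivlMr // in a1; rewrite ltr_pdivrMr // in a2.
rewrite ler_pdivlMr // in b1; rewrite ltr_pdivrMr // in b2.
rewrite -natr1 mulrDl mul1r in a2 b2.
rewrite to_realD to_realN !mxE -(@real_normK _ (_ - _)) ?num_real //.
rewrite ler_pXn2r ?nnegrE ?(ltW eta0) // ler_norml.
by apply/andP; split; lra.
Qed.

Lemma chart_continuous_bounded F : chart_continuous F -> exists M : R, forall b, `|F b| <= M.
Proof.
move=> cF; have [dl dl0 H] := uniform_continuity hp cF ltr01.
have [L [LK Lnet]] := K_net dl0.
exists (\sum_(l <- L) `|F (act l b_o)| + 1) => b.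
have [x [xK ->]] := Gr_K hp b; have [l lL lx] := Lnet x xK.
rewrite !act_bo; have xx := unitary_lsub (group_K_unitary xK).
have : `|F (grs (lsubmx l)) - F (grs (lsubmx x))| < 1.
  apply: H => //; rewrite -linearB.
  exact: le_lt_trans (nrm2_lsub _) lx.
have : `|F (grs (lsubmx l))| <= \sum_(l <- L) `|F (act l b_o)|.
  rewrite (big_rem l) //= act_bo lerDl; apply: sumr_ge0 => y _; exact: normr_ge0.
have := ler_normD (F (grs (lsubmx x)) - F (grs (lsubmx l))) (F (grs (lsubmx l))).
rewrite subrK distrC => h1 h2 h3; apply: (le_trans h1); lra.
Qed.

Definition avg F s (b : Gr) : R := (\sum_(x <- s) F (act x b)) / (size s)%:R.

Lemma avg_mul F s L (b : Gr) : inK s -> inK L ->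
  avg F [seq x *m y | x <- s, y <- L] b = avg (avg F s) L b.
Proof.
move=> sK LK; rewrite /avg size_allpairs natrM invfM mulrA; congr (_ / _).
rewrite big_allpairs_dep /= exchange_big /= mulr_suml; apply: eq_big_seq => y yL.
congr (_ / _); apply: eq_big_seq => x xs.
by rewrite actM //; apply: group_K_unitary; [exact: sK | exact: LK].
Qed.

(** One small value lowers an average that is bounded by u elsewhere. *)
Lemma avg_le F s (u v : R) b x0 : x0 \in s -> (forall x, x \in s -> F (act x b) <= u) ->
  F (act x0 b) <= v -> avg F s b <= u - (u - v) / (size s)%:R.
Proof.
move=> x0s hu hv.
have n0 : (0 < (size s)%:R :> R) by rewrite ltr0n; case: s x0s {hu}.
rewrite /avg ler_pdivrMr // mulrBl divfK ?gt_eqF //.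
rewrite (big_rem x0) //= (perm_size (perm_to_rem x0s)) /= -natr1 mulrDr mulr1.
have : \sum_(y <- rem x0 s) F (act y b) <= u * (size (rem x0 s))%:R.
  rewrite mulr_natr (_ : u *+ _ = \sum_(y <- rem x0 s) u); last first.
    by rewrite big_const_seq count_predT iter_addr addr0.
  rewrite big_seq [leRHS]big_seq; apply: ler_sum => y ys.
  by apply: hu; exact: mem_rem ys.
by move: hv; lra.
Qed.

Lemma avg_ge F s (u : R) b : s != [::] -> (forall x, x \in s -> u <= F (act x b)) -> u <= avg F s b.
Proof.
case: s => // x s _ h.
have : avg (fun b => - F b) (x :: s) b <= - u - (- u - - u) / (size (x :: s))%:R.
  apply: (@avg_le _ _ _ _ _ x (mem_head _ _)); last by rewrite lerN2 h ?mem_head.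
  by move=> y ys; rewrite lerN2 h.
by rewrite subrr mul0r subr0 /avg sumrN mulNr lerN2.
Qed.

Lemma avg_close F s (e dl : R) x y : inK s ->
  (forall Z Z', adjoint Z *m Z = 1%:M -> nrm2 (Z' - Z) < dl -> `|F (grs Z') - F (grs Z)| < e) ->
  s != [::] -> group_K x -> group_K y -> nrm2 (x - y) < dl ->
  avg F s (act x b_o) <= avg F s (act y b_o) + e.
Proof.
move=> sK H s0 xK yK xy.
have n0 : (0 < (size s)%:R :> R) by rewrite ltr0n lt0n size_eq0.
rewrite /avg -lerBlDl -mulrBl ler_pdivrMr // -sumrB.
rewrite mulr_natr (_ : e *+ _ = \sum_(y <- s) e); last first.
  by rewrite big_const_seq count_predT iter_addr addr0.
rewrite big_seq [leRHS]big_seq; apply: ler_sum => z zs.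
have zu := group_K_unitary (sK _ zs); have xu := group_K_unitary xK.
have yu := group_K_unitary yK.
rewrite -!actM // !act_bo; apply: (le_trans (ler_norm _)); apply/ltW/H.
  exact: unitary_lsub (unitaryM zu yu).
rewrite -linearB -mulmxBr; apply: (le_lt_trans (nrm2_lsub _)).
by rewrite nrm2_unitl // (proj1 zu).
Qed.

(** The averages of F over finite sets of translates come arbitrarily close to a constant:
    an average whose supremum is nearly minimal cannot be much smaller anywhere, since
    translating it by a finite net of K would lower the supremum further. This replaces
    the Haar measure of K. *)
Lemma mean_exists F : chart_continuous F -> exists m : R, forall e, 0 < e ->
  exists s, [/\ inK s, s != [::] & forall b, m - e <= avg F s b <= m + e].
Proof.
move=> cF; have [B FB] := chart_continuous_bounded cF.
pose E : set R := [set u | exists s, [/\ inK s, s != [::] & forall b, avg F s b <= u]].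
have E0 : has_inf E.
  split.
    exists B, [:: 1%:M]; split=> //; first by move=> x; rewrite inE => /eqP ->; exact: group_K1.
    by move=> b; rewrite /avg big_seq1 divr1 (le_trans (ler_norm _)).
  exists (- B) => u [s [_ s0 h]]; apply: le_trans (h b_o); apply: avg_ge => // x _.
  by have := FB (act x b_o); rewrite ler_norml => /andP [].
pose m := inf E; exists m => e e0.
have e20 : 0 < e / 2 by rewrite divr_gt0.
have [dl dl0 H] := uniform_continuity hp cF e20.
have [L [LK Lnet]] := K_net dl0.
have L0 : (0 < size L)%N.
  by have [l lL _] := Lnet 1%:M group_K1; case: L lL {LK Lnet}.
have n0 : 0 < (size L)%:R :> R by rewrite ltr0n.
have n1 : 1 <= (size L)%:R :> R by rewrite ler1n.
(* Less than the drop (e / 2) / |L| that one low value causes in an average over L. *)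
pose ep := e / (4 * (size L)%:R).
have ep0 : 0 < ep by rewrite divr_gt0 // mulr_gt0.
have epe : ep <= e.
  by rewrite ler_pdivrMr ?mulr_gt0 // ler_peMr ?(ltW e0) //; lra.
have [u [s [sK s0 hs]] um] := inf_adherent ep0 E0.
exists s; split=> // b; apply/andP; split; last first.
  by apply: (le_trans (hs b)); move: um; rewrite -/m; lra.
rewrite leNgt; apply/negP => bm.
have [x0 [x0K bE]] := Gr_K hp b; rewrite bE in bm.
pose s' := [seq x *m y | x <- s, y <- L].
have s'K : inK s' by move=> _ /allpairsP [[x y] /= [xs yL ->]]; apply: group_KM; auto.
have s'0 : s' != [::].
  by rewrite -size_eq0 size_allpairs muln_eq0 negb_or size_eq0 s0 -lt0n.
have : m <= m - ep.
  apply: (ge_inf (proj2 E0)); exists s'; split=> // c.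
  have [y [yK ->]] := Gr_K hp c.
  have yu := group_K_unitary yK.
  have [l lL lx] := Lnet _ (group_KM x0K (group_K_adj yK)).
  rewrite avg_mul //.
  have lK := LK _ lL; have lu := group_K_unitary lK.
  have V : avg F s (act l (act y b_o)) <= m - e / 2.
    rewrite -actM //; apply: (@le_trans _ _ (avg F s (act x0 b_o) + e / 2)); last by lra.
    apply: (avg_close sK H s0) => //; first exact: group_KM.
    have -> : l *m y - x0 = (l - x0 *m adjoint y) *m y.
      by rewrite mulmxBl -mulmxA (proj1 yu) mulmx1.
    by rewrite nrm2_unitr // (proj2 yu).
  apply: (le_trans (avg_le (u := m + ep) lL _ V)).
    by move=> z _; apply: (le_trans (hs _)); move: um; rewrite -/m => /ltW.
  have epE : ep = (e / 2) / (size L)%:R / 2.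
    by rewrite /ep; field; rewrite gt_eqF.
  have h : (e / 2) / (size L)%:R <= (m + ep - (m - e / 2)) / (size L)%:R.
    by rewrite ler_pM2r ?invr_gt0 //; lra.
  by move: h epE; set q := (e / 2) / _; set w := (_ / (size L)%:R); lra.
by move: ep0; lra.
Qed.
End InvariantMeanUniqueness.

(** * Pairs of square blocks *)

Section ProductOfCoordinates.
Context {R : realType} {k : division_algebra} {p : nat}.
Local Notation K := (scalars R k).
Local Notation d := (real_dim k).
Local Notation V := 'rV[R]_(p * p * d).
Local Notation W := 'rV[R]_((p + p) * p * d).
Local Notation BV := (g_sigma_algebraType (@open V)).
Local Notation BW := (g_sigma_algebraType (@open W)).
Local Notation o := (@of_real_row R k p p).

(** The frame (X; Y) in real coordinates, from the coordinates of its two square blocks. *)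
Definition stack (x : V * V) : W := to_real (col_mx (o x.1) (o x.2)).

Lemma stack_coord l : exists l', (forall x, stack x 0 l = x.1 0 l') \/
  (forall x, stack x 0 l = x.2 0 l').
Proof.
case/mxvec_indexP: l => l c; case/mxvec_indexP: l => i j.
case: (split_ordP i) => i' ->; exists (mxvec_index (mxvec_index i' j) c); [left|right] => x.
  by rewrite /stack to_realE col_mxEu -to_realE of_real_rowK.
by rewrite /stack to_realE col_mxEd -to_realE of_real_rowK.
Qed.

Lemma stack_coordl l' : exists l, forall x, stack x 0 l = x.1 0 l'.
Proof.
case/mxvec_indexP: l' => l c; case/mxvec_indexP: l => i j.
exists (mxvec_index (mxvec_index (lshift p i) j) c) => x.
by rewrite /stack to_realE col_mxEu -to_realE of_real_rowK.
Qed.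

Lemma stack_coordr l' : exists l, forall x, stack x 0 l = x.2 0 l'.
Proof.
case/mxvec_indexP: l' => l c; case/mxvec_indexP: l => i j.
exists (mxvec_index (mxvec_index (rshift p i) j) c) => x.
by rewrite /stack to_realE col_mxEd -to_realE of_real_rowK.
Qed.

Lemma stackD x y : stack (x.1 + y.1, x.2 + y.2) = stack x + stack y.
Proof. by rewrite /stack /= !of_real_rowD -add_col_mx to_realD. Qed.

Lemma stack_surj (u : W) : exists x, u = stack x.
Proof.
exists (to_real (usubmx (of_real_row u : 'M[K]_(p + p, p))),
        to_real (dsubmx (of_real_row u : 'M[K]_(p + p, p)))).
by rewrite /stack /= !to_realK vsubmxK of_real_rowK.
Qed.

Lemma measurable_stack : measurable_fun setT (stack : BV * BV -> BW).
Proof.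
apply: measurable_fun_rV => l; have [l' [E|E]] := stack_coord l.
  under eq_fun do rewrite E.
  apply: (measurableT_comp (f := fun v : BV => (v : V) 0 l')) => //.
  exact: measurable_coord.
under eq_fun do rewrite E.
apply: (measurableT_comp (f := fun v : BV => (v : V) 0 l')) => //.
exact: measurable_coord.
Qed.

Lemma measurable_translate N (v : 'rV[R]_N) :
  measurable_fun setT (fun x : g_sigma_algebraType (@open 'rV[R]_N) => (x : 'rV[R]_N) + v
    : g_sigma_algebraType (@open 'rV[R]_N)).
Proof.
apply: measurable_fun_rV => l; under eq_fun do rewrite mxE.
by apply: measurable_funD => //; exact: measurable_coord.
Qed.

Lemma integral_translate N (mu : {measure set (g_sigma_algebraType (@open 'rV[R]_N)) -> \bar R})
   v (h : g_sigma_algebraType (@open 'rV[R]_N) -> \bar R) :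
  tinv mu -> measurable_fun setT h -> (forall x, (0 <= h x)%E) ->
  (\int[mu]_x h ((x : 'rV[R]_N) + v)%R = \int[mu]_x h x)%E.
Proof.
move=> mut mh h0; rewrite -(ge0_integral_pushm mu (measurable_translate v) mh h0).
by apply: eq_measure_integral => A mA _; exact: mut.
Qed.

Variable mu : {sigma_finite_measure set BV -> \bar R}.

Definition stackm : {measure set BW -> \bar R} :=
  pushm (mu \x mu)%E measurable_stack.

(** The product of two translation-invariant measures, slice by slice, is translation invariant, and
    every translation of frames is a pair of translations of blocks. *)
Lemma stackm_tinv : tinv mu -> tinv stackm.
Proof.
move=> mut u A mA; have [[u1 u2] ->] := stack_surj u.
rewrite -[LHS]/((mu \x mu)%E (stack @^-1` _)) -[RHS]/((mu \x mu)%E (stack @^-1` A)).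
set B := stack @^-1` A; have mB : measurable (B : set (BV * BV)).
  by rewrite -[X in measurable X]setTI; exact: measurable_stack.
rewrite [LHS]/product_measure1 [RHS]/product_measure1.
rewrite -[RHS](integral_translate u1 mut); last 2 first.
- exact: measurable_fun_xsection.
- by move=> x; exact: measure_ge0.
apply: eq_integral => x _ /=.
rewrite -[RHS](mut u2); last exact: measurable_xsection.
have sE y : stack (((x : V) + u1)%R, y + u2) = stack ((x : V), y) + stack (u1, u2).
  exact: (stackD (x : V, y) (u1, u2)).
by congr (mu _); apply/seteqP; split => y; rewrite /= /xsection /= !inE /B /= sE.
Qed.

Lemma stackm_cube (c : R) : mu (hbox 0 (const_mx 1)) = c%:E ->
  stackm (hbox 0 (const_mx 1)) = (c * c)%:E.
Proof.
move=> mu1; rewrite -[LHS]/((mu \x mu)%E (stack @^-1` _)).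
rewrite (_ : stack @^-1` _ = hbox 0 (const_mx 1) `*` hbox 0 (const_mx 1)); last first.
  apply/seteqP; split => [[v w] /= h|[v w] [/= hv hw] l].
    split => l; [have [l' E] := stack_coordl l|have [l' E] := stack_coordr l];
    by have := h l'; rewrite E !mxE.
  by rewrite !mxE; have [l' [->|->]] := stack_coord l; [have := hv l' | have := hw l'];
    rewrite !mxE.
rewrite product_measure1E; try exact: measurable_hbox.
by rewrite EFinM; congr (_ * _)%E; exact: mu1.
Qed.
End ProductOfCoordinates.

(** * Singular matrices *)

Section SingularMatrices.
Context {R : realType} {k : division_algebra} {p : nat}.
Local Notation K := (scalars R k).
Local Notation d := (real_dim k).
Local Notation V := 'rV[R]_(p * p * d).
Local Notation BV := (g_sigma_algebraType (@open V)).
Local Notation o := (@of_real_row R k p p).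
Variable mu : {sigma_finite_measure set BV -> \bar R}.

Lemma finite_roots_opp (P : {poly R}) : P != 0 -> finite_set [set t | root P (- t)].
Proof.
move=> P0; apply: contrapT => /(infinite_set_fset (size P)) [B BP].
rewrite leqNgt -(size_map (@GRing.opp R)); apply/negP; rewrite negbK.
apply: max_poly_roots => //; last by rewrite (map_inj_uniq oppr_inj) finmap.fset_uniq.
by apply/allP => _ /mapP [t tB ->]; exact: (BP t).
Qed.

Lemma measurable_singular : measurable ([set v | det_real (o v) = 0] : set BV).
Proof.
apply: measurable_closed.
have cd : continuous (fun v : V => det_real (o v)).
  by apply: continuous_det_real; exact: continuous_of_real_row.
by have /continuous_closedP/(_ _ (@closed_eq R 0)) := cd.
Qed.

(** For fixed X the matrix X + t is singular for finitely many real t only. Integrating over t in the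
    line, all translates of the singular set have the same measure, and their total is zero. *)
Lemma singular_null : tinv mu -> mu [set v : BV | det_real (o v) = 0] = 0%E.
Proof.
have := measurable_singular; set S := [set v | _] => mS mut.
pose e : V := to_real (1%:M : 'M[K]_p).
pose L := @lebesgue_measure R.
pose g (x : BV * measurableTypeR R) : BV := (x.1 : V) + (x.2 : R) *: e.
have mg : measurable_fun setT g.
  apply: measurable_fun_rV => l; under eq_fun do rewrite mxE [(_ *: e) _ _]mxE.
  apply: measurable_funD; last by apply: measurable_funM.
  by apply: (measurableT_comp (f := fun v : BV => (v : V) 0 l)) => //; exact: measurable_coord.
have mh : measurable_fun setT (fun v : BV => (\1_S v)%:E : \bar R).
  by apply/measurable_EFinP; exact: measurable_indic.
have mf : measurable_fun setT (fun x => (\1_S (g x))%:E : \bar R).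
  exact: (measurableT_comp mh mg).
have := @fubini_tonelli _ _ BV (measurableTypeR R) R mu L (fun x => (\1_S (g x))%:E : \bar R) mf (fun x => _).
rewrite (eq_integral (cst 0%E)) => [|v _]; last first.
  rewrite -[LHS]/(\int[L]_t (\1_[set t : measurableTypeR R | S (g (v, t))] t)%:E)%E.
  rewrite integral_indic ?setIT //; last first.
    have mgv : measurable_fun setT (fun t : measurableTypeR R => g (v, t)).
      by apply: measurableT_comp mg _; exact: measurable_pair1.
    by rewrite -[X in measurable X]setTI; exact: mgv.
  apply: countable_lebesgue_measure0; apply: finite_set_countable.
  pose M := Lmx (fun w : 'cV[K]_p => o v *m w).
  apply: (@sub_finite_set _ _ [set t | root (char_poly M) (- t)]); last first.
    by apply: finite_roots_opp; rewrite monic_neq0 // char_poly_monic.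
  move=> t; rewrite /S /g /=.
  rewrite of_real_rowD of_real_rowZ to_realK det_realE => /eqP /det0P [u u0].
  rewrite mul_Lmx; last exact: rlin_mull.
  rewrite mulmxDl -scalemxAl mul1mx to_realD to_realZ of_real_rowK => /eqP.
  rewrite addr_eq0 => /eqP E; rewrite -eigenvalue_root_char; apply/eigenvalueP.
  by exists u => //; rewrite mul_Lmx ?E ?scaleNr //; exact: rlin_mull.
rewrite integral_cst // mul0e => /(_ (fun=> _)) E.
have {E} : (0 = \int[L]_t mu S)%E.
  rewrite E => [|x]; last by rewrite lee_fin.
  apply: eq_integral => t _.
  rewrite (integral_translate (t *: e) mut mh) => [|x]; last by rewrite lee_fin.
  by rewrite integral_indic // setIT.
rewrite integral_cst // /L.
have LT : @lebesgue_measure R setT = +oo%E.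
  by have := @lebesgue_measure_itv R `]-oo, +oo[; rewrite set_itvNyy.
have [->//|m0] := eqVneq (mu S) 0%E.
rewrite [X in (_ * X)%E]LT gt0_muley // lt_neqAle eq_sym m0 /=; exact: measure_ge0.
Qed.
End SingularMatrices.

(** * Integration over frames *)

Section FrameIntegral.
Context {R : realType} {k : division_algebra} {p : nat}.
Hypothesis hp : (0 < p)%N.
Local Notation K := (scalars R k).
Local Notation d := (real_dim k).
Local Notation Gr := (Gr R k p).
Local Notation M2p := 'M[K]_(p + p).
Local Notation V := 'rV[R]_(p * p * d).
Local Notation W := 'rV[R]_((p + p) * p * d).
Local Notation BV := (g_sigma_algebraType (@open V)).
Local Notation BW := (g_sigma_algebraType (@open W)).
Local Notation o := (@of_real_row R k p p).
Local Notation o2 := (@of_real_row R k (p + p) p).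
Implicit Types (F : Gr -> R) (x : M2p).

(** A set of frames that is invariant under unitary matrices and has finite positive measure. *)
Definition unit_frames : set W := [set z | inj_cols (o2 z) /\ nrm2 (o2 z) <= 1].

(** The function F lifted to frames, cut off to a set of finite measure. *)
Definition frame_fun F (z : W) : R := F (grs (o2 z)) * \1_unit_frames z.

Lemma continuous_o2_nrm2 : continuous (fun z : W => nrm2 (o2 z)).
Proof. by apply: continuous_nrm2; exact: continuous_of_real_row. Qed.

(** Injectivity and the value of F at the span are both stable under small changes of the frame. *)
Lemma open_frames_preimage F (A : set R) : chart_continuous F -> open A ->
  open [set z : W | inj_cols (o2 z) /\ A (F (grs (o2 z)))].
Proof.
move=> cF oA; rewrite openE => z [iz Az].
have /nbhs_ballP [e /= e0 eA] : nbhs (F (grs (o2 z))) A by exact: open_nbhs_nbhs.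
have [dl dl0 H] := grs_continuous hp cF iz e0.
have cn : continuous (fun z' : W => nrm2 (o2 z' - o2 z)).
  apply: continuous_nrm2; apply: continuous_add_M; last exact: continuous_cst.
  exact: continuous_of_real_row.
have /cvgrPdist_lt/(_ dl dl0) := cn z; apply: filterS => z'.
rewrite subrr nrm2_0 sub0r normrN ger0_norm ?nrm2_ge0 // => /H [iz' Fz].
by split=> //; apply: eA; rewrite /ball /= distrC.
Qed.

Lemma chart_continuous_cst (r : R) : chart_continuous (fun _ : Gr => r).
Proof. by move=> g _; exact: continuous_cst. Qed.

Lemma open_inj : open [set z : W | inj_cols (o2 z)].
Proof.
have := open_frames_preimage (@chart_continuous_cst 0) (@openT R).
by congr open; apply/seteqP; split => z /= => [[]|].
Qed.

Lemma measurable_unit_frames : measurable (unit_frames : set BW).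
Proof.
rewrite (_ : unit_frames = [set z | inj_cols (o2 z)] `&` [set z | nrm2 (o2 z) <= 1]) //.
apply: measurableI; first exact: measurable_open open_inj.
apply: measurable_closed.
by have /continuous_closedP/(_ _ (@closed_le R 1)) := continuous_o2_nrm2.
Qed.

Lemma measurable_frame_fun F : chart_continuous F ->
  measurable_fun setT (frame_fun F : BW -> R).
Proof.
move=> cF; have mU : measurable ([set z | inj_cols (o2 z)] : set BW) by exact: measurable_open open_inj.
have -> : frame_fun F = (fun z => F (grs (o2 z)) * \1_[set z | inj_cols (o2 z)] z * \1_unit_frames z).
  apply/funext => z; rewrite /frame_fun -mulrA; congr (_ * _).
  rewrite !indicE; case: (boolP (z \in unit_frames)); rewrite ?mulr0 // inE => -[iz _].
  by rewrite mem_set ?mulr1.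
apply: measurable_funM; last by apply: measurable_indic; exact: measurable_unit_frames.
have := patch_indic (fun z : BW => F (grs (o2 z))) [set z | inj_cols (o2 z)].
rewrite /GRing.mul_fun => <-; apply: (proj1 (measurable_restrictT _ mU)).
apply: (measurability _ (RGenOpens.measurableE R)) => _ [_ [a [b ->]] <-].
apply: measurable_open; apply: (@open_frames_preimage F `]a, b[%classic cF).
exact: interval_open.
Qed.
End FrameIntegral.

Section Disintegration.
Context {R : realType} {k : division_algebra} {p : nat}.
Hypothesis hp : (0 < p)%N.
Local Notation K := (scalars R k).
Local Notation d := (real_dim k).
Local Notation Gr := (Gr R k p).
Local Notation M2p := 'M[K]_(p + p).
Local Notation V := 'rV[R]_(p * p * d).
Local Notation W := 'rV[R]_((p + p) * p * d).
Local Notation BV := (g_sigma_algebraType (@open V)).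
Local Notation BW := (g_sigma_algebraType (@open W)).
Local Notation o := (@of_real_row R k p p).
Local Notation o2 := (@of_real_row R k (p + p) p).
Implicit Types (F : Gr -> R) (x : M2p).

Definition rdet (v : V) : R := `|\det (Lmx (fun X : 'M[K]_p => X *m o v))|.

(** In the coordinates of the big cell this is a(n)^(-2 rho); see [weight_height]. The Gram determinant
    makes it visibly continuous. *)
Definition weight (v : V) : R := (gram (col_mx 1%:M (o v)))^-1 ^+ p.

Definition bigcell F (v : V) : R := F (chart 1%:M (o v)).

Definition unit_ball : set V := [set v | nrm2 (o v) <= 1].

Lemma continuous_o : continuous (o : V -> 'M[K]_p).
Proof. exact: continuous_of_real_row. Qed.

Lemma measurable_rdet : measurable_fun setT (rdet : BV -> R).
Proof.
apply: (measurableT_comp (f := fun y : R => `|y|)) => //.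
apply: continuous_measurable; apply: continuous_det => i j.
by apply: continuous_Lmxr; exact: continuous_o.
Qed.

Lemma measurable_unit_ball : measurable (unit_ball : set BV).
Proof.
have cn : continuous (fun v : V => nrm2 (o v)) by apply: continuous_nrm2; exact: continuous_o.
by apply: measurable_closed; have /continuous_closedP/(_ _ (@closed_le R 1)) := cn.
Qed.

Lemma continuous_bigcell F : chart_continuous F -> continuous (bigcell F).
Proof.
move=> cF; apply: (@continuous_comp' _ _ _ o (fun X => F (chart 1%:M X))).
  exact: continuous_o.
by apply: cF; exact: SL1.
Qed.

Lemma measurable_bigcell F : chart_continuous F -> measurable_fun setT (bigcell F : BV -> R).
Proof. by move=> cF; apply: continuous_measurable; exact: continuous_bigcell. Qed.

Lemma dims0 : (0 < p * p * d)%N.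
Proof. by rewrite !muln_gt0 hp; case: k. Qed.

Lemma dims20 : (0 < (p + p) * p * d)%N.
Proof. by rewrite !muln_gt0 addn_gt0 hp; case: k. Qed.

(** The change of variables (X, Y) to (X, Y X) in which the second block becomes the coordinate of the
    span in the big cell. *)
Definition shear (z : BV * BV) : BV * BV :=
  (z.1, rmul (Lmx (fun X : 'M[K]_p => X *m o z.1)) (z.2 : V)).

Lemma measurable_shear : measurable_fun setT shear.
Proof.
apply/measurable_fun_pairP; split; first exact: measurable_fst.
apply: measurable_fun_rV => l; rewrite /shear /rmul /=.
under eq_fun do rewrite mxE.
apply: measurable_sum => i; apply: measurable_funM.
  apply: (measurableT_comp (f := fun v : BV => (v : V) 0 i)) => //.
  exact: measurable_coord.
apply: (measurableT_comp (f := fun v : BV => Lmx (fun X : 'M[K]_p => X *m o v) i l)) => //.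
by apply: continuous_measurable; apply: continuous_Lmxr; exact: continuous_o.
Qed.

Lemma stack_shear (v x : V) : stack (shear (v, x)) = to_real (col_mx 1%:M (o x) *m o v).
Proof.
rewrite /stack /shear /= /rmul mul_Lmx; last exact: rlin_mulr.
by rewrite to_realK mul_col_mx mul1mx.
Qed.

Lemma rdet_mull (T : 'M[K]_p) v :
  rdet (to_real (T *m o v)) = `|\det (Lmx (fun X : 'M[K]_p => X *m T))| * rdet v.
Proof.
rewrite /rdet -normrM -det_mulmx -Lmx_comp; [|exact: rlin_mulr|exact: rlin_mulr].
by congr (`|\det _|); apply: Lmx_ext => X; rewrite to_realK mulmxA.
Qed.

Lemma rdet_inv v : rdet v != 0 -> exists Y, o v *m Y = 1%:M /\ Y *m o v = 1%:M.
Proof.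
rewrite normr_eq0 => r0; apply: inj_inv.
pose Y : 'M[K]_p := of_real_row (to_real (1%:M : 'M[K]_p) *m invmx (Lmx (fun X : 'M[K]_p => X *m o v))).
apply: (@inj_cols_left_inv _ _ _ _ Y); apply: (can_inj (@to_realK R k p p)).
rewrite (to_real_mul Y (rlin_mulr p (o v))) of_real_rowK mulmxKV //.
by rewrite unitmxE unitfE.
Qed.

Variable mu : {sigma_finite_measure set BV -> \bar R}.
Variable c : R.
Hypothesis mut : tinv mu.
Hypothesis mu1 : mu (hbox 0 (const_mx 1)) = c%:E.

(** Left multiplication by a unitary matrix preserves the measure on frames, as its real determinant is
    one in modulus, and it preserves the cutoff. *)
Lemma frame_integral_unitary F x : unitary x -> chart_continuous F -> (forall b, 0 <= F b) ->
  (\int[stackm mu]_z (frame_fun (fun b => F (act x b)) z)%:E = \int[stackm mu]_z (frame_fun F z)%:E)%E.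
Proof.
move=> xu cF F0; pose A := Lmx (fun Z : 'M[K]_(p + p, p) => x *m Z).
have AA : A *m A^T = 1%:M.
  by apply: Lmx_isom; [exact: rlin_mull | move=> u v; apply: dot_unitl; exact: (proj1 xu)].
have dA : `|\det A| = 1.
  have := congr1 determinant AA; rewrite det_mulmx det_tr det1 -expr2 -real_normK ?num_real // => /eqP.
  by rewrite sqrp_eq1 // => /eqP.
rewrite -[RHS]mul1e -[in RHS]invr1 -dA.
rewrite -(integral_linear_change dims20 (stackm_tinv mut) (stackm_cube mu1)).
- apply: eq_integral => z _; congr EFin.
  have oE : o2 (rmul A z) = x *m o2 z.
    by rewrite /rmul mul_Lmx ?to_realK //; exact: rlin_mull.
  have iE : inj_cols (x *m o2 z) <-> inj_cols (o2 z).
    split; first exact: inj_cols_mull.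
    by apply: inj_colsM; exact: inj_cols_left_inv (proj1 xu).
  rewrite /frame_fun oE; have [Dz|Dz] := pselect (unit_frames z); last first.
    rewrite !indicE !memNset ?mulr0 // /unit_frames /= oE iE.
    by rewrite nrm2_unitl // (proj1 xu).
  rewrite act_unitary_grs //; last by case: Dz.
  by rewrite !indicE !mem_set // /unit_frames /= oE iE nrm2_unitl // (proj1 xu).
- by rewrite unitmxE unitfE -normr_eq0 dA oner_neq0.
- by apply/measurable_EFinP; exact: measurable_frame_fun.
- by move=> z; rewrite lee_fin mulr_ge0.
Qed.
Definition ball_integrand (y : BV) : \bar R := (rdet y * \1_unit_ball y)%:E.

Definition ball_mass : \bar R := (\int[mu]_y ball_integrand y)%E.

Lemma ball_integrand_ge0 y : (0 <= ball_integrand y)%E.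
Proof. by rewrite lee_fin mulr_ge0 // normr_ge0. Qed.

Lemma measurable_ball_integrand : measurable_fun setT ball_integrand.
Proof.
apply/measurable_EFinP; apply: measurable_funM; first exact: measurable_rdet.
by apply: measurable_indic; exact: measurable_unit_ball.
Qed.

(** The frames with a given span in the big cell, parametrized by their first block v. With
    (1; X) = B T the substitution T v absorbs T in the cutoff and produces the determinants of
    left and right multiplication by T. *)
Lemma fibre_integral F (x : V) : (forall b, 0 <= F b) ->
  (\int[mu]_v (rdet v * frame_fun F (stack (shear (v, x))))%:E =
   (bigcell F x * weight x)%:E * ball_mass)%E.
Proof.
move=> F0; have iX : inj_cols (col_mx 1%:M (o x) : 'M[K]_(p + p, p)) by exact: inj_cols_nbar.
have [x0 [T [t [x0K XE Tu Tt t0]]]] := K_frame hp iX.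
have BB := unitary_lsub (group_K_unitary x0K).
have P0 : 0 < \prod_i t i by apply: prodr_gt0 => i _; exact: t0.
pose A := Lmx (fun Y : 'M[K]_p => T *m Y).
have AE (v : V) : rmul A v = to_real (T *m o v).
  by rewrite /rmul mul_Lmx //; exact: rlin_mull.
have detT : `|\det (Lmx (fun X : 'M[K]_p => X *m T))| = (\prod_i t i) ^+ (p * d).
  by rewrite (det_mulr_upper p Tu Tt) ger0_norm // exprn_ge0 // ltW.
have detA : `|\det A| = (\prod_i t i) ^+ (p * d).
  by rewrite (det_mull_upper p Tu Tt) ger0_norm // exprn_ge0 // ltW.
have wE : weight x = ((\prod_i t i) ^+ (p * d))^-1 * ((\prod_i t i) ^+ (p * d))^-1.
  rewrite /weight XE (gram_frame _ BB) det_realE (det_mull_upper 1 Tu Tt) mul1n.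
  rewrite exprVn -!exprM -invfM -exprD; congr (_ ^-1); congr (_ ^+ _).
  by rewrite mulnAC muln2 -addnn (mulnC d p).
have P1 : 0 < (\prod_i t i) ^+ (p * d) by rewrite exprn_gt0.
have rT v : rdet (rmul A v) = (\prod_i t i) ^+ (p * d) * rdet v.
  by rewrite AE rdet_mull detT.
have nE v : nrm2 (col_mx 1%:M (o x) *m o v) = nrm2 (o (rmul A v)).
  by rewrite AE to_realK XE -mulmxA nrm2_unitl.
have ptw v : rdet v * frame_fun F (stack (shear (v, x))) =
   bigcell F x * ((\prod_i t i) ^+ (p * d))^-1 * (rdet (rmul A v) * \1_unit_ball (rmul A v)).
  (* Both sides vanish when v is singular; otherwise v does not change the span of (1; X). *)
  have [r0|r0] := eqVneq (rdet v) 0; first by rewrite rT r0 !(mulr0, mul0r).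
  have [Y [vY Yv]] := rdet_inv r0.
  rewrite rT /frame_fun stack_shear to_realK (grs_mulr _ vY).
  have -> : F (grs (col_mx 1%:M (o x))) = bigcell F x by rewrite /bigcell chartE mul1mx.
  have -> : \1_unit_frames (to_real (col_mx 1%:M (o x) *m o v)) = \1_unit_ball (rmul A v) :> R.
    rewrite !indicE; congr (_%:R); congr nat_of_bool; apply/idP/idP; rewrite !inE /unit_frames /unit_ball /= to_realK nE; first by case.
    move=> h; split=> //; apply: inj_colsM => //; exact: inj_cols_left_inv Yv.
  by field; rewrite gt_eqF.
have k0 : 0 <= bigcell F x * ((\prod_i t i) ^+ (p * d))^-1.
  by rewrite mulr_ge0 ?invr_ge0 ?(ltW P1) //; exact: F0.
have mA := measurableT_comp measurable_ball_integrand (measurable_rmul A).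
rewrite (eq_integral (fun v : BV => ((bigcell F x * ((\prod_i t i) ^+ (p * d))^-1)%:E *
   (ball_integrand \o rmul A) v)%E)); last by move=> v _; rewrite ptw EFinM.
have A0 (v : BV) : [set: BV] v -> (0 <= (ball_integrand \o rmul A) v)%E.
  by move=> _; exact: ball_integrand_ge0.
have E := ge0_integralZl_EFin mu measurableT A0 mA k0.
rewrite {}E.
rewrite (integral_linear_change dims0 mut mu1 _ measurable_ball_integrand ball_integrand_ge0).
  by rewrite detA -/ball_mass muleA -EFinM -mulrA -wE.
by rewrite unitmxE unitfE -normr_eq0 detA gt_eqF.
Qed.

Lemma gram_bigcell_gt0 (v : V) : 0 < gram (col_mx 1%:M (o v)).
Proof.
have iX : inj_cols (col_mx 1%:M (o v) : 'M[K]_(p + p, p)) by exact: inj_cols_nbar.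
have [x [T [t [xK XE Tu Tt t0]]]] := K_frame hp iX.
rewrite XE (gram_frame _ (unitary_lsub (group_K_unitary xK))).
rewrite det_realE (det_mull_upper 1 Tu Tt) !exprn_gt0 //.
by apply: prodr_gt0 => i _; exact: t0.
Qed.

Lemma weight_ge0 v : 0 <= weight v.
Proof. by rewrite exprn_ge0 // invr_ge0 ltW // gram_bigcell_gt0. Qed.

Lemma continuous_weight : continuous weight.
Proof.
have cg : continuous (fun v : V => gram (col_mx 1%:M (o v) : 'M[K]_(p + p, p))).
  apply: continuous_gram; apply: continuous_col_mx; first exact: continuous_cst.
  exact: continuous_o.
apply: (@continuous_comp' _ R R (fun v : V => (gram (col_mx 1%:M (o v)))^-1) (fun y => y ^+ p)).
  move=> v; have g0 : gram (col_mx 1%:M (o v) : 'M[K]_(p + p, p)) != 0.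
    by rewrite gt_eqF // gram_bigcell_gt0.
  exact: (cvgV g0 (cg v)).
exact: exprn_continuous.
Qed.

Lemma measurable_weight : measurable_fun setT (weight : BV -> R).
Proof. exact: continuous_measurable continuous_weight. Qed.

Lemma det_real_rdet (v : V) : det_real (o v) != 0 -> rdet v != 0.
Proof.
move=> d0; have a0 : abs_det (o v) != 0.
  by rewrite gt_eqF // /abs_det powR_gt0 // normr_gt0.
have [Y [_ Yv]] := inj_inv (abs_det_inj a0).
apply: contra_neq (oner_neq0 R) => r0.
have := rdet_mull Y v; rewrite Yv r0 mulr0 /rdet to_realK.
by rewrite Lmx_id ?det1 ?normr1 // => X; rewrite mulmx1.
Qed.

(** A frame (v; w) with v invertible spans the point w v^-1 of the big cell. Substituting w = x v for
    fixed v, and integrating over v first, separates the point of the Grassmannian from the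
    choice of the frame. *)
Lemma frame_integralE F : chart_continuous F -> (forall b, 0 <= F b) ->
  (\int[stackm mu]_z (frame_fun F z)%:E =
   ball_mass * \int[mu]_x (bigcell F x * weight x)%:E)%E.
Proof.
move=> cF F0.
have mphi : measurable_fun setT (fun z : BW => (frame_fun F z)%:E : \bar R).
  by apply/measurable_EFinP; exact: measurable_frame_fun.
have phi0 z : (0 <= (frame_fun F z)%:E)%E by rewrite lee_fin mulr_ge0.
have ms : measurable_fun setT (fun z : BV * BV => (frame_fun F (stack z))%:E : \bar R).
  exact: (measurableT_comp mphi measurable_stack).
have mr : measurable_fun setT (fun z : BV * BV => (rdet z.1 * frame_fun F (stack (shear z)))%:E : \bar R).
  under eq_fun do rewrite EFinM.
  apply: emeasurable_funM.
    apply/measurable_EFinP; apply: (measurableT_comp (f := rdet : BV -> R)) => //; exact: measurable_rdet.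
  exact: (measurableT_comp ms measurable_shear).
have r0 z : (0 <= (rdet z.1 * frame_fun F (stack (shear z)))%:E)%E.
  by rewrite lee_fin !mulr_ge0 // normr_ge0.
rewrite (ge0_integral_pushm (mu \x mu)%E measurable_stack mphi phi0).
rewrite fubini_tonelli1 //.
transitivity (\int[mu]_v \int[mu]_x (rdet v * frame_fun F (stack (shear (v, x))))%:E)%E.
  apply: ge0_ae_eq_integral => //.
  - exact: measurable_fun_fubini_tonelli_F.
  - exact: (measurable_fun_fubini_tonelli_F (m2 := mu) _ mr r0).
  - by move=> v _; apply: integral_ge0.
  - by move=> v _; apply: integral_ge0 => x _; exact: (r0 (v, x)).
  exists [set v : BV | det_real (o v) = 0]; split.
  - exact: measurable_singular.
  - exact: singular_null.
  move=> v /= h; apply: contrapT => /eqP d0; apply: h => _.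
  have r1 := det_real_rdet d0.
  have mv : measurable_fun setT (fun w : BV => (frame_fun F (stack (v, w)))%:E : \bar R).
    by apply: measurableT_comp ms _; exact: measurable_pair1.
  have fv w : (0 <= (frame_fun F (stack (v, w)))%:E)%E by exact: phi0.
  pose A := Lmx (fun X : 'M[K]_p => X *m o v).
  have E := ge0_integralZl_EFin mu measurableT (fun w _ => fv (rmul A w))
    (measurableT_comp mv (measurable_rmul A)) (normr_ge0 _ : 0 <= rdet v).
  under [RHS]eq_integral do rewrite EFinM.
  rewrite [RHS]E (integral_linear_change dims0 mut mu1 _ mv fv); last first.
    by rewrite unitmxE unitfE -normr_eq0.
  rewrite -[`|\det A|]/(rdet v) muleA -EFinM (mulfV r1) mul1e; reflexivity.
etransitivity; first exact: (fubini_tonelli (m1 := mu) (m2 := mu) _ mr r0).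
under eq_integral do rewrite (fibre_integral _ F0) muleC.
have mb : measurable_fun setT (fun x : BV => (bigcell F x * weight x)%:E : \bar R).
  by apply/measurable_EFinP; apply: measurable_funM; [exact: measurable_bigcell | exact: measurable_weight].
have b0 (x : BV) : [set: BV] x -> (0 <= (bigcell F x * weight x)%:E)%E.
  by move=> _; rewrite lee_fin mulr_ge0 // ?weight_ge0 //; exact: F0.
have m0 : (0 <= ball_mass)%E by apply: integral_ge0 => y _; exact: ball_integrand_ge0.

exact: (ge0_integralZl mu measurableT mb b0 m0).
Qed.
End Disintegration.

(** * Uniqueness of the invariant integral *)

Section InvariantIntegrals.
Context {R : realType} {k : division_algebra} {p : nat}.
Hypothesis hp : (0 < p)%N.
Local Notation Gr := (Gr R k p).
Local Notation M2p := 'M[scalars R k]_(p + p).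
Implicit Types (F : Gr -> R) (x : M2p).

Lemma chart_continuous_act F x : group_K x -> chart_continuous F ->
  chart_continuous (fun b => F (act x b)).
Proof.
move=> xK cF g Gg; under eq_fun do rewrite (chart_act _ (group_K_unitary xK) (group_G_inj Gg)).
by apply: cF; apply: SL_mul => //; exact: group_KG.
Qed.

(** A probability density w on T, transported to the Grassmannian by b, whose integral of continuous
    functions is invariant under K. Both sides of the final change of variables have this form. *)
Definition invariant_integral d (T : measurableType d) (nu : {measure set T -> \bar R})
    (b : T -> Gr) (w : T -> R) :=
  [/\ measurable_fun setT w, forall t, 0 <= w t, (\int[nu]_t (w t)%:E = 1)%E,
      forall F, chart_continuous F -> measurable_fun setT (fun t => F (b t)) &
      forall F x, chart_continuous F -> (forall c, 0 <= F c) -> group_K x ->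
        (\int[nu]_t (F (act x (b t)) * w t)%:E = \int[nu]_t (F (b t) * w t)%:E)%E].

(** The integral of F is that of its averages over translates, which are nearly constant. *)
Lemma invariant_integral_mean d (T : measurableType d) (nu : {measure set T -> \bar R})
    (b : T -> Gr) (w : T -> R) F (m : R) :
  invariant_integral nu b w -> chart_continuous F -> (forall c, 0 <= F c) ->
  (forall e, 0 < e -> exists s, [/\ inK s, s != [::] & forall c, m - e <= avg F s c <= m + e]) ->
  (\int[nu]_t (F (b t) * w t)%:E = m%:E)%E.
Proof.
move=> [mw w0 w1 mb inv] cF F0 Hm; set J := (\int[nu]_t (F (b t) * w t)%:E)%E.
have mFw G : chart_continuous G -> measurable_fun setT (fun t => (G (b t) * w t)%:E : \bar R).
  by move=> cG; apply/measurable_EFinP; apply: measurable_funM => //; exact: mb.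
have cstw (r : R) : 0 <= r -> (\int[nu]_t (r * w t)%:E = r%:E)%E.
  move=> r0; under eq_integral do rewrite EFinM.
  rewrite ge0_integralZl_EFin //; first by rewrite w1 mule1.
    by move=> t _; rewrite lee_fin.
  exact/measurable_EFinP.
have cFx x : group_K x -> chart_continuous (fun c => F (act x c)).
  by move=> xK; exact: chart_continuous_act.
have J0 : (0 <= J)%E by apply: integral_ge0 => t _; rewrite lee_fin mulr_ge0.
have sumJ s : inK s -> measurable_fun setT (fun t => (\sum_(x <- s) F (act x (b t)) * w t)%:E : \bar R) /\
    (\int[nu]_t (\sum_(x <- s) F (act x (b t)) * w t)%:E = (size s)%:R%:E * J)%E.
  elim: s => [|x s IH] sK.
    split; first by under eq_fun do rewrite big_nil; exact: measurable_cst.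
    by under eq_integral do rewrite big_nil; rewrite integral0 mul0e.
  have [ms IHs] : _ /\ _ := IH (fun y ys => sK y (mem_behead (s := x :: s) ys)).
  have xK : group_K x by apply: sK; exact: mem_head.
  have mx := mFw _ (cFx x xK).
  split.
    under eq_fun do rewrite big_cons EFinD; exact: emeasurable_funD.
  under eq_integral do rewrite big_cons EFinD.
  rewrite ge0_integralD //; last 2 first.
  - by move=> t _; rewrite lee_fin mulr_ge0.
  - by move=> t _; rewrite lee_fin; apply: sumr_ge0 => y _; rewrite mulr_ge0.
  rewrite IHs (inv F x cF F0 xK) -/J [size (x :: s)]/= -natr1 EFinD -{1}[J]mul1e addeC.
  by rewrite -ge0_muleDl // ?lee_fin.
have avgE s t : (avg F s (b t) * w t)%:E =
    ((size s)%:R^-1%:E * (\sum_(x <- s) F (act x (b t)) * w t)%:E)%E.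
  by rewrite -EFinM /avg -mulr_suml mulrA (mulrC _^-1).
have avg_meas s : inK s -> measurable_fun setT (fun t => (avg F s (b t) * w t)%:E : \bar R).
  move=> sK; under eq_fun do rewrite avgE; apply: emeasurable_funM => //.
  exact: (proj1 (sumJ s sK)).
have avgJ s : inK s -> s != [::] -> (\int[nu]_t (avg F s (b t) * w t)%:E = J)%E.
  move=> sK s0; have n0 : 0 < (size s)%:R :> R by rewrite ltr0n lt0n size_eq0.
  have [ms hs] := sumJ s sK.
  under eq_integral do rewrite avgE.
  rewrite ge0_integralZl_EFin ?invr_ge0 ?(ltW n0) //; last first.
    by move=> t _; rewrite lee_fin; apply: sumr_ge0 => y _; rewrite mulr_ge0.
  by rewrite hs muleA -EFinM mulVf ?mul1e // gt_eqF.
have avg0 s c : 0 <= avg F s c.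
  by rewrite /avg divr_ge0 // sumr_ge0.
have m0 : 0 <= m.
  apply/ler_addgt0Pr => e e0; have [s [_ _ /(_ b_o) /andP [_ h]]] := Hm e e0.
  exact: le_trans (avg0 s b_o) h.
have J_le e : 0 < e -> (J <= (m + e)%:E)%E.
  move=> e0; have [s [sK s0 hs]] := Hm e e0.
  have me : 0 <= m + e by rewrite addr_ge0 // ltW.
  rewrite -(avgJ s sK s0) -(cstw _ me); apply: ge0_le_integral => //.
  - by move=> t _; rewrite lee_fin mulr_ge0.
  - exact: avg_meas.
  - by apply/measurable_EFinP; apply: measurable_funM.
  - by move=> t _; rewrite lee_fin ler_wpM2r //; have /andP [] := hs (b t).
have J_ge e : 0 < e -> (m%:E <= J + e%:E)%E.
  move=> e0; have [s [sK s0 hs]] := Hm e e0.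
  rewrite -(avgJ s sK s0) -(cstw _ m0) -[X in (_ + X)%E](cstw _ (ltW e0)).
  have mew : measurable_fun setT (fun t => (e * w t)%:E : \bar R).
    by apply/measurable_EFinP; apply: measurable_funM.
  rewrite -ge0_integralD //; last 3 first.
  - by move=> t _; rewrite lee_fin mulr_ge0.
  - exact: avg_meas.
  - by move=> t _; rewrite lee_fin mulr_ge0 // ltW.
  apply: ge0_le_integral => //.
  - by move=> t _; rewrite lee_fin mulr_ge0.
  - by apply/measurable_EFinP; apply: measurable_funM.
  - by apply: emeasurable_funD => //; exact: avg_meas.
  - move=> t _; rewrite -EFinD lee_fin -mulrDl ler_wpM2r //.
    by have /andP [h _] := hs (b t); lra.
have [j jE] : exists j, J = j%:E.
  have : J \is a fin_num by rewrite ge0_fin_numE // (le_lt_trans (J_le 1 ltr01)) // ltry.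
  by move=> /fineK <-; eexists.
rewrite jE; congr EFin; apply/eqP; rewrite eq_le; apply/andP; split.
  by apply/ler_addgt0Pr => e e0; rewrite -lee_fin -jE J_le.
by apply/ler_addgt0Pr => e e0; rewrite -lee_fin EFinD -jE J_ge.
Qed.

(** Positive and negative parts of F are continuous, and each has a mean value. *)
Lemma invariant_integral_unique d (T : measurableType d) (nu : {measure set T -> \bar R})
    (b : T -> Gr) (w : T -> R) d' (T' : measurableType d') (nu' : {measure set T' -> \bar R})
    (b' : T' -> Gr) (w' : T' -> R) F :
  invariant_integral nu b w -> invariant_integral nu' b' w' -> chart_continuous F ->
  (\int[nu]_t (F (b t) * w t)%:E = \int[nu']_t (F (b' t) * w' t)%:E)%E.
Proof.
move=> hnu hnu' cF.
have key G : chart_continuous G -> (forall c, 0 <= G c) ->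
    (\int[nu]_t (G (b t) * w t)%:E = \int[nu']_t (G (b' t) * w' t)%:E)%E.
  move=> cG G0; have [m Hm] := mean_exists hp cG.
  by rewrite (invariant_integral_mean hnu cG G0 Hm) (invariant_integral_mean hnu' cG G0 Hm).
have cp : chart_continuous (fun c => Num.max (F c) 0).
  move=> g Gg; apply: (@continuous_comp' _ R R _ (fun y => Num.max y 0)); first exact: cF.
  by move=> y; apply: continuous_max; [exact: cvg_id | exact: cvg_cst].
have cn : chart_continuous (fun c => Num.max (- F c) 0).
  move=> g Gg; apply: (@continuous_comp' _ R R (fun X => F (chart g X)) (fun y => Num.max (- y) 0)).
    exact: cF.
  move=> y; apply: (@continuous_max _ _ (fun y : R => - y) (fun=> 0)); last exact: cvg_cst.
  exact: oppr_continuous.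
have p0 (r : R) : 0 <= Num.max r 0 by rewrite le_max lexx orbT.
case: hnu => _ w0 _ _ _; case: hnu' => _ w0' _ _ _.
rewrite integralE [RHS]integralE; congr (_ - _)%E.
  rewrite (eq_integral (fun t => (Num.max (F (b t)) 0 * w t)%:E)) => [|t _].
    rewrite [RHS](eq_integral (fun t => (Num.max (F (b' t)) 0 * w' t)%:E)) => [|t _].
      exact: (key (fun c => Num.max (F c) 0)).
    by rewrite funeposE maxr_pMl // mul0r EFin_max.
  by rewrite funeposE maxr_pMl // mul0r EFin_max.
rewrite (eq_integral (fun t => (Num.max (- F (b t)) 0 * w t)%:E)) => [|t _].
  rewrite [RHS](eq_integral (fun t => (Num.max (- F (b' t)) 0 * w' t)%:E)) => [|t _].
    exact: (key (fun c => Num.max (- F c) 0)).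
  by rewrite funenegE maxr_pMl // mul0r mulNr EFin_max.
by rewrite funenegE maxr_pMl // mul0r mulNr EFin_max.
Qed.
End InvariantIntegrals.

(** * Invariance of the integral over the big cell *)

Section BigCellIntegral.
Context {R : realType} {k : division_algebra} {p : nat}.
Hypothesis hp : (0 < p)%N.
Local Notation K := (scalars R k).
Local Notation d := (real_dim k).
Local Notation Gr := (Gr R k p).
Local Notation M2p := 'M[K]_(p + p).
Local Notation V := 'rV[R]_(p * p * d).
Local Notation W := 'rV[R]_((p + p) * p * d).
Local Notation BV := (g_sigma_algebraType (@open V)).
Local Notation BW := (g_sigma_algebraType (@open W)).
Local Notation o := (@of_real_row R k p p).
Local Notation o2 := (@of_real_row R k (p + p) p).
Implicit Types (F : Gr -> R) (x : M2p).
Variable mu : {sigma_finite_measure set BV -> \bar R}.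
Variable c : R.
Hypothesis mut : tinv mu.
Hypothesis mu1 : mu (hbox 0 (const_mx 1)) = c%:E.
Hypothesis c0 : 0 < c.
Hypothesis hw : (\int[mu]_v (weight (k := k) v)%:E = 1)%E.

(** The constant of proportionality is the measure of the cutoff, by the case F = 1. *)
Lemma ball_massE : stackm mu (@unit_frames R k p) = ball_mass (k := k) mu.
Proof.
have := frame_integralE hp mut mu1 (@chart_continuous_cst R k p 1) (fun=> ler01).
rewrite /frame_fun /bigcell.
under eq_integral do rewrite mul1r.
rewrite integral_indic ?setIT // => [->|]; last exact: measurable_unit_frames.
by under eq_integral do rewrite mul1r; rewrite hw mule1.
Qed.

Lemma ball_mass_fin : (ball_mass (k := k) mu < +oo)%E.
Proof.
rewrite -ball_massE; set b : W := const_mx 2; set a : W := const_mx (- 2).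
have mb := @measurable_hbox R _ a b.
apply: (@le_lt_trans _ _ (stackm mu (hbox a b))).
  apply: le_measure; rewrite ?inE //; first exact: measurable_unit_frames.
  move=> z [_ hz] i; rewrite !mxE; have := coord_le_nrm2 (o2 z) i.
  rewrite of_real_rowK => /le_trans/(_ hz) h.
  have : `|z 0 i| <= 1.
    by rewrite -(@ler_pXn2r _ 2) ?nnegrE // expr1n real_normK ?num_real.
  by rewrite ler_norml => /andP [? ?]; apply/andP; split; lra.
rewrite (mu_hbox (stackm_tinv mut) (stackm_cube mu1)) ?ltry // => i.
by rewrite !mxE; lra.
Qed.

Lemma ball_mass_gt0 : (0 < ball_mass (k := k) mu)%E.
Proof.
rewrite -ball_massE.
pose O' : set W := [set z | inj_cols (o2 z)] `&` [set z | nrm2 (o2 z) < 1].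
have oO : open O'.
  apply: openI; first exact: open_inj.
  by have /continuousP/(_ _ (@open_lt R 1)) := @continuous_o2_nrm2 R k p.
(* The frame (1; 0) has squared norm p; the factor r brings it into the open unit ball. *)
pose r : R := (2 * p%:R)^-1.
have p0 : 0 < p%:R :> R by rewrite ltr0n.
have r0 : 0 < r by rewrite invr_gt0 mulr_gt0.
pose Z0 : 'M[K]_(p + p, p) := col_mx 1%:M 0.
have Z0Z : adjoint Z0 *m Z0 = 1%:M by rewrite adjoint_col mul_row_col adjoint1 mulmx1 mulmx0 addr0.
pose z0 : W := to_real (of_real k r *: Z0).
have Oz : O' z0.
  split; rewrite /= to_realK.
    apply: (@inj_cols_left_inv _ _ _ _ (of_real k r^-1 *: adjoint Z0)).
    by rewrite -scalemxAl mulmx_realZ Z0Z scalerA -of_realM mulVf ?gt_eqF // of_real1 scale1r.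
  rewrite nrm2Z (nrm2_orthonormal Z0Z) /r.
  have -> : (2 * p%:R)^-1 ^+ 2 * p%:R = (4 * p%:R)^-1 :> R by field; rewrite gt_eqF.
  have p1 : 1 <= p%:R :> R by rewrite ler1n.
  by rewrite invf_lt1 ?mulr_gt0 //; lra.
have [a [b [hz hO]]] := open_hbox oO Oz.
have ab : le_rv (map_mx ratr a) (map_mx ratr b : W).
  by move=> i; have /andP [h1 /ltW h2] := hz i; exact: le_trans h1 h2.
apply: (@lt_le_trans _ _ (stackm mu (hbox (map_mx ratr a) (map_mx ratr b)))).
  rewrite (mu_hbox (stackm_tinv mut) (stackm_cube mu1)) // lte_fin !mulr_gt0 //.
  apply: prodr_gt0 => i _; have /andP [h1 h2] := hz i.
  by rewrite subr_gt0 (le_lt_trans h1 h2).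
apply: le_measure; rewrite ?inE; [exact: measurable_hbox|exact: measurable_unit_frames|].
by move=> z /hO [h1 /ltW h2].
Qed.

(** The integral over frames is invariant, and it is a finite positive multiple of the integral over
    the big cell. *)
Lemma bigcell_invariant : invariant_integral mu (fun v : BV => chart 1%:M (o v) : Gr) (weight (k := k)).
Proof.
split; first exact: measurable_weight.
- exact: weight_ge0.
- exact: hw.
- by move=> F cF; exact: (measurable_bigcell cF).
move=> F x cF F0 xK; have cFx := chart_continuous_act xK cF.
have := frame_integral_unitary hp mut mu1 (group_K_unitary xK) cF F0.
rewrite (frame_integralE hp mut mu1 cF F0) (frame_integralE hp mut mu1 cFx (fun b => F0 _)).
have [m mE] : exists m, ball_mass (k := k) mu = m%:E.
  have : ball_mass (k := k) mu \is a fin_num by rewrite ge0_fin_numE ?ball_mass_fin // ltW // ball_mass_gt0.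
  by move=> /fineK <-; eexists.
have m0 : 0 < m by rewrite -lte_fin -mE ball_mass_gt0.
rewrite mE => /(congr1 (fun y => m^-1%:E * y)%E).
by rewrite !muleA -!EFinM mulVf ?gt_eqF // !mul1e.
Qed.
End BigCellIntegral.

(** * Haar measure of the opposite unipotent group in coordinates *)

Section MeasureConstructions.
Context d (T : measurableType d) (R : realType).

Section SigmaFinitePack.
Variables (m : {measure set T -> \bar R}) (h : sigma_finite setT m).
(** The measure m itself; the proof of sigma-finiteness is a parameter so that it can carry the
    structure that the theorem of Fubini asks for. *)
Definition sigma_finite_pack of sigma_finite setT m : set T -> \bar R := m.
Local Notation sm := (sigma_finite_pack h).

Let sm0 : sm set0 = 0%E. Proof. exact: (measure0 m). Qed.
Let sm_ge0 A : (0 <= sm A)%E. Proof. exact: (measure_ge0 m). Qed.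
Let sm_sigma : semi_sigma_additive sm. Proof. exact: (@measure_semi_sigma_additive _ _ _ m). Qed.
HB.instance Definition _ := isMeasure.Build _ _ _ sm sm0 sm_ge0 sm_sigma.
HB.instance Definition _ := Measure_isSigmaFinite.Build _ _ _ sm h.
End SigmaFinitePack.

Lemma ge0_integral_mrestr (m : {measure set T -> \bar R}) (D : set T) (mD : measurable D) (g : T -> \bar R) :
  measurable_fun setT g -> (forall x, (0 <= g x)%E) ->
  (\int[mrestr m mD]_x g x = \int[m]_(x in D) g x)%E.
Proof.
move=> mg g0; transitivity (\int[mrestr m mD]_(x in D) g x)%E.
  rewrite (@ge0_negligible_integral _ _ _ _ setT (~` D)) //.
  - by rewrite setTD setCK.
  - exact: measurableC.
  - by rewrite -[LHS]/(m (~` D `&` D)) setICl measure0.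
by apply: eq_measure_integral => A mA AD; rewrite -[LHS]/(m (A `&` D)) (setIidl AD).
Qed.
End MeasureConstructions.
Section HaarInCoordinates.
Context {R : realType} {k : division_algebra} {p : nat}.
Hypothesis hp : (0 < p)%N.
Local Notation K := (scalars R k).
Local Notation d := (real_dim k).
Local Notation M2p := 'M[K]_(p + p).
Local Notation V := 'rV[R]_(p * p * d).
Local Notation BV := (g_sigma_algebraType (@open V)).
Local Notation BM := (BorelM R k p).
Local Notation o := (@of_real_row R k p p).
Local Notation Nbar := (group_Nbar R k p).

(** The coordinates of the lower left block, which parametrizes the opposite unipotent group. *)
Definition lower (y : M2p) : V := to_real (dlsubmx y).

Lemma continuous_lower : continuous lower.
Proof.
apply: (@continuous_comp' _ _ _ (fun y : M2p => dlsubmx y) (@to_real R k p p)).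
  apply: continuous_mx => i j; under eq_fun do rewrite !mxE.
  exact: continuous_entry.
exact: continuous_to_real.
Qed.

Lemma measurable_lower : measurable_fun setT (lower : BM -> BV).
Proof. exact: continuous_measurable_borel continuous_lower. Qed.

Lemma lower_nbar v : lower (nbar (o v)) = v.
Proof. by rewrite /lower /nbar block_mxKdl of_real_rowK. Qed.

Lemma nbar_lower y : Nbar y -> nbar (o (lower y)) = y.
Proof. by move=> /group_NbarP [X ->]; rewrite /lower /nbar block_mxKdl to_realK. Qed.

Lemma measurable_Nbar : measurable (Nbar : set BM).
Proof.
have cy : continuous (fun y : M2p => y - nbar (o (lower y))).
  apply: continuous_add_M; first by move=> y; exact: cvg_id.
  apply: (@continuous_rlin _ _ _ _ _ _ _ (fun y : M2p => nbar (o (lower y))) (fun y => - y)).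
    by split=> [x y|r y]; rewrite ?opprD // scalerN.
  apply: continuous_block_nbar.
  apply: (@continuous_comp' _ _ _ lower o); first exact: continuous_lower.
  exact: continuous_of_real_row.
have -> : Nbar = [set y | nrm2 (y - nbar (o (lower y))) = 0].
  apply/seteqP; split => y /= => [/nbar_lower ->|/nrm2_eq0 /eqP].
    by rewrite subrr nrm2_0.
  by rewrite subr_eq0 => /eqP ->; apply/group_NbarP; eexists.
apply: measurable_closed.
by have /continuous_closedP/(_ _ (@closed_eq R 0)) := continuous_nrm2 cy.
Qed.

Lemma nbarD (X Y : 'M[K]_p) : nbar X *m nbar Y = nbar (X + Y).
Proof. by rewrite /nbar mulmx_block !mulmx1 !mul1mx !mul0mx !mulmx0 !addr0 add0r. Qed.

Variable dn : {measure set BM -> \bar R}.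
Hypothesis hdn : Haar_Nbar dn.

Definition haar_coord : {measure set BV -> \bar R} :=
  pushm (mrestr dn measurable_Nbar) measurable_lower.

Lemma haar_coordE A : haar_coord A = dn ([set y | A (lower y)] `&` Nbar).
Proof. by []. Qed.

(** Multiplication in the opposite unipotent group is addition of the lower left blocks. *)
Lemma haar_coord_tinv : tinv haar_coord.
Proof.
move=> v A mA; rewrite !haar_coordE; have [inv _ _] := hdn.
have mB : measurable ([set y | A (lower y)] `&` Nbar : set BM).
  apply: measurableI; last exact: measurable_Nbar.
  by rewrite -[X in measurable X]setTI; exact: measurable_lower.
rewrite -(inv (nbar (- o v)) _ _ mB); last 2 first.
- by apply/group_NbarP; eexists.
- by move=> y [].
congr (dn _); apply/seteqP; split => [y [/= Ay Ny]|_ [y [/= Ay Ny] <-]].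
  exists (nbar (o v) *m y); last first.
    by rewrite mulmxA nbarD addNr -(nbar_lower Ny) nbarD add0r.
  rewrite -(nbar_lower Ny) nbarD; split; last by apply/group_NbarP; eexists.
  by rewrite /= addrC -of_real_rowD lower_nbar.
rewrite -(nbar_lower Ny) nbarD; split; last by apply/group_NbarP; eexists.
rewrite (_ : - o v + o (lower y) = o (lower y - v)); last first.
  rewrite of_real_rowD addrC; congr (_ + _); apply/eqP.
  by rewrite eq_sym -addr_eq0 -of_real_rowD addNr of_real_row0.
by rewrite /= lower_nbar subrK.
Qed.

(** The unit cube lies in a compact box, whose image in the group is compact. *)
Lemma haar_coord_cube : exists c : R, haar_coord (hbox 0 (const_mx 1)) = c%:E.
Proof.
have [_ fin _] := hdn.
pose B : set V := [set v | forall i, `[0, 1]%classic (v 0 i)].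
have cB : compact B by apply: (@rV_compact R _ (fun=> `[0, 1]%classic : set R)) => i; exact: segment_compact.
have cnb : continuous (fun v : V => nbar (o v) : M2p).
  by apply: continuous_block_nbar; exact: continuous_of_real_row.
have cC : compact ((fun v : V => nbar (o v) : M2p) @` B).
  by apply: continuous_compact => //; apply: continuous_subspaceT.
have CN : (fun v : V => nbar (o v) : M2p) @` B `<=` Nbar.
  by move=> _ [v _ <-]; apply/group_NbarP; eexists.
have E : (fun v : V => nbar (o v) : M2p) @` B = [set y | B (lower y)] `&` Nbar.
  apply/seteqP; split => [_ [v Bv <-]|y [By Ny]].
    by split; [rewrite /= lower_nbar | apply/group_NbarP; eexists].
  by exists (lower y) => //; exact: nbar_lower.
have mB : measurable (B : set BV).
  rewrite (_ : B = \bigcap_(i in [set: 'I__]) ((fun v : V => v 0 i) @^-1` `[0, 1])); last first.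
    by apply/seteqP; split => v h i; [move=> _; exact: h | exact: (h i I)].
  apply: fin_bigcap_measurable => // i _.
  by rewrite -[X in measurable X]setTI; exact: measurable_coord.
have : haar_coord (hbox 0 (const_mx 1)) \is a fin_num.
  rewrite ge0_fin_numE //; apply: le_lt_trans (fin _ cC CN).
  rewrite E -haar_coordE; apply: le_measure; rewrite ?inE //; first exact: measurable_hbox.
  by move=> v hv i; have := hv i; rewrite !mxE /= in_itv /= => /andP [-> /ltW ->].
by move=> /fineK <-; eexists.
Qed.

Lemma haar_coord_sigma_finite : sigma_finite setT haar_coord.
Proof.
have [c mu1] := haar_coord_cube.
exists (fun n => hbox (const_mx (- n%:R)) (const_mx n%:R)).
  apply/seteqP; split => // x _; exists (Num.truncn (\sum_i `|x 0 i|)).+1 => //= i.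
  have : (`|x 0 i| < (Num.truncn (\sum_i `|x 0 i|)).+1%:R).
    apply: (@le_lt_trans _ _ (\sum_i `|x 0 i|)); last by rewrite truncnS_gt.
    by rewrite (bigD1 i) //= lerDl sumr_ge0.
  by rewrite ltr_norml !mxE => /andP [/ltW -> ->].
move=> n; split; first exact: measurable_hbox.
rewrite (mu_hbox haar_coord_tinv mu1) ?ltry // => i; rewrite !mxE.
by rewrite (le_trans (y := 0)) // oppr_le0.
Qed.

(** Otherwise the bound by the outer volume would make the whole group null. *)
Lemma haar_coord_cube_gt0 c : haar_coord (hbox 0 (const_mx 1)) = c%:E -> 0 < c.
Proof.
move=> mu1; rewrite lt_neqAle -lee_fin -mu1 measure_ge0 andbT; apply/eqP => cz.
have := mu_le_vol haar_coord_tinv mu1 (@measurableT _ BV).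
rewrite -cz mul0e haar_coordE => h; have [_ _ n0] := hdn.
suff : (dn Nbar <= 0)%E by rewrite leNgt n0.
by apply: le_trans h; rewrite (_ : [set y | _] = setT) ?setTI //; exact/seteqP.
Qed.

(** The signed version follows from the nonnegative one, since both integrals are defined by positive
    and negative parts. *)
Lemma integral_Nbar (psi : BV -> \bar R) : measurable_fun setT psi ->
  (\int[dn]_(y in Nbar) psi (lower y) = \int[haar_coord]_v psi v)%E.
Proof.
have key (phi : BV -> \bar R) : measurable_fun setT phi -> (forall v, (0 <= phi v)%E) ->
   (\int[dn]_(y in Nbar) phi (lower y) = \int[haar_coord]_v phi v)%E.
  move=> mphi phi0; rewrite (ge0_integral_pushm _ measurable_lower mphi phi0).
  rewrite ge0_integral_mrestr //; exact: (measurableT_comp mphi measurable_lower).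
move=> mpsi; rewrite integralE [RHS]integralE.
rewrite -(key _ (measurable_funepos mpsi) (funepos_ge0 _)) -(key _ (measurable_funeneg mpsi) (funeneg_ge0 _)).
by congr (_ - _)%E; apply: eq_integral => y _; rewrite ?funeposE ?funenegE.
Qed.
End HaarInCoordinates.

(** * The invariant probability measure *)

Section InvariantProbability.
Context {R : realType} {k : division_algebra} {p : nat}.
Hypothesis hp : (0 < p)%N.
Local Notation Gr := (Gr R k p).
Local Notation BGr := (BorelGr R k p).
Local Notation M2p := 'M[scalars R k]_(p + p).
Implicit Types (F : Gr -> R) (x : M2p).

Lemma open_GrE (A : set Gr) : open A = Gr_open A.
Proof. by []. Qed.

Lemma measurable_chart_continuous F : chart_continuous F -> measurable_fun setT (F : BGr -> R).
Proof.
move=> cF; apply: continuous_measurable; apply/continuousP => A oA; rewrite open_GrE => g Gg.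
by move/continuousP: (cF g Gg); apply.
Qed.

Lemma measurable_act x : group_K x -> measurable_fun setT (act x : BGr -> BGr).
Proof.
move=> xK; apply: continuous_measurable_borel; apply/continuousP => A; rewrite !open_GrE => oA g Gg.
have -> : chart g @^-1` (act x @^-1` A) = chart (x *m g) @^-1` A.
  apply/seteqP; split => X /=; rewrite (chart_act _ (group_K_unitary xK) (group_G_inj Gg)) //.
by apply: oA; apply: SL_mul => //; exact: group_KG.
Qed.

Lemma probability_invariant (db : probability BGr R) : K_invariant db ->
  invariant_integral db (fun b : BGr => b : Gr) (fun=> 1).
Proof.
move=> hdb; split=> //.
- by rewrite integral_cst // mul1e; exact: probability_setT.
- by move=> F; exact: measurable_chart_continuous.
move=> F x cF F0 xK; have mF := measurable_chart_continuous cF.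
have mE : measurable_fun setT (fun b : BGr => (F b)%:E : \bar R) by apply/measurable_EFinP.
under eq_integral do rewrite mulr1; under [RHS]eq_integral do rewrite mulr1.
rewrite -(ge0_integral_pushm db (measurable_act xK) mE) => [|b]; last by rewrite lee_fin.
by apply: eq_measure_integral => A mA _; exact: hdb.
Qed.

Lemma invariant_integral_act d (T : measurableType d) (nu : {measure set T -> \bar R})
    (b : T -> Gr) (w : T -> R) x : group_K x ->
  invariant_integral nu b w -> invariant_integral nu (fun t => act x (b t)) w.
Proof.
move=> xK [mw w0 w1 mb inv]; have xu := group_K_unitary xK; split=> //.
  by move=> F cF; apply: (mb (fun c => F (act x c))); exact: chart_continuous_act.
move=> F y cF F0 yK; have yu := group_K_unitary yK.
rewrite (inv F x) // -[RHS](inv F (y *m x)) //; last exact: group_KM.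
by apply: eq_integral => t _; rewrite actM.
Qed.

(** Bounded pointwise limits of continuous functions are integrable and their integrals are limits.
    The cosine kernel is in general only such a limit, as it may jump where the cosine vanishes. *)
Lemma invariant_integral_limit d (T : measurableType d) (nu : {measure set T -> \bar R})
    (b : T -> Gr) (w : T -> R) (Fn : nat -> Gr -> R) F (M : R) :
  invariant_integral nu b w -> (forall n, chart_continuous (Fn n)) ->
  (forall n c, `|Fn n c| <= M) -> (forall c, Fn n c @[n --> \oo] --> F c) ->
  nu.-integrable setT (fun t => (F (b t) * w t)%:E) /\
  (\int[nu]_t (Fn n (b t) * w t)%:E)%E @[n --> \oo] --> (\int[nu]_t (F (b t) * w t)%:E)%E.
Proof.
move=> [mw w0 w1 mb _] cFn FM Flim.
have M0 : 0 <= M by apply: le_trans (FM 0%N b_o).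
have mFn n : measurable_fun setT (fun t => (Fn n (b t) * w t)%:E : \bar R).
  by apply/measurable_EFinP; apply: measurable_funM => //; exact: mb.
have lim t : [set: T] t -> (fun n => (Fn n (b t) * w t)%:E) @ \oo --> (F (b t) * w t)%:E.
  move=> _; apply: cvg_EFin; first by apply: nearW.
  by apply: cvgM; [exact: Flim | exact: cvg_cst].
have mF : measurable_fun setT (fun t => (F (b t) * w t)%:E : \bar R).
  by apply: emeasurable_fun_cvg lim => n; exact: mFn.
have ig : nu.-integrable setT (fun t => (M * w t)%:E).
  apply/integrableP; split; first by apply/measurable_EFinP; apply: measurable_funM.
  under eq_integral do rewrite gee0_abs ?lee_fin ?mulr_ge0 // EFinM.
  rewrite ge0_integralZl_EFin //; first by rewrite w1 mule1 ltry.
    by move=> t _; rewrite lee_fin.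
  exact/measurable_EFinP.
have dom n t : [set: T] t -> (`|(Fn n (b t) * w t)%:E| <= (M * w t)%:E)%E.
  by move=> _; rewrite lee_fin normrM (ger0_norm (w0 t)) ler_wpM2r.
have [h1 _ h3] := @dominated_convergence _ T R nu setT measurableT _ _ _ mFn mF (aeW _ lim) ig (aeW _ (fun t n Dt => dom n t Dt)).
by split.
Qed.

Lemma invariant_integral_limit_eq d (T : measurableType d) (nu : {measure set T -> \bar R})
    (b : T -> Gr) (w : T -> R) d' (T' : measurableType d') (nu' : {measure set T' -> \bar R})
    (b' : T' -> Gr) (w' : T' -> R) (Fn : nat -> Gr -> R) F (M : R) :
  invariant_integral nu b w -> invariant_integral nu' b' w' ->
  (forall n, chart_continuous (Fn n)) ->
  (forall n c, `|Fn n c| <= M) -> (forall c, Fn n c @[n --> \oo] --> F c) ->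
  (\int[nu]_t (F (b t) * w t)%:E = \int[nu']_t (F (b' t) * w' t)%:E)%E.
Proof.
move=> hnu hnu' cFn FM Flim.
have [_ h] := invariant_integral_limit hnu cFn FM Flim.
have [_ h'] := invariant_integral_limit hnu' cFn FM Flim.
have E : (fun n => \int[nu]_t (Fn n (b t) * w t)%:E)%E = (fun n => \int[nu']_t (Fn n (b' t) * w' t)%:E)%E.
  by apply/funext => n; exact: invariant_integral_unique.
rewrite E in h; have /cvg_lim <- // := h; have /cvg_lim <- // := h'.
Qed.
End InvariantProbability.

(** * The cosine kernel *)

Section CosineKernel.
Context {R : realType} {k : division_algebra} {p : nat}.
Hypothesis hp : (0 < p)%N.
Local Notation K := (scalars R k).
Local Notation d := (real_dim k).
Local Notation Gr := (Gr R k p).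
Local Notation M2p := 'M[K]_(p + p).
Implicit Types (u v : Gr -> R) (c b : Gr) (z : R[i]).

Lemma dR0 : 0 < d%:R :> R.
Proof. by case: k. Qed.

Lemma abs_det_exp n (x : 'M[K]_n) : abs_det x ^+ d = `|det_real x|.
Proof.
by rewrite /abs_det -powR_mulrn ?powR_ge0 // -powRrM mulVf ?gt_eqF ?dR0 // powRr1.
Qed.

(** The triangular factor is kept only through its nonzero determinant. *)
Lemma frame_decomp (Z : 'M[K]_(p + p, p)) : inj_cols Z ->
  exists B T, [/\ adjoint B *m B = 1%:M, Z = B *m T, grs Z = grs B & det_real T != 0].
Proof.
move=> iZ; have [x [T [t [xK ZE Tu Tt t0]]]] := K_frame hp iZ.
have [S [TS ST]] : exists S, T *m S = 1%:M /\ S *m T = 1%:M.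
  by apply: inj_inv; apply: (@inj_cols_mull _ _ _ _ _ (lsubmx x)); rewrite -ZE.
exists (lsubmx x), T; split=> //.
- exact: unitary_lsub (group_K_unitary xK).
- by rewrite ZE (grs_mulr _ TS).
- have := congr1 (@det_real R k p) TS; rewrite det_realM det_real1.
  by apply: contra_eqN => /eqP ->; rewrite mul0r eq_sym oner_eq0.
Qed.

Lemma gram_gt0 (Z : 'M[K]_(p + p, p)) : inj_cols Z -> 0 < gram Z.
Proof.
move=> /frame_decomp [B [T [BB -> _ T0]]]; rewrite (gram_frame _ BB).
by rewrite exprn_even_gt0.
Qed.

(** A formula for the cosine in terms of an arbitrary frame Z, whose numerator and denominator are
    continuous in Z. *)
Lemma abs_cos_grs (Z C : 'M[K]_(p + p, p)) : inj_cols Z -> adjoint C *m C = 1%:M ->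
  abs_cos (grs Z) (grs C) ^+ d = `|det_real (adjoint C *m Z)| / Num.sqrt (gram Z).
Proof.
move=> iZ CC; have [B [T [BB -> -> T0]]] := frame_decomp iZ.
rewrite (abs_cosE hp BB CC) abs_det_exp (gram_frame _ BB) sqrtr_sqr mulmxA.
by rewrite det_realM normrM mulfK // normr_eq0.
Qed.

Lemma abs_cos_ge0 b c : 0 <= abs_cos b c.
Proof.
have [x [xK ->]] := Gr_K hp b; have [y [yK ->]] := Gr_K hp c.
rewrite !act_bo (abs_cosE hp (unitary_lsub (group_K_unitary xK)) (unitary_lsub (group_K_unitary yK))).
exact: abs_det_ge0.
Qed.

Lemma chart_continuous_cos c : chart_continuous (fun b => abs_cos b c ^+ d).
Proof.
have [x [xK ->]] := Gr_K hp c; rewrite act_bo.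
have CC := unitary_lsub (group_K_unitary xK); set C := lsubmx x in CC *.
move=> g Gg; pose Z (X : 'M[K]_p) := g *m col_mx 1%:M X.
have iZ X : inj_cols (Z X).
  by apply: inj_colsM; [exact: group_G_inj | exact: inj_cols_nbar].
have cc : continuous (fun X : 'M[K]_p => col_mx 1%:M X : 'M[K]_(p + p, p)).
  by apply: continuous_col_mx; [exact: continuous_cst | move=> X; exact: cvg_id].
have cZ : continuous Z.
  by apply: (continuous_rlin (h := fun Y : 'M[K]_(p + p, p) => g *m Y)) => //; exact: rlin_mull.
under eq_fun do rewrite chartE (abs_cos_grs (iZ _) CC).
apply: continuous_mul.
  apply: (@continuous_comp' _ R R (fun X => det_real (adjoint C *m Z X)) (fun y => `|y|)).
    apply: continuous_det_real.
    by apply: (continuous_rlin (h := fun Y : 'M[K]_(p + p, p) => adjoint C *m Y)) => //; exact: rlin_mull.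
  by move=> y; exact: norm_continuous.
have cg : continuous (fun X => Num.sqrt (gram (Z X))).
  apply: (@continuous_comp' _ R R (fun X => gram (Z X)) (fun y => Num.sqrt y)).
    exact: continuous_gram.
  exact: sqrt_continuous.
move=> X; have g0 : Num.sqrt (gram (Z X)) != 0 by rewrite gt_eqF // sqrtr_gt0 gram_gt0.
exact: (cvgV g0 (cg X)).
Qed.

Lemma chart_continuousM u v : chart_continuous u -> chart_continuous v ->
  chart_continuous (fun b => u b * v b).
Proof. by move=> cu cv g Gg; apply: continuous_mul; [exact: cu | exact: cv]. Qed.

Lemma chart_continuousB u v : chart_continuous u -> chart_continuous v ->
  chart_continuous (fun b => u b - v b).
Proof.
move=> cu cv g Gg; apply: continuous_add; first exact: cu.
by move=> X; exact: (cvgN (cv g Gg X)).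
Qed.

Lemma Re_expC z : complex.Re (expC z) = expR (complex.Re z) * cos (complex.Im z).
Proof. by rewrite /expC /= mul0r subr0. Qed.

Lemma Im_expC z : complex.Im (expC z) = expR (complex.Re z) * sin (complex.Im z).
Proof. by rewrite /expC /= mul0r addr0. Qed.

Definition floored n (t : R) : R := Num.max t n.+1%:R^-1.
Definition cutoff n (t : R) : R := Num.min 1 (n.+1%:R * t).
(** A continuous substitute for t^(z/d), up to w = cos or w = sin for its real or imaginary part. The
    logarithm is floored at 1 / (n+1) and the cutoff vanishes at t = 0, so that for t > 0 the
    value is eventually the exact one. *)
Definition reg_pow (w : R -> R) z n (t : R) : R :=
  expR (complex.Re z * (ln (floored n t) / d%:R)) *
  w (complex.Im z * (ln (floored n t) / d%:R)) * cutoff n t.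

Lemma floored_gt0 n t : 0 < floored n t.
Proof. by rewrite /floored lt_max invr_gt0 ltr0n orbT. Qed.

Lemma continuous_reg_pow w z n : continuous w -> continuous (reg_pow w z n).
Proof.
move=> cw.
have cl : continuous (fun t : R => ln (floored n t) / d%:R).
  apply: continuous_mul; last exact: continuous_cst.
  move=> t; apply: (@continuous_comp _ _ _ (floored n) (@ln R)).
    by apply: continuous_max; [exact: cvg_id | exact: cvg_cst].
  by apply: continuous_ln; exact: floored_gt0.
have ce (r : R) : continuous (fun t : R => r * (ln (floored n t) / d%:R)).
  by apply: continuous_mul => //; exact: continuous_cst.
apply: continuous_mul; first apply: continuous_mul.
- apply: (@continuous_comp' _ R R _ (@expR R)); first exact: ce.
  exact: continuous_expR.
- by apply: (@continuous_comp' _ R R _ w) => //; exact: ce.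
- move=> t; apply: continuous_min; first exact: cvg_cst.
  by apply: cvgM; [exact: cvg_cst | exact: cvg_id].
Qed.

(** Uniform in n: the floor only increases the base, and the exponent has nonnegative real part. *)
Lemma reg_pow_bound w z n t (M : R) : (forall y, `|w y| <= 1) -> 0 <= complex.Re z -> 0 <= t -> t <= M ->
  1 <= M -> `|reg_pow w z n t| <= expR (complex.Re z * (ln M / d%:R)).
Proof.
move=> w1 z0 t0 tM M1; rewrite /reg_pow !normrM (ger0_norm (expR_ge0 _)).
have c1 : `|cutoff n t| <= 1.
  rewrite ger0_norm ?ge_min ?lexx // le_min ler01 mulr_ge0 //.
rewrite -[leRHS]mulr1.
apply: ler_pM => //.
rewrite -[leRHS]mulr1; apply: ler_pM => //.
rewrite ler_expR; apply: ler_wpM2l => //; rewrite ler_pM2r ?invr_gt0 ?dR0 //.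
rewrite ler_ln ?posrE ?floored_gt0 ?(lt_le_trans ltr01) //.
by rewrite ge_max tM (le_trans _ M1) // invf_le1 ?ltr0n // ler1n.
Qed.

Lemma reg_pow_limit w z t : 0 < t ->
  reg_pow w z n t @[n --> \oo] --> expR (complex.Re z * (ln t / d%:R)) * w (complex.Im z * (ln t / d%:R)).
Proof.
move=> t0; apply: cvg_near_cst; exists (Num.truncn t^-1) => // n /= hn.
have h : t^-1 <= n.+1%:R.
  by apply: ltW; apply: lt_le_trans (truncnS_gt _) _; rewrite ler_nat ltnS.
have h1 : n.+1%:R^-1 <= t by rewrite -[t]invrK lef_pV2 ?posrE ?invr_gt0.
rewrite /reg_pow; have -> : floored n t = t by rewrite /floored; apply/max_idPl.
have -> : cutoff n t = 1.
  rewrite /cutoff; apply/min_idPl.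
  have tt : t^-1 * t = 1 by rewrite mulVf // gt_eqF.
  have : t^-1 * t <= n.+1%:R * t by rewrite ler_pM2r.
  by rewrite tt.
by rewrite mulr1.
Qed.

(** The real part of |Cos|^z (u + i v). Its imaginary part has the same form for (v, - u), so one
    limit argument serves both. *)
Definition kernel_part z u v c b : R :=
  complex.Re (powC (abs_cos b c) z) * u b - complex.Im (powC (abs_cos b c) z) * v b.

(** For z = 0 the kernel is the constant 1, including where the cosine vanishes, and no
    regularization is wanted; otherwise it vanishes there, as the cutoff does. *)
Lemma kernel_limit z u v c : 0 <= complex.Re z -> chart_continuous u -> chart_continuous v ->
  exists (Fn : nat -> Gr -> R) (M : R), [/\ forall n, chart_continuous (Fn n),
    forall n b, `|Fn n b| <= M & forall b, Fn n b @[n --> \oo] --> kernel_part z u v c b].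
Proof.
move=> z0 cu cv; have [Mu uM] := chart_continuous_bounded hp cu.
have [Mv vM] := chart_continuous_bounded hp cv.
have [z00|zn0] := eqVneq z 0.
  exists (fun=> u), Mu; split=> // b; rewrite /kernel_part /powC z00.
  apply: cvg_near_cst; apply: nearW => n.
  rewrite eqxx mul0r; case: ifP => _; last first.
    by rewrite Re_expC Im_expC /= expR0 cos0 sin0 mulr1 mulr0 mul0r mul1r subr0.
  by rewrite /= mul0r mul1r subr0.
have cD := @chart_continuous_cos c.
have [MD DM] := chart_continuous_bounded hp cD.
pose D b := abs_cos b c ^+ d; pose M := Num.max MD 1; pose B := expR (complex.Re z * (ln M / d%:R)).
have D0 b : 0 <= D b by rewrite exprn_ge0 // abs_cos_ge0.
have DM' b : D b <= M.
  by rewrite le_max (le_trans (ler_norm _) (DM b)).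
have M1 : 1 <= M by rewrite le_max lexx orbT.
have B0 : 0 <= B by exact: expR_ge0.
exists (fun n b => reg_pow cos z n (D b) * u b - reg_pow sin z n (D b) * v b), (B * Mu + B * Mv).
split.
- move=> n; apply: chart_continuousB; apply: chart_continuousM => //.
    move=> g Gg; apply: (@continuous_comp' _ R R (fun X => D (chart g X)) (reg_pow cos z n)).
      exact: cD.
    by apply: continuous_reg_pow; exact: continuous_cos.
  move=> g Gg; apply: (@continuous_comp' _ R R (fun X => D (chart g X)) (reg_pow sin z n)).
    exact: cD.
  by apply: continuous_reg_pow; exact: continuous_sin.
- move=> n b; apply: (le_trans (ler_normB _ _)); apply: lerD; rewrite normrM; apply: ler_pM => //.
    by apply: (@reg_pow_bound cos z n (D b) M) => // y; rewrite ler_norml cos_geN1 cos_le1.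
  by apply: (@reg_pow_bound sin z n (D b) M) => // y; rewrite ler_norml sin_geN1 sin_le1.
move=> b; rewrite /kernel_part /powC; case: eqP => [t0|/eqP t0].
  rewrite (negbTE zn0) /= !mul0r subr0; apply: cvg_near_cst; apply: nearW => n.
  have Db0 : D b = 0 by rewrite /D t0 expr0n; case: (k).
  have c0 : cutoff n (D b) = 0 by rewrite /cutoff Db0 mulr0; apply/min_idPr.
  by rewrite /reg_pow c0 !mulr0 !mul0r subr0.
have t1 : 0 < abs_cos b c by rewrite lt_neqAle eq_sym t0 abs_cos_ge0.
have Dp : 0 < D b by rewrite exprn_gt0.
have lE : ln (D b) / d%:R = ln (abs_cos b c).
  by rewrite /D lnXn // -[ln _ *+ d]mulr_natr mulfK // gt_eqF // dR0.
have hc := @reg_pow_limit cos z _ Dp; have hs := @reg_pow_limit sin z _ Dp.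
rewrite lE in hc hs.
rewrite Re_expC Im_expC.
have -> : complex.Re (z * (ln (abs_cos b c))%:C) = complex.Re z * ln (abs_cos b c).
  by case: (z) => a e /=; rewrite mulr0 subr0.
have -> : complex.Im (z * (ln (abs_cos b c))%:C) = complex.Im z * ln (abs_cos b c).
  by case: (z) => a e /=; rewrite mulr0 add0r.
apply: cvgB; (apply: cvgM; last exact: cvg_cst).
  exact: hc.
exact: hs.
Qed.
End CosineKernel.

(** * The kernel in the big cell *)

Section HorosphericalCoordinates.
Context {R : realType} {k : division_algebra} {p : nat}.
Hypothesis hp : (0 < p)%N.
Local Notation K := (scalars R k).
Local Notation d := (real_dim k).
Local Notation Gr := (Gr R k p).
Local Notation M2p := 'M[K]_(p + p).
Local Notation V := 'rV[R]_(p * p * d).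
Local Notation BV := (g_sigma_algebraType (@open V)).
Local Notation o := (@of_real_row R k p p).
Local Notation rho := (rho R k p).
Implicit Types (u : Gr -> R) (f : Gr -> R[i]) (x : M2p) (v : V).

Lemma smooth_chart_continuous f : smooth f ->
  chart_continuous (fun b => complex.Re (f b)) /\ chart_continuous (fun b => complex.Im (f b)).
Proof.
move=> sf; have key (h : R[i] -> R) (g : M2p) :
    Cinfty (fun v : V => h (f (chart g (o v)))) -> continuous (fun X => h (f (chart g X))).
  move=> /(_ 0%N) /= ch.
  have -> : (fun X => h (f (chart g X))) = (fun X => (fun v : V => h (f (chart g (o v)))) (to_real X)).
    by apply/funext => X; rewrite to_realK.
  exact: (@continuous_comp' _ V R (@to_real R k p p) (fun v => h (f (chart g (o v))))
    (@continuous_to_real R k p p) ch).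
by split=> g Gg; have [h1 h2] := sf g Gg; exact: key.
Qed.

(** The number s p / 2 for a(n) = exp (s H_o), so that a(n)^lambda = exp (lambda height). *)
Definition height v : R := log_a (nbar (o v)) * p%:R / 2.

(** With (1; X) = B T, the Gram determinant is the square of the real determinant of T and the height
    is the logarithm of |det T|. *)
Lemma gram_height v : gram (col_mx 1%:M (o v)) = (expR (height v) ^+ d) ^+ 2.
Proof.
have iX : inj_cols (col_mx 1%:M (o v) : 'M[K]_(p + p, p)) by exact: inj_cols_nbar.
have [x [T [t [xK XE Tu Tt t0]]]] := K_frame hp iX.
have [S [TS _]] : exists S, T *m S = 1%:M /\ S *m T = 1%:M.
  by apply: inj_inv; apply: (@inj_cols_mull _ _ _ _ _ (lsubmx x)); rewrite -XE.
rewrite /height (log_aP hp (group_K_unitary xK) XE TS) abs_det_exp real_normK ?num_real //.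
by rewrite XE (gram_frame _ (unitary_lsub (group_K_unitary xK))).
Qed.

(** This identifies the weight found by the substitution in frames with a(n)^(-2 rho). *)
Lemma weight_height v : weight v = expR (- (2 * rho) * height v).
Proof.
rewrite /weight gram_height -exprM exprVn -exprM mulNr expRN; congr (_^-1).
have -> : 2 * rho = (2 * d * p)%:R by rewrite !natrM mulrA.
by rewrite expRM_natl (mulnC d 2).
Qed.

(** The cosine of n b_o and b_o is 1 / |det T| for (1; X) = B T, as the upper block of B is T^-1.
    Multiplying both subspaces by the same unitary matrix changes nothing. *)
Lemma cos_height x v : group_K x -> abs_cos (chart x (o v)) (act x b_o) = expR (- height v).
Proof.
move=> xK; have [xx xx'] := group_K_unitary xK.
have iZ : inj_cols (x *m col_mx 1%:M (o v)).
  by apply: inj_colsM; [exact: inj_cols_left_inv xx | exact: inj_cols_nbar].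
have CC := unitary_lsub (group_K_unitary xK).
have xE : lsubmx x = x *m col_mx 1%:M 0.
  by rewrite -{2}[x]hsubmxK mul_row_col mulmx1 mulmx0 addr0.
have := abs_cos_grs hp iZ CC; rewrite chartE act_bo.
have -> : adjoint (lsubmx x) *m (x *m col_mx 1%:M (o v)) = 1%:M.
  rewrite xE adjointM mulmxA -(mulmxA _ (adjoint x)) xx mulmx1 adjoint_col mul_row_col.
  by rewrite adjoint1 adjoint0 mul1mx mul0mx addr0.
have -> : gram (x *m col_mx 1%:M (o v)) = gram (col_mx 1%:M (o v)).
  by rewrite /gram adjointM mulmxA -(mulmxA _ (adjoint x)) xx mulmx1.
rewrite det_real1 normr1 gram_height sqrtr_sqr ger0_norm ?exprn_ge0 ?expR_ge0 // div1r -exprVn -expRN.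
move=> /eqP; rewrite eqrXn2 ?abs_cos_ge0 ?expR_ge0 //; last by case: (k).
by move=> /eqP.
Qed.

Lemma expC_height lambda (h : R) : expC ((- lambda - rho%:C) * h%:C) =
  (expC ((lambda - rho%:C) * (- h)%:C)) * (expR (- (2 * rho) * h))%:C :> R[i].
Proof.
case: lambda => a e; apply/eqP; rewrite eq_complex.
rewrite /expC /= !(mulr0, mul0r, addr0, subr0, add0r, oppr0, sub0r).
have -> : - e * h = e * - h by ring.
have -> : expR ((- a - rho) * h) = expR ((a - rho) * - h) * expR (- (2 * rho) * h).
  by rewrite -expRD; congr expR; ring.
by apply/andP; split; apply/eqP; ring.
Qed.

(** The exponent - lambda - rho splits as - (lambda - rho) - 2 rho, and a(n)^-1 is the cosine of
    n b_o and b_o. *)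
Lemma J_integrandE lambda f x v : group_K x ->
  J_integrand lambda f x (nbar (o v)) =
  cos_kernel lambda f (act x b_o) (chart x (o v)) * (weight v)%:C.
Proof.
move=> xK; rewrite /cos_kernel cos_height // /powC gt_eqF ?expR_gt0 // expRK.
rewrite -[LHS]/(expC ((- lambda - rho%:C) * (height v)%:C) * f (chart x (o v))).
rewrite (expC_height lambda (height v)) weight_height.
move: (expC _) (f _) (expR _)%:C => A B C.
by rewrite -!mulrA (mulrC B).
Qed.

Lemma Re_cos_kernel lambda f c b : complex.Re (cos_kernel lambda f c b) =
  kernel_part (lambda - rho%:C) (fun b => complex.Re (f b)) (fun b => complex.Im (f b)) c b.
Proof. by rewrite /cos_kernel /kernel_part; case: powC; case: (f b). Qed.

Lemma Im_cos_kernel lambda f c b : complex.Im (cos_kernel lambda f c b) =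
  kernel_part (lambda - rho%:C) (fun b => complex.Im (f b)) (fun b => - complex.Re (f b)) c b.
Proof. by rewrite /cos_kernel /kernel_part; case: powC => a e; case: (f b) => a' e' /=; ring. Qed.

Variables (db : probability (BorelGr R k p) R) (dn : {measure set (BorelM R k p) -> \bar R}).
Hypothesis hdb : K_invariant db.
Hypothesis hdn : Haar_Nbar dn.
Hypothesis hdn1 : integralC dn (group_Nbar R k p) (fun n => a_pow n (- (2 * rho)%:C)) = 1.
Local Notation Nbar := (group_Nbar R k p).

(** The normalization of the Haar measure says that the weight is a probability density. *)
Lemma haar_coord_weight : (\int[haar_coord dn]_v (weight (k := k) v)%:E = 1)%E.
Proof.
have mw : measurable_fun setT (fun v : BV => (weight (k := k) (p := p) v)%:E : \bar R).
  by apply/measurable_EFinP; exact: measurable_weight.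
have E (y : M2p) : Nbar y -> complex.Re (a_pow y (- (2 * rho)%:C)) = weight (k := k) (lower y).
  move=> Ny; rewrite -{1}(nbar_lower Ny) /a_pow Re_expC weight_height -/(height _) /=.
  by rewrite !(mulr0, mul0r, addr0, subr0, oppr0) cos0 mulr1.
have hR : Rintegral dn Nbar (fun y => complex.Re (a_pow y (- (2 * rho)%:C))) = 1 :> R.
  exact: (congr1 (@complex.Re R) hdn1).
move: hR; rewrite /Rintegral.
rewrite (eq_integral (fun y : BorelM R k p => (weight (k := k) (lower (y : M2p)))%:E)) => [|y]; last first.
  by rewrite inE => Ny; rewrite E.
rewrite (integral_Nbar dn mw).
by case: (\int[_]_v _)%E => [r /= -> //|/= /eqP|/= /eqP]; rewrite eq_sym oner_eq0.
Qed.

(** The integral over the big cell translated by x, which is what the definition of J uses. *)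
Lemma chart_orbit_invariant x : group_K x ->
  invariant_integral (haar_coord dn) (fun v : BV => chart x (o v) : Gr) (weight (k := k)).
Proof.
move=> xK; have [c mu1] := haar_coord_cube hdn.
pose mu : {sigma_finite_measure set _ -> \bar R} := sigma_finite_pack (haar_coord_sigma_finite hdn).
have hw : (\int[mu]_v (weight (k := k) v)%:E = 1)%E.
  by rewrite -haar_coord_weight; apply: eq_measure_integral.
have := bigcell_invariant hp (mu := mu) (haar_coord_tinv hdn) mu1 (haar_coord_cube_gt0 hdn mu1) hw.
move=> /(invariant_integral_act xK) [mw w0 w1 mb inv].
have E v : act x (chart 1%:M (o v)) = chart x (o v) :> Gr.
  by rewrite (chart_act _ (group_K_unitary xK) (group_G_inj (group_KG group_K1))) mulmx1.
split=> //.
- by move=> F cF; have := mb F cF; under eq_fun do rewrite E.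
- move=> F y cF F0 yK; have := inv F y cF F0 yK.
  under eq_integral do rewrite E; under [in RHS]eq_integral do rewrite E.
  exact.
Qed.

(** The density a(n)^(-2 rho) carries Haar measure to the invariant probability measure, on bounded
    limits of continuous functions. *)
Lemma kernel_transfer z u (v : Gr -> R) x : 0 <= complex.Re z ->
  chart_continuous u -> chart_continuous v -> group_K x ->
  let G := kernel_part z u v (act x b_o) in
  let psi w := G (chart x (o w)) * weight w in
  [/\ db.-integrable setT (fun b => (G b)%:E), dn.-integrable Nbar (fun y => (psi (lower y))%:E) &
    Rintegral db setT G = Rintegral dn Nbar (fun y => psi (lower y))].
Proof.
move=> z0 cu cv xK G psi.
have [Fn [M [cFn FM Flim]]] := kernel_limit hp (act x b_o) z0 cu cv.
have idb := probability_invariant hdb; have idn := chart_orbit_invariant xK.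
have [ib _] := invariant_integral_limit idb cFn FM Flim.
have [ip _] := invariant_integral_limit idn cFn FM Flim.
have E := invariant_integral_limit_eq hp idb idn cFn FM Flim.
have mpsi := measurable_int _ ip.
split.
- by move: ib; under eq_fun do rewrite mulr1.
- apply/integrableP; split.
    by apply: measurable_funTS; exact: (measurableT_comp mpsi (@measurable_lower R k p)).
  rewrite (integral_Nbar dn (measurableT_comp (@abse_measurable _ _) mpsi)).
  by have /integrableP [_] := ip.
- rewrite /Rintegral (integral_Nbar dn mpsi) -E.
  by under [in RHS]eq_integral do rewrite mulr1.
Qed.
End HorosphericalCoordinates.

(** * The two transforms *)

Section Transforms.
Context {R : realType} {k : division_algebra} {p : nat}.
Hypothesis hp : (0 < p)%N.
Local Notation Gr := (Gr R k p).
Local Notation M2p := 'M[scalars R k]_(p + p).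
Local Notation rho := (rho R k p).
Local Notation Nbar := (group_Nbar R k p).
Variables (db : probability (BorelGr R k p) R) (dn : {measure set (BorelM R k p) -> \bar R}).
Hypothesis hdb : K_invariant db.
Hypothesis hdn : Haar_Nbar dn.
Hypothesis hdn1 : integralC dn Nbar (fun n => a_pow n (- (2 * rho)%:C)) = 1.
Variable lambda : R[i].
Hypothesis hlambda : rho <= complex.Re lambda.
Variable f : Gr -> R[i].
Hypothesis sf : smooth f.

Lemma exponent_ge0 : 0 <= complex.Re (lambda - rho%:C).
Proof. by move: hlambda; case: lambda => a e /=; rewrite subr_ge0. Qed.

(** Real and imaginary parts of the two integrands correspond under n to x n b_o. *)
Lemma J_cos_transfer x : group_K x ->
  [/\ integrableC dn Nbar (J_integrand lambda f x),
    integrableC db setT (cos_kernel lambda f (act x b_o)) &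
    integralC dn Nbar (J_integrand lambda f x) = Cos_transform db lambda f (act x b_o)].
Proof.
move=> xK; have [cu cv] := smooth_chart_continuous sf.
have cu' : chart_continuous (fun b => - complex.Re (f b)).
  by move=> g Gg X; exact: (cvgN (cu g Gg X)).
have [b1 n1 e1] := kernel_transfer hp hdb hdn hdn1 exponent_ge0 cu cv xK.
have [b2 n2 e2] := kernel_transfer hp hdb hdn hdn1 exponent_ge0 cv cu' xK.
have Re_J (y : M2p) : Nbar y -> complex.Re (J_integrand lambda f x y) =
    kernel_part (lambda - rho%:C) (fun b => complex.Re (f b)) (fun b => complex.Im (f b))
      (act x b_o) (chart x (of_real_row (lower y))) * weight (lower y).
  move=> Ny; rewrite -Re_cos_kernel -{1}(nbar_lower Ny) J_integrandE //.
  by case: (cos_kernel _ _ _ _) => a e /=; rewrite mulr0 subr0.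
have Im_J (y : M2p) : Nbar y -> complex.Im (J_integrand lambda f x y) =
    kernel_part (lambda - rho%:C) (fun b => complex.Im (f b)) (fun b => - complex.Re (f b))
      (act x b_o) (chart x (of_real_row (lower y))) * weight (lower y).
  move=> Ny; rewrite -Im_cos_kernel -{1}(nbar_lower Ny) J_integrandE //.
  by case: (cos_kernel _ _ _ _) => a e /=; rewrite mulr0 add0r.
have mN := @measurable_Nbar R k p.
split.
- split.
    by apply: eq_integrable n1 => // y; rewrite inE => Ny; rewrite Re_J.
  by apply: eq_integrable n2 => // y; rewrite inE => Ny; rewrite Im_J.
- split.
    by apply: eq_integrable b1 => // b _; rewrite Re_cos_kernel.
  by apply: eq_integrable b2 => // b _; rewrite Im_cos_kernel.
rewrite /Cos_transform /integralC; congr (_ +i* _).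
  transitivity (Rintegral db setT (kernel_part (lambda - rho%:C) (fun b => complex.Re (f b))
      (fun b => complex.Im (f b)) (act x b_o))).
    by rewrite e1; apply: eq_Rintegral => y; rewrite inE => Ny; rewrite Re_J.
  by apply: eq_Rintegral => b _; rewrite Re_cos_kernel.
transitivity (Rintegral db setT (kernel_part (lambda - rho%:C) (fun b => complex.Im (f b))
    (fun b => - complex.Re (f b)) (act x b_o))).
  by rewrite e2; apply: eq_Rintegral => y; rewrite inE => Ny; rewrite Im_J.
by apply: eq_Rintegral => b _; rewrite Im_cos_kernel.
Qed.

(** The value of the integral depends on x b_o only, because the cosine transform does. *)
Lemma J_opE b : J_op dn lambda f b = Cos_transform db lambda f b.
Proof.
have [x [xK xb]] := Gr_K hp b; rewrite /J_op; case: xgetP => [z _ /= hz|/(_ (Cos_transform db lambda f b)) []].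
  by rewrite (hz x xK (esym xb)); have [_ _ ->] := J_cos_transfer xK; rewrite -xb.
by move=> y yK yb; have [_ _ ->] := J_cos_transfer yK; rewrite yb.
Qed.

(** The Weyl element turns x b_o into its orthogonal complement. *)
Lemma A_opE b : A_op dn lambda f b = Sin_transform db lambda f b.
Proof.
have key x : group_K x -> act x b_o = b ->
    J_op dn lambda f (act (x *m weyl) b_o) = Sin_transform db lambda f b.
  by move=> xK xb; rewrite J_opE -(perp_act xK) xb.
have [x [xK xb]] := Gr_K hp b; rewrite /A_op; case: xgetP => [z _ /= hz|/(_ (Sin_transform db lambda f b)) []].
  by rewrite (hz x xK (esym xb)) key.
by move=> y yK yb; rewrite key.
Qed.
End Transforms.

Theorem theorem6p2 (R : realType) (k : division_algebra) (p : nat)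
    (hp : (1 <= p)%N)
    (db : probability (BorelGr R k p) R) (hdb : K_invariant db)
    (dn : {measure set (BorelM R k p) -> \bar R}) (hdn : Haar_Nbar dn)
    (hdn1 : integralC dn (group_Nbar R k p)
              (fun n => a_pow n (- (2 * rho R k p)%:C)) = 1)
    (lambda : R[i]) (hlambda : rho R k p <= complex.Re lambda) :
  forall f : Gr R k p -> R[i], smooth f ->
    [/\ forall x, group_K x ->
          integrableC dn (group_Nbar R k p) (J_integrand lambda f x),
        forall c, integrableC db setT (cos_kernel lambda f c) &
        A_op dn lambda f = Sin_transform db lambda f].
Proof.
move=> f sf; split.
- by move=> x xK; have [] := J_cos_transfer hp hdb hdn hdn1 hlambda sf xK.
- move=> c; have [x [xK ->]] := Gr_K hp c.
  by have [] := J_cos_transfer hp hdb hdn hdn1 hlambda sf xK.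
- by apply/funext => b; exact: A_opE.
Qed.
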